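(* Let $\alpha\vdash\sigma(\alpha)$ be an inductively constructed type in which $\alpha$ occurs only positively. Let $\mu\alpha.\sigma(\alpha)=\Pi\alpha.(\sigma(\alpha)\multimap\alpha)\to\alpha$, $\mathit{fold}=\Lambda\alpha.\lambda f{:}\sigma(\alpha)\multimap\alpha.\lambda^\circ u{:}\mu\alpha.\sigma(\alpha).\ u\,\alpha\,(!f)$, and $\mathit{in}:\sigma(\mu\alpha.\sigma(\alpha))\multimap\mu\alpha.\sigma(\alpha)$, $\mathit{in}\,z=\Lambda\alpha.\lambda f{:}\sigma(\alpha)\multimap\alpha.\ f(\sigma(\mathit{fold}\,\alpha\,(!f))\,z)$. Let $\Xi\mid-;-\vdash f:\sigma(\tau)\multimap\tau$ be an algebra and $\Xi\mid-;-\vdash h:\mu\alpha.\sigma(\alpha)\multimap\tau$ a map of algebras from $\mathit{in}$ to $f$, i.e. $h\circ\mathit{in}$ is internally equal to $f\circ\sigma(h)$. Then in LAPL extended with the extensionality schemes and the identity extension schema it is provable that $h=_{\mu\alpha.\sigma(\alpha)\multimap\tau}\mathit{fold}\,\tau\,(!f)$. (Hence $\mathit{in}$ is an initial algebra for the endofunctor of ${\rm LinType}_\Xi$ induced by $\sigma$.)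
   Context: PILL$_Y$ is the polymorphic intuitionistic/linear lambda calculus with fixed points. Types in a context $\Xi$ of type variables are given by $\sigma ::= \alpha \mid I \mid \sigma\otimes\sigma \mid \sigma\multimap\sigma \mid\ !\sigma \mid \Pi\alpha.\sigma$. Terms are typed in judgements $\Xi\mid\Gamma;\Delta\vdash t:\tau$ with an intuitionistic variable context $\Gamma$ and a linear variable context $\Delta$; the constructs are variables, $\star:I$, linear abstraction $\lambda^\circ x{:}\sigma.t$ and application $t\,u$, $t\otimes s$, $!t$ (allowed only when the linear context is empty), type abstraction $\Lambda\alpha.t$ and type application $t\,\sigma$, the eliminations $\mathrm{let}\ x\otimes y = s\ \mathrm{in}\ t$, $\mathrm{let}\ !x = s\ \mathrm{in}\ t$, $\mathrm{let}\ \star = s\ \mathrm{in}\ t$, and a constant $Y:\Pi\alpha.(\alpha\to\alpha)\to\alpha$. Here $\sigma\to\tau$ abbreviates $!\sigma\multimap\tau$ and $\lambda x{:}\sigma.t$ abbreviates $\lambda^\circ y{:}!\sigma.\ \mathrm{let}\ !x=y\ \mathrm{in}\ t$. External equality of terms is generated by the $\beta$- and $\eta$-rules of all constructs, commuting conversions of the let-constructs with linear contexts, congruence, and $f\,(!(Y\,\sigma\,(!f))) = Y\,\sigma\,(!f)$. $g\circ f=\lambda^\circ x.g(f\,x)$. LAPL is an intuitionistic higher-order predicate logic over PILL$_Y$ with contexts $\Xi\mid\Gamma\mid\Theta$, where $\Theta$ declares relation variables and admissible relation variables $R:\mathrm{AdmRel}(\sigma,\tau)$; propositions include internal equality $t=_\sigma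 u$ (externally equal terms are internally equal), $\rho(t,u)$ for definable relations, connectives and quantifiers over types, terms, relations and admissible relations. Admissible relations are a designated class of definable relations containing equality relations and graphs $\langle f\rangle=(x,y).f\,x=y$ of linear terms. Each type $\sigma(\vec\alpha)$ has a relational interpretation $\sigma[\vec\rho]$ at admissible relations $\vec\rho$, with $\alpha_i[\vec\rho]\equiv\rho_i$, $(\sigma\multimap\sigma')[\vec\rho](f,g)\Leftrightarrow\forall x,y.\ \sigma[\vec\rho](x,y)\supset\sigma'[\vec\rho](f\,x,g\,y)$, $(!\sigma)[\vec\rho](!x,!y)$ whenever $\sigma[\vec\rho](x,y)$, and $(\Pi\beta.\sigma)[\vec\rho](t,u)\Leftrightarrow\forall\beta,\beta'.\forall R:\mathrm{AdmRel}(\beta,\beta').\ \sigma[\vec\rho,R](t\,\beta,u\,\beta')$ (and analogous clauses for $\otimes,I$). The extensionality schemes are $(\forall x.\ t\,x=u\,x)\supset t=_{\sigma\multimap\tau}u$ and $(\forall\alpha.\ t\,\alpha=u\,\alpha)\supset t=_{\Pi\alpha.\tau}u$; the identity extension schema is $\forall\vec\alpha.\ \sigma[eq_{\vec\alpha}]\equiv eq_{\sigma(\vec\alpha)}$ for every type $\sigma(\vec\alpha)$, $eq$ denoting internal equality. ${\rm LinType}_\Xi$ is the category with objects types in context $\Xi$ and morphisms terms $\Xi\mid-;-\vdash f:\sigma\multimap\tau$ modulo internal equality provable in LAPL plus extensionality and identity extension. A type is inductively constructed if it is built from type variables and closed types using $\multimap,\otimes,I,!,\Pi$; positive/negative occurrences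 are as usual ($\multimap$ reverses polarity in its argument). For such $\sigma(\alpha)$ with $\alpha$ only positive, the functorial action $\sigma(f):\sigma(\tau)\multimap\sigma(\tau')$ of $f:\tau\multimap\tau'$ is the term defined by structural induction: $\alpha(f)=f$; closed types act by identity; $(\sigma_1\multimap\sigma_2)(f)=\lambda^\circ h.\ \sigma_2(f)\circ h\circ\sigma_1(f)$ (with $\sigma_1(f)$ going backwards since $\alpha$ is negative in $\sigma_1$); $\otimes$ componentwise; $(!\sigma_1)(f)=\lambda^\circ x.\mathrm{let}\ !y=x\ \mathrm{in}\ !(\sigma_1(f)\,y)$; $(\Pi\omega.\sigma_1)(f)=\lambda^\circ z.\Lambda\omega.\sigma_1(f)(z\,\omega)$. *)

(* Defs.v *)
From Stdlib Require Import List Arith Bool.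
Import ListNotations.

(** There are three independent index spaces: type variables, term variables
    and relation variables; index 0 is the innermost binder.  Renamings and
    substitutions act simultaneously on all the index spaces of a sort. *)

Definition scons {A : Type} (a : A) (f : nat -> A) (i : nat) : A :=
  match i with 0 => a | S j => f j end.
Infix ".:" := scons (at level 55, right associativity).

Definition upr (z : nat -> nat) : nat -> nat := 0 .: (fun i => S (z i)).

Fixpoint uprn (k : nat) (z : nat -> nat) : nat -> nat :=
  match k with 0 => z | S k => upr (uprn k z) end.

Inductive ty : Type :=
| TVar (i : nat)
| TOne
| TTen (A B : ty)
| TLol (A B : ty)
| TBang (A : ty)
| TAll (A : ty).

Infix "⊗" := TTen (at level 40, left associativity).
Infix "⊸" := TLol (at level 51, right associativity).

Definition TArr (A B : ty) : ty := TBang A ⊸ B.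

Fixpoint wf_ty (n : nat) (A : ty) : bool :=
  match A with
  | TVar i => i <? n
  | TOne => true
  | A ⊗ B => wf_ty n A && wf_ty n B
  | A ⊸ B => wf_ty n A && wf_ty n B
  | TBang A => wf_ty n A
  | TAll A => wf_ty (S n) A
  end.

Fixpoint ty_ren (x : nat -> nat) (A : ty) : ty :=
  match A with
  | TVar i => TVar (x i)
  | TOne => TOne
  | A ⊗ B => ty_ren x A ⊗ ty_ren x B
  | A ⊸ B => ty_ren x A ⊸ ty_ren x B
  | TBang A => TBang (ty_ren x A)
  | TAll A => TAll (ty_ren (upr x) A)
  end.

Definition upT (th : nat -> ty) : nat -> ty :=
  TVar 0 .: (fun i => ty_ren S (th i)).

Fixpoint ty_sub (th : nat -> ty) (A : ty) : ty :=
  match A with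
  | TVar i => th i
  | TOne => TOne
  | A ⊗ B => ty_sub th A ⊗ ty_sub th B
  | A ⊸ B => ty_sub th A ⊸ ty_sub th B
  | TBang A => TBang (ty_sub th A)
  | TAll A => TAll (ty_sub (upT th) A)
  end.

(** [polarised p a A]: every free occurrence of the variable [a] in [A] is
    positive (if [p = true]), resp. negative (if [p = false]). *)
Fixpoint polarised (p : bool) (a : nat) (A : ty) : bool :=
  match A with
  | TVar i => if i =? a then p else true
  | TOne => true
  | A ⊗ B => polarised p a A && polarised p a B
  | A ⊸ B => polarised (negb p) a A && polarised p a B
  | TBang A => polarised p a A
  | TAll A => polarised p (S a) A
  end.

Inductive ind_constructed : ty -> Prop :=
| ic_var i : ind_constructed (TVar i)
| ic_closed A : wf_ty 0 A = true -> ind_constructed A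
| ic_one : ind_constructed TOne
| ic_ten A B : ind_constructed A -> ind_constructed B -> ind_constructed (A ⊗ B)
| ic_lol A B : ind_constructed A -> ind_constructed B -> ind_constructed (A ⊸ B)
| ic_bang A : ind_constructed A -> ind_constructed (TBang A)
| ic_all A : ind_constructed A -> ind_constructed (TAll A).

(** The three let-constructs share the constructor [Let p s t], where the
    pattern [p] binds [arity p] variables in [t]; in [let x ⊗ y = s in t] the
    variable [x] has index 1 and [y] has index 0. *)

Inductive pat : Type := PStar | PTen | PBang.

Definition arity (p : pat) : nat :=
  match p with PStar => 0 | PTen => 2 | PBang => 1 end.

Inductive tm : Type :=
| Var (i : nat)
| Star
| YC
| Lam (A : ty) (t : tm)
| App (t u : tm)
| Pair (t u : tm)
| Bang (t : tm)
| TLam (t : tm)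
| TApp (t : tm) (A : ty)
| Let (p : pat) (s t : tm).

Fixpoint tm_ren (x z : nat -> nat) (t : tm) : tm :=
  match t with
  | Var i => Var (z i)
  | Star => Star
  | YC => YC
  | Lam A t => Lam (ty_ren x A) (tm_ren x (upr z) t)
  | App t u => App (tm_ren x z t) (tm_ren x z u)
  | Pair t u => Pair (tm_ren x z t) (tm_ren x z u)
  | Bang t => Bang (tm_ren x z t)
  | TLam t => TLam (tm_ren (upr x) z t)
  | TApp t A => TApp (tm_ren x z t) (ty_ren x A)
  | Let p s t => Let p (tm_ren x z s) (tm_ren x (uprn (arity p) z) t)
  end.

Definition tm_wk (k : nat) (t : tm) : tm := tm_ren id (Nat.add k) t.

Definition upV (s : nat -> tm) : nat -> tm := Var 0 .: (fun i => tm_wk 1 (s i)).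

Fixpoint upVn (k : nat) (s : nat -> tm) : nat -> tm :=
  match k with 0 => s | S k => upV (upVn k s) end.

Fixpoint tm_sub (th : nat -> ty) (s : nat -> tm) (t : tm) : tm :=
  match t with
  | Var i => s i
  | Star => Star
  | YC => YC
  | Lam A t => Lam (ty_sub th A) (tm_sub th (upV s) t)
  | App t u => App (tm_sub th s t) (tm_sub th s u)
  | Pair t u => Pair (tm_sub th s t) (tm_sub th s u)
  | Bang t => Bang (tm_sub th s t)
  | TLam t => TLam (tm_sub (upT th) (fun i => tm_ren S id (s i)) t)
  | TApp t A => TApp (tm_sub th s t) (ty_sub th A)
  | Let p u t => Let p (tm_sub th s u) (tm_sub th (upVn (arity p) s) t)
  end.

Definition idtm (A : ty) : tm := Lam A (Var 0).

(** [comp A g f] is [g ∘ f], where [A] is the domain of [f]. *)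
Definition comp (A : ty) (g f : tm) : tm :=
  Lam A (App (tm_wk 1 g) (App (tm_wk 1 f) (Var 0))).

(** The intuitionistic abstraction [λ x : A. t]; the renaming makes room for
    the auxiliary linear variable of type [!A]. *)
Definition ILam (A : ty) (t : tm) : tm :=
  Lam (TBang A) (Let PBang (Var 0) (tm_ren id (0 .: (fun i => S (S i))) t)).

(** A two-zone context [Γ; Δ] is one list of slots.  [SInt A] is an
    intuitionistic variable and [SLin A] a linear one.  [SUsed] is the slot
    of a linear variable that belongs to another branch of a context split:
    it keeps the indices aligned and cannot be referred to. *)

Inductive slot : Type :=
| SInt (A : ty)
| SLin (A : ty)
| SUsed.

Definition slot_ren (x : nat -> nat) (s : slot) : slot :=
  match s with
  | SInt A => SInt (ty_ren x A)
  | SLin A => SLin (ty_ren x A)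
  | SUsed => SUsed
  end.

Inductive split : list slot -> list slot -> list slot -> Prop :=
| split_nil : split [] [] []
| split_int A G G1 G2 : split G G1 G2 ->
    split (SInt A :: G) (SInt A :: G1) (SInt A :: G2)
| split_linl A G G1 G2 : split G G1 G2 ->
    split (SLin A :: G) (SLin A :: G1) (SUsed :: G2)
| split_linr A G G1 G2 : split G G1 G2 ->
    split (SLin A :: G) (SUsed :: G1) (SLin A :: G2)
| split_used G G1 G2 : split G G1 G2 ->
    split (SUsed :: G) (SUsed :: G1) (SUsed :: G2).

Definition nolin (G : list slot) : Prop :=
  forall i A, nth_error G i <> Some (SLin A).

(** [pat_ty p A D]: the pattern [p] matches values of type [A] and binds the
    variables [D]. *)
Inductive pat_ty : pat -> ty -> list slot -> Prop :=
| pt_star : pat_ty PStar TOne []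
| pt_ten A B : pat_ty PTen (A ⊗ B) [SLin B; SLin A]
| pt_bang A : pat_ty PBang (TBang A) [SInt A].

Inductive hasty : nat -> list slot -> tm -> ty -> Prop :=
| ht_int n G i A :
    nth_error G i = Some (SInt A) -> nolin G ->
    hasty n G (Var i) A
| ht_lin n G i A :
    nth_error G i = Some (SLin A) ->
    (forall j B, nth_error G j = Some (SLin B) -> j = i) ->
    hasty n G (Var i) A
| ht_star n G : nolin G -> hasty n G Star TOne
| ht_Y n G : nolin G ->
    hasty n G YC (TAll (TArr (TArr (TVar 0) (TVar 0)) (TVar 0)))
| ht_lam n G A B t :
    wf_ty n A = true -> hasty n (SLin A :: G) t B ->
    hasty n G (Lam A t) (A ⊸ B)
| ht_app n G G1 G2 A B t u :
    split G G1 G2 -> hasty n G1 t (A ⊸ B) -> hasty n G2 u A ->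
    hasty n G (App t u) B
| ht_pair n G G1 G2 A B t u :
    split G G1 G2 -> hasty n G1 t A -> hasty n G2 u B ->
    hasty n G (Pair t u) (A ⊗ B)
| ht_bang n G A t :
    nolin G -> hasty n G t A -> hasty n G (Bang t) (TBang A)
| ht_tlam n G A t :
    hasty (S n) (map (slot_ren S) G) t A -> hasty n G (TLam t) (TAll A)
| ht_tapp n G A B t :
    hasty n G t (TAll A) -> wf_ty n B = true ->
    hasty n G (TApp t B) (ty_sub (B .: TVar) A)
| ht_let n G G1 G2 p A D B s t :
    split G G1 G2 -> hasty n G1 s A -> pat_ty p A D ->
    hasty n (D ++ G2) t B ->
    hasty n G (Let p s t) B.

(** Linear contexts: term contexts whose hole is not in the scope of a [!]. *)
Inductive lctx : Type :=
| CHole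
| CLam (A : ty) (C : lctx)
| CAppL (C : lctx) (t : tm)
| CAppR (t : tm) (C : lctx)
| CPairL (C : lctx) (t : tm)
| CPairR (t : tm) (C : lctx)
| CTLam (C : lctx)
| CTApp (C : lctx) (A : ty)
| CLetL (p : pat) (C : lctx) (t : tm)
| CLetR (p : pat) (s : tm) (C : lctx).

Fixpoint plug (C : lctx) (u : tm) : tm :=
  match C with
  | CHole => u
  | CLam A C => Lam A (plug C u)
  | CAppL C t => App (plug C u) t
  | CAppR t C => App t (plug C u)
  | CPairL C t => Pair (plug C u) t
  | CPairR t C => Pair t (plug C u)
  | CTLam C => TLam (plug C u)
  | CTApp C A => TApp (plug C u) A
  | CLetL p C t => Let p (plug C u) t
  | CLetR p s C => Let p s (plug C u)
  end.

(** Numbers of term variables and of type variables bound above the hole. *)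
Fixpoint vdepth (C : lctx) : nat :=
  match C with
  | CHole => 0
  | CLam _ C => S (vdepth C)
  | CAppL C _ | CAppR _ C | CPairL C _ | CPairR _ C
  | CTLam C | CTApp C _ | CLetL _ C _ => vdepth C
  | CLetR p _ C => arity p + vdepth C
  end.

Fixpoint tdepth (C : lctx) : nat :=
  match C with
  | CHole => 0
  | CTLam C => S (tdepth C)
  | CLam _ C | CAppL C _ | CAppR _ C | CPairL C _ | CPairR _ C
  | CTApp C _ | CLetL _ C _ | CLetR _ _ C => tdepth C
  end.

Fixpoint lctx_ren (z : nat -> nat) (C : lctx) : lctx :=
  match C with
  | CHole => CHole
  | CLam A C => CLam A (lctx_ren (upr z) C)
  | CAppL C t => CAppL (lctx_ren z C) (tm_ren id z t)
  | CAppR t C => CAppR (tm_ren id z t) (lctx_ren z C)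
  | CPairL C t => CPairL (lctx_ren z C) (tm_ren id z t)
  | CPairR t C => CPairR (tm_ren id z t) (lctx_ren z C)
  | CTLam C => CTLam (lctx_ren z C)
  | CTApp C A => CTApp (lctx_ren z C) A
  | CLetL p C t => CLetL p (lctx_ren z C) (tm_ren id (uprn (arity p) z) t)
  | CLetR p s C => CLetR p (tm_ren id z s) (lctx_ren (uprn (arity p) z) C)
  end.

(** Exchanges the innermost block of [b] variables with the next block of [k]
    variables. *)
Definition swap (b k i : nat) : nat :=
  if i <? b then i + k else if i <? b + k then i - b else i.

(** The generating equations, on raw terms; [ext] below only uses the
    instances both sides of which are well typed.  The commuting conversion
    [eq_comm] reads [let p = s in C[u] = C[let p = s in u]]: weakening [s] and
    [C] expresses that [C] captures no variable of [s] and does not mention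
    the variables bound by [p]. *)
Inductive base_eq : tm -> tm -> Prop :=
| beta_lol A t u :
    base_eq (App (Lam A t) u) (tm_sub TVar (u .: Var) t)
| beta_all t A :
    base_eq (TApp (TLam t) A) (tm_sub (A .: TVar) Var t)
| beta_star t :
    base_eq (Let PStar Star t) t
| beta_ten s u t :
    base_eq (Let PTen (Pair s u) t) (tm_sub TVar (u .: s .: Var) t)
| beta_bang u t :
    base_eq (Let PBang (Bang u) t) (tm_sub TVar (u .: Var) t)
| eta_lol A t :
    base_eq (Lam A (App (tm_wk 1 t) (Var 0))) t
| eta_all t :
    base_eq (TLam (TApp (tm_ren S id t) (TVar 0))) t
| eta_star t :
    base_eq (Let PStar t Star) t
| eta_ten t :
    base_eq (Let PTen t (Pair (Var 1) (Var 0))) t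
| eta_bang t :
    base_eq (Let PBang t (Bang (Var 0))) t
| eq_comm p s C u :
    base_eq
      (Let p s (plug (lctx_ren (Nat.add (arity p)) C)
                     (tm_ren id (swap (arity p) (vdepth C)) u)))
      (plug C (Let p (tm_ren (Nat.add (tdepth C)) (Nat.add (vdepth C)) s) u))
| eq_Y A f :
    base_eq (App f (Bang (App (TApp YC A) (Bang f)))) (App (TApp YC A) (Bang f)).

Inductive ext : nat -> list slot -> tm -> tm -> ty -> Prop :=
| ext_base n G t u A :
    hasty n G t A -> hasty n G u A -> base_eq t u -> ext n G t u A
| ext_refl n G t A : hasty n G t A -> ext n G t t A
| ext_sym n G t u A : ext n G t u A -> ext n G u t A
| ext_trans n G t u v A : ext n G t u A -> ext n G u v A -> ext n G t v A
| ext_lam n G A B t t' :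
    wf_ty n A = true -> ext n (SLin A :: G) t t' B ->
    ext n G (Lam A t) (Lam A t') (A ⊸ B)
| ext_app n G G1 G2 A B t t' u u' :
    split G G1 G2 -> ext n G1 t t' (A ⊸ B) -> ext n G2 u u' A ->
    ext n G (App t u) (App t' u') B
| ext_pair n G G1 G2 A B t t' u u' :
    split G G1 G2 -> ext n G1 t t' A -> ext n G2 u u' B ->
    ext n G (Pair t u) (Pair t' u') (A ⊗ B)
| ext_bang n G A t t' :
    nolin G -> ext n G t t' A -> ext n G (Bang t) (Bang t') (TBang A)
| ext_tlam n G A t t' :
    ext (S n) (map (slot_ren S) G) t t' A ->
    ext n G (TLam t) (TLam t') (TAll A)
| ext_tapp n G A B t t' :
    ext n G t t' (TAll A) -> wf_ty n B = true ->
    ext n G (TApp t B) (TApp t' B) (ty_sub (B .: TVar) A)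
| ext_let n G G1 G2 p A D B s s' t t' :
    split G G1 G2 -> ext n G1 s s' A -> pat_ty p A D ->
    ext n (D ++ G2) t t' B ->
    ext n G (Let p s t) (Let p s' t') B.

Inductive kind : Type := KRel | KAdm.

(** [RAbs A B φ] is [(x : A, y : B). φ], with [x] at index 1 and [y] at
    index 0. *)
Inductive prop : Type :=
| PEq (A : ty) (t u : tm)
| PRel (r : rel) (t u : tm)
| PBot
| PTop
| PImp (f g : prop)
| PAnd (f g : prop)
| POr (f g : prop)
| PAllT (f : prop)
| PAllV (A : ty) (f : prop)
| PAllR (k : kind) (A B : ty) (f : prop)
| PExT (f : prop)
| PExV (A : ty) (f : prop)
| PExR (k : kind) (A B : ty) (f : prop)
with rel : Type :=
| RVar (i : nat)
| RAbs (A B : ty) (f : prop).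

Definition PIff (f g : prop) : prop := PAnd (PImp f g) (PImp g f).

Fixpoint prop_ren (x z e : nat -> nat) (f : prop) : prop :=
  match f with
  | PEq A t u => PEq (ty_ren x A) (tm_ren x z t) (tm_ren x z u)
  | PRel r t u => PRel (rel_ren x z e r) (tm_ren x z t) (tm_ren x z u)
  | PBot => PBot
  | PTop => PTop
  | PImp f g => PImp (prop_ren x z e f) (prop_ren x z e g)
  | PAnd f g => PAnd (prop_ren x z e f) (prop_ren x z e g)
  | POr f g => POr (prop_ren x z e f) (prop_ren x z e g)
  | PAllT f => PAllT (prop_ren (upr x) z e f)
  | PAllV A f => PAllV (ty_ren x A) (prop_ren x (upr z) e f)
  | PAllR k A B f => PAllR k (ty_ren x A) (ty_ren x B) (prop_ren x z (upr e) f)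
  | PExT f => PExT (prop_ren (upr x) z e f)
  | PExV A f => PExV (ty_ren x A) (prop_ren x (upr z) e f)
  | PExR k A B f => PExR k (ty_ren x A) (ty_ren x B) (prop_ren x z (upr e) f)
  end
with rel_ren (x z e : nat -> nat) (r : rel) : rel :=
  match r with
  | RVar i => RVar (e i)
  | RAbs A B f => RAbs (ty_ren x A) (ty_ren x B) (prop_ren x (upr (upr z)) e f)
  end.

Definition prop_wk (k : nat) (f : prop) : prop := prop_ren id (Nat.add k) id f.
Definition rel_wk (k : nat) (r : rel) : rel := rel_ren id (Nat.add k) id r.

Fixpoint prop_sub (th : nat -> ty) (s : nat -> tm) (q : nat -> rel) (f : prop)
  : prop :=
  match f with
  | PEq A t u => PEq (ty_sub th A) (tm_sub th s t) (tm_sub th s u)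
  | PRel r t u => PRel (rel_sub th s q r) (tm_sub th s t) (tm_sub th s u)
  | PBot => PBot
  | PTop => PTop
  | PImp f g => PImp (prop_sub th s q f) (prop_sub th s q g)
  | PAnd f g => PAnd (prop_sub th s q f) (prop_sub th s q g)
  | POr f g => POr (prop_sub th s q f) (prop_sub th s q g)
  | PAllT f =>
      PAllT (prop_sub (upT th) (fun i => tm_ren S id (s i))
                      (fun i => rel_ren S id id (q i)) f)
  | PAllV A f =>
      PAllV (ty_sub th A) (prop_sub th (upV s) (fun i => rel_wk 1 (q i)) f)
  | PAllR k A B f =>
      PAllR k (ty_sub th A) (ty_sub th B)
            (prop_sub th s (RVar 0 .: (fun i => rel_ren id id S (q i))) f)
  | PExT f =>
      PExT (prop_sub (upT th) (fun i => tm_ren S id (s i))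
                     (fun i => rel_ren S id id (q i)) f)
  | PExV A f =>
      PExV (ty_sub th A) (prop_sub th (upV s) (fun i => rel_wk 1 (q i)) f)
  | PExR k A B f =>
      PExR k (ty_sub th A) (ty_sub th B)
           (prop_sub th s (RVar 0 .: (fun i => rel_ren id id S (q i))) f)
  end
with rel_sub (th : nat -> ty) (s : nat -> tm) (q : nat -> rel) (r : rel) : rel :=
  match r with
  | RVar i => q i
  | RAbs A B f =>
      RAbs (ty_sub th A) (ty_sub th B)
           (prop_sub th (upVn 2 s) (fun i => rel_wk 2 (q i)) f)
  end.

Definition rctx : Type := list (kind * ty * ty).

Definition rctx_ren (x : nat -> nat) (T : rctx) : rctx :=
  map (fun '(k, A, B) => (k, ty_ren x A, ty_ren x B)) T.

(** The term variables of the logic are all intuitionistic. *)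
Definition hasty_i (n : nat) (G : list ty) (t : tm) (A : ty) : Prop :=
  hasty n (map SInt G) t A.

Inductive wf_prop : nat -> list ty -> rctx -> prop -> Prop :=
| wf_eq n G T A t u :
    hasty_i n G t A -> hasty_i n G u A -> wf_prop n G T (PEq A t u)
| wf_rel_app n G T r A B t u :
    wf_rel n G T r A B -> hasty_i n G t A -> hasty_i n G u B ->
    wf_prop n G T (PRel r t u)
| wf_bot n G T : wf_prop n G T PBot
| wf_top n G T : wf_prop n G T PTop
| wf_imp n G T f g :
    wf_prop n G T f -> wf_prop n G T g -> wf_prop n G T (PImp f g)
| wf_and n G T f g :
    wf_prop n G T f -> wf_prop n G T g -> wf_prop n G T (PAnd f g)
| wf_or n G T f g :
    wf_prop n G T f -> wf_prop n G T g -> wf_prop n G T (POr f g)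
| wf_allT n G T f :
    wf_prop (S n) (map (ty_ren S) G) (rctx_ren S T) f ->
    wf_prop n G T (PAllT f)
| wf_allV n G T A f :
    wf_ty n A = true -> wf_prop n (A :: G) T f -> wf_prop n G T (PAllV A f)
| wf_allR n G T k A B f :
    wf_ty n A = true -> wf_ty n B = true ->
    wf_prop n G ((k, A, B) :: T) f -> wf_prop n G T (PAllR k A B f)
| wf_exT n G T f :
    wf_prop (S n) (map (ty_ren S) G) (rctx_ren S T) f ->
    wf_prop n G T (PExT f)
| wf_exV n G T A f :
    wf_ty n A = true -> wf_prop n (A :: G) T f -> wf_prop n G T (PExV A f)
| wf_exR n G T k A B f :
    wf_ty n A = true -> wf_ty n B = true ->
    wf_prop n G ((k, A, B) :: T) f -> wf_prop n G T (PExR k A B f)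
with wf_rel : nat -> list ty -> rctx -> rel -> ty -> ty -> Prop :=
| wf_rvar n G T i k A B :
    nth_error T i = Some (k, A, B) -> wf_rel n G T (RVar i) A B
| wf_rabs n G T A B f :
    wf_ty n A = true -> wf_ty n B = true ->
    wf_prop n (B :: A :: G) T f -> wf_rel n G T (RAbs A B f) A B.

Definition req (A : ty) : rel := RAbs A A (PEq A (Var 1) (Var 0)).

Definition graph (A B : ty) (f : tm) : rel :=
  RAbs A B (PEq B (App (tm_wk 2 f) (Var 1)) (Var 0)).

Definition reindex (A B : ty) (f g : tm) (r : rel) : rel :=
  RAbs A B (PRel (rel_wk 2 r) (App (tm_wk 2 f) (Var 1)) (App (tm_wk 2 g) (Var 0))).

(** [r ≡ r'], for relations between [A] and [B]. *)
Definition requiv (A B : ty) (r r' : rel) : prop :=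
  PAllV A (PAllV B (PIff (PRel (rel_wk 2 r) (Var 1) (Var 0))
                         (PRel (rel_wk 2 r') (Var 1) (Var 0)))).

(** [r ⊸ r'] for [r] between [A] and [A'] and [r'] between [B] and [B']. *)
Definition rlol (A A' B B' : ty) (r r' : rel) : rel :=
  RAbs (A ⊸ B) (A' ⊸ B')
    (PAllV A (PAllV A'
       (PImp (PRel (rel_wk 4 r) (Var 1) (Var 0))
             (PRel (rel_wk 4 r') (App (Var 3) (Var 1)) (App (Var 2) (Var 0)))))).

(** [r → r'], relating [f] and [g] if [r(x, y)] implies [r'(f !x, g !y)]. *)
Definition rarr (A A' B B' : ty) (r r' : rel) : rel :=
  RAbs (TArr A B) (TArr A' B')
    (PAllV A (PAllV A'
       (PImp (PRel (rel_wk 4 r) (Var 1) (Var 0))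
             (PRel (rel_wk 4 r') (App (Var 3) (Bang (Var 1)))
                                 (App (Var 2) (Bang (Var 0))))))).

(** [∀ (α, β, R : AdmRel(α, β)). r], between [Πα. A] and [Πβ. A']; in [r] the
    type variables [α] and [β] have indices 1 and 0. *)
Definition rall (A A' : ty) (r : rel) : rel :=
  RAbs (TAll A) (TAll A')
    (PAllT (PAllT (PAllR KAdm (TVar 1) (TVar 0)
       (PRel (rel_wk 2 r) (TApp (Var 1) (TVar 1)) (TApp (Var 0) (TVar 0)))))).

(** The clauses for [⊗], [I] and [!] pull relations back along the canonical
    maps into the polymorphic encodings
      [A ⊗ B ⊸ Πα. (A ⊸ B ⊸ α) ⊸ α],  [I ⊸ Πα. α ⊸ α],
      [!A ⊸ Πα. (A → α) ⊸ α]. *)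

Definition ty_wk2 (A : ty) : ty := ty_ren (Nat.add 2) A.

(** Weakening into the scope of [∀ (α, β, R)]. *)
Definition rel_wkall (r : rel) : rel := rel_ren (Nat.add 2) id S r.

Definition enc_ten (A B : ty) : tm :=
  Lam (A ⊗ B) (Let PTen (Var 0)
    (TLam (Lam (ty_ren S A ⊸ ty_ren S B ⊸ TVar 0)
       (App (App (Var 0) (Var 2)) (Var 1))))).

Definition rten (A A' B B' : ty) (r r' : rel) : rel :=
  reindex (A ⊗ B) (A' ⊗ B') (enc_ten A B) (enc_ten A' B')
    (rall ((ty_ren S A ⊸ ty_ren S B ⊸ TVar 0) ⊸ TVar 0)
          ((ty_ren S A' ⊸ ty_ren S B' ⊸ TVar 0) ⊸ TVar 0)
          (rlol (ty_wk2 A ⊸ ty_wk2 B ⊸ TVar 1) (ty_wk2 A' ⊸ ty_wk2 B' ⊸ TVar 0)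
                (TVar 1) (TVar 0)
             (rlol (ty_wk2 A) (ty_wk2 A') (ty_wk2 B ⊸ TVar 1) (ty_wk2 B' ⊸ TVar 0)
                (rel_wkall r)
                (rlol (ty_wk2 B) (ty_wk2 B') (TVar 1) (TVar 0)
                   (rel_wkall r') (RVar 0)))
             (RVar 0))).

Definition enc_one : tm :=
  Lam TOne (Let PStar (Var 0) (TLam (Lam (TVar 0) (Var 0)))).

Definition rone : rel :=
  reindex TOne TOne enc_one enc_one
    (rall (TVar 0 ⊸ TVar 0) (TVar 0 ⊸ TVar 0)
          (rlol (TVar 1) (TVar 0) (TVar 1) (TVar 0) (RVar 0) (RVar 0))).

Definition enc_bang (A : ty) : tm :=
  Lam (TBang A) (TLam (Lam (TArr (ty_ren S A) (TVar 0)) (App (Var 0) (Var 1)))).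

Definition rbang (A A' : ty) (r : rel) : rel :=
  reindex (TBang A) (TBang A') (enc_bang A) (enc_bang A')
    (rall (TArr (ty_ren S A) (TVar 0) ⊸ TVar 0)
          (TArr (ty_ren S A') (TVar 0) ⊸ TVar 0)
          (rlol (TArr (ty_wk2 A) (TVar 1)) (TArr (ty_wk2 A') (TVar 0))
                (TVar 1) (TVar 0)
             (rarr (ty_wk2 A) (ty_wk2 A') (TVar 1) (TVar 0)
                (rel_wkall r) (RVar 0))
             (RVar 0))).

(** The relational interpretation [A[r_0, r_1, ...]], where the relation [r i]
    for the [i]-th type variable lies between the types [th i] and [th' i];
    the result lies between [ty_sub th A] and [ty_sub th' A]. *)
Fixpoint interp (th th' : nat -> ty) (r : nat -> rel) (A : ty) : rel :=
  match A with
  | TVar i => r i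
  | TOne => rone
  | A ⊗ B =>
      rten (ty_sub th A) (ty_sub th' A) (ty_sub th B) (ty_sub th' B)
           (interp th th' r A) (interp th th' r B)
  | A ⊸ B =>
      rlol (ty_sub th A) (ty_sub th' A) (ty_sub th B) (ty_sub th' B)
           (interp th th' r A) (interp th th' r B)
  | TBang A => rbang (ty_sub th A) (ty_sub th' A) (interp th th' r A)
  | TAll A =>
      rall (ty_sub (upT th) A) (ty_sub (upT th') A)
           (interp (TVar 1 .: (fun i => ty_wk2 (th i)))
                   (TVar 0 .: (fun i => ty_wk2 (th' i)))
                   (RVar 0 .: (fun i => rel_wkall (r i))) A)
  end.

(** [defrel Ax n G T k r A B] is the formation judgement of definable
    ([k = KRel]) and of admissible ([k = KAdm]) relations;
    [prv Ax n G T H f] is provability of [f] from the hypotheses [H] in the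
    context [Ξ | Γ | Θ = n | G | T].  The two are mutually inductive, since
    admissibility is invariant under provable equivalence.  [Ax] collects the
    axioms by which the logic is extended. *)

Section Logic.

Variable Ax : nat -> list ty -> rctx -> prop -> Prop.

Inductive defrel : nat -> list ty -> rctx -> kind -> rel -> ty -> ty -> Prop :=
| dr_rel n G T r A B :
    wf_rel n G T r A B -> defrel n G T KRel r A B
| adm_var n G T i A B :
    nth_error T i = Some (KAdm, A, B) -> defrel n G T KAdm (RVar i) A B
| adm_eq n G T A :
    wf_ty n A = true -> defrel n G T KAdm (req A) A A
| adm_graph n G T A B f :
    wf_ty n A = true -> wf_ty n B = true -> hasty_i n G f (A ⊸ B) ->
    defrel n G T KAdm (graph A B f) A B
| adm_reindex n G T r A B A' B' f g :
    defrel n G T KAdm r A B ->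
    wf_ty n A' = true -> wf_ty n B' = true ->
    hasty_i n G f (A' ⊸ A) -> hasty_i n G g (B' ⊸ B) ->
    defrel n G T KAdm (reindex A' B' f g r) A' B'
| adm_and n G T r r' A B :
    defrel n G T KAdm r A B -> defrel n G T KAdm r' A B ->
    defrel n G T KAdm
      (RAbs A B (PAnd (PRel (rel_wk 2 r) (Var 1) (Var 0))
                      (PRel (rel_wk 2 r') (Var 1) (Var 0)))) A B
| adm_op n G T r A B :
    defrel n G T KAdm r A B ->
    defrel n G T KAdm (RAbs B A (PRel (rel_wk 2 r) (Var 0) (Var 1))) B A
| adm_top n G T A B :
    wf_ty n A = true -> wf_ty n B = true ->
    defrel n G T KAdm (RAbs A B PTop) A B
| adm_imp n G T f r A B :
    wf_prop n G T f -> defrel n G T KAdm r A B ->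
    defrel n G T KAdm
      (RAbs A B (PImp (prop_wk 2 f) (PRel (rel_wk 2 r) (Var 1) (Var 0)))) A B
| adm_allT n G T r A B :
    wf_ty n A = true -> wf_ty n B = true ->
    defrel (S n) (map (ty_ren S) G) (rctx_ren S T) KAdm r (ty_ren S A) (ty_ren S B) ->
    defrel n G T KAdm
      (RAbs A B (PAllT (PRel (rel_wk 2 r) (Var 1) (Var 0)))) A B
| adm_allV n G T C r A B :
    wf_ty n C = true ->
    defrel n (C :: G) T KAdm r A B ->
    defrel n G T KAdm
      (RAbs A B (PAllV C (PRel (rel_ren id (upr (Nat.add 2)) id r) (Var 2) (Var 1)))) A B
| adm_allR n G T k C D r A B :
    wf_ty n C = true -> wf_ty n D = true ->
    defrel n G ((k, C, D) :: T) KAdm r A B ->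
    defrel n G T KAdm
      (RAbs A B (PAllR k C D (PRel (rel_wk 2 r) (Var 1) (Var 0)))) A B
| adm_equiv n G T r r' A B :
    defrel n G T KAdm r A B -> wf_rel n G T r' A B ->
    prv n G T [] (requiv A B r r') ->
    defrel n G T KAdm r' A B

with prv : nat -> list ty -> rctx -> list prop -> prop -> Prop :=
| prv_Ax n G T H f : Ax n G T f -> prv n G T H f
| prv_hyp n G T H f : In f H -> prv n G T H f
| prv_topI n G T H : prv n G T H PTop
| prv_botE n G T H f : prv n G T H PBot -> wf_prop n G T f -> prv n G T H f
| prv_impI n G T H f g :
    wf_prop n G T f -> prv n G T (f :: H) g -> prv n G T H (PImp f g)
| prv_impE n G T H f g :
    prv n G T H (PImp f g) -> prv n G T H f -> prv n G T H g
| prv_andI n G T H f g :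
    prv n G T H f -> prv n G T H g -> prv n G T H (PAnd f g)
| prv_andE1 n G T H f g : prv n G T H (PAnd f g) -> prv n G T H f
| prv_andE2 n G T H f g : prv n G T H (PAnd f g) -> prv n G T H g
| prv_orI1 n G T H f g :
    prv n G T H f -> wf_prop n G T g -> prv n G T H (POr f g)
| prv_orI2 n G T H f g :
    wf_prop n G T f -> prv n G T H g -> prv n G T H (POr f g)
| prv_orE n G T H f g h :
    prv n G T H (POr f g) -> prv n G T (f :: H) h -> prv n G T (g :: H) h ->
    prv n G T H h
| prv_allTI n G T H f :
    prv (S n) (map (ty_ren S) G) (rctx_ren S T) (map (prop_ren S id id) H) f ->
    prv n G T H (PAllT f)
| prv_allTE n G T H f A :
    prv n G T H (PAllT f) -> wf_ty n A = true ->
    prv n G T H (prop_sub (A .: TVar) Var RVar f)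
| prv_exTI n G T H f A :
    wf_prop n G T (PExT f) -> wf_ty n A = true ->
    prv n G T H (prop_sub (A .: TVar) Var RVar f) ->
    prv n G T H (PExT f)
| prv_exTE n G T H f g :
    prv n G T H (PExT f) -> wf_prop n G T g ->
    prv (S n) (map (ty_ren S) G) (rctx_ren S T)
        (f :: map (prop_ren S id id) H) (prop_ren S id id g) ->
    prv n G T H g
| prv_allVI n G T H A f :
    wf_ty n A = true -> prv n (A :: G) T (map (prop_wk 1) H) f ->
    prv n G T H (PAllV A f)
| prv_allVE n G T H A f t :
    prv n G T H (PAllV A f) -> hasty_i n G t A ->
    prv n G T H (prop_sub TVar (t .: Var) RVar f)
| prv_exVI n G T H A f t :
    wf_prop n G T (PExV A f) -> hasty_i n G t A ->
    prv n G T H (prop_sub TVar (t .: Var) RVar f) ->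
    prv n G T H (PExV A f)
| prv_exVE n G T H A f g :
    prv n G T H (PExV A f) -> wf_prop n G T g ->
    prv n (A :: G) T (f :: map (prop_wk 1) H) (prop_wk 1 g) ->
    prv n G T H g
| prv_allRI n G T H k A B f :
    wf_ty n A = true -> wf_ty n B = true ->
    prv n G ((k, A, B) :: T) (map (prop_ren id id S) H) f ->
    prv n G T H (PAllR k A B f)
| prv_allRE n G T H k A B f r :
    prv n G T H (PAllR k A B f) -> defrel n G T k r A B ->
    prv n G T H (prop_sub TVar Var (r .: RVar) f)
| prv_exRI n G T H k A B f r :
    wf_prop n G T (PExR k A B f) -> defrel n G T k r A B ->
    prv n G T H (prop_sub TVar Var (r .: RVar) f) ->
    prv n G T H (PExR k A B f)
| prv_exRE n G T H k A B f g :
    prv n G T H (PExR k A B f) -> wf_prop n G T g ->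
    prv n G ((k, A, B) :: T) (f :: map (prop_ren id id S) H) (prop_ren id id S g) ->
    prv n G T H g
| prv_rabs n G T H A B f t u :
    wf_rel n G T (RAbs A B f) A B -> hasty_i n G t A -> hasty_i n G u B ->
    prv n G T H (PIff (PRel (RAbs A B f) t u)
                      (prop_sub TVar (u .: t .: Var) RVar f))
| prv_ext n G T H A t u :
    ext n (map SInt G) t u A -> prv n G T H (PEq A t u)
| prv_repl n G T H A t u f :
    prv n G T H (PEq A t u) -> wf_prop n (A :: G) T f ->
    prv n G T H (prop_sub TVar (t .: Var) RVar f) ->
    prv n G T H (prop_sub TVar (u .: Var) RVar f).

End Logic.

Fixpoint PAllTn (m : nat) (f : prop) : prop :=
  match m with 0 => f | S m => PAllT (PAllTn m f) end.

Inductive ext_ie : nat -> list ty -> rctx -> prop -> Prop :=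
| ax_ext_lol n G T A B t u :
    hasty_i n G t (A ⊸ B) -> hasty_i n G u (A ⊸ B) ->
    ext_ie n G T
      (PImp (PAllV A (PEq B (App (tm_wk 1 t) (Var 0)) (App (tm_wk 1 u) (Var 0))))
            (PEq (A ⊸ B) t u))
| ax_ext_all n G T A t u :
    hasty_i n G t (TAll A) -> hasty_i n G u (TAll A) ->
    ext_ie n G T
      (PImp (PAllT (PEq A (TApp (tm_ren S id t) (TVar 0))
                          (TApp (tm_ren S id u) (TVar 0))))
            (PEq (TAll A) t u))
| ax_identity_extension n G T m A :
    wf_ty m A = true ->
    ext_ie n G T
      (PAllTn m (requiv A A (interp TVar TVar (fun i => req (TVar i)) A) (req A))).

(** [act p th th' phi A] is the action on maps [phi i : th i ⊸ th' i] for all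
    the type variables [i].  It goes from [ty_sub th A] to [ty_sub th' A] if
    [p = true], and backwards if [p = false].  Variables that may occur with
    either polarity have [th i = th' i], with [phi i] the identity. *)
Fixpoint act (p : bool) (th th' : nat -> ty) (phi : nat -> tm) (A : ty) : tm :=
  let dom := if p then th else th' in
  let cod := if p then th' else th in
  if wf_ty 0 A then idtm A else
  match A with
  | TVar i => phi i
  | TOne => idtm TOne
  | A ⊗ B =>
      Lam (ty_sub dom (A ⊗ B))
        (Let PTen (Var 0)
           (Pair (App (tm_wk 3 (act p th th' phi A)) (Var 1))
                 (App (tm_wk 3 (act p th th' phi B)) (Var 0))))
  | A ⊸ B =>
      Lam (ty_sub dom (A ⊸ B))
        (comp (ty_sub cod A)
           (tm_wk 1 (act p th th' phi B))
           (comp (ty_sub cod A) (Var 0) (tm_wk 1 (act (negb p) th th' phi A))))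
  | TBang A =>
      Lam (ty_sub dom (TBang A))
        (Let PBang (Var 0) (Bang (App (tm_wk 2 (act p th th' phi A)) (Var 0))))
  | TAll A =>
      Lam (ty_sub dom (TAll A))
        (TLam (App (tm_wk 1 (act p (upT th) (upT th')
                               (idtm (TVar 0) .: (fun i => tm_ren S id (phi i))) A))
                   (TApp (Var 0) (TVar 0))))
  end.

(** For [σ = σ(α)] with [α] the type variable 0: the object [σ(A)] and the
    morphism [σ(f)] for [f : A ⊸ B]. *)
Definition fobj (sigma A : ty) : ty := ty_sub (A .: TVar) sigma.

Definition fmap (sigma A B : ty) (f : tm) : tm :=
  act true (A .: TVar) (B .: TVar) (f .: (fun i => idtm (TVar i))) sigma.

(** The following are only used when [σ] has no free type variable besides [α]; so
    [mu sigma] is closed and needs no weakening under type binders. *)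

Definition mu (sigma : ty) : ty := TAll (TArr (sigma ⊸ TVar 0) (TVar 0)).

Definition fold (sigma : ty) : tm :=
  TLam (ILam (sigma ⊸ TVar 0)
    (Lam (mu sigma) (App (TApp (Var 0) (TVar 0)) (Bang (Var 1))))).

Definition in_alg (sigma : ty) : tm :=
  Lam (fobj sigma (mu sigma))
    (TLam (ILam (sigma ⊸ TVar 0)
       (App (Var 0)
          (App (fmap sigma (mu sigma) (TVar 0)
                  (App (TApp (fold sigma) (TVar 0)) (Bang (Var 0))))
               (Var 1))))).

(** The objects over [n] type variables are the types over [n] variables. *)

Definition lin_hom (n : nat) (A B : ty) (f : tm) : Prop := hasty n [] f (A ⊸ B).

(** Equality of morphisms: internal equality, provable in LAPL with
    extensionality and identity extension. *)
Definition lin_eq (n : nat) (A B : ty) (f g : tm) : Prop :=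
  prv ext_ie n [] [] [] (PEq (A ⊸ B) f g).

Definition algebra (n : nat) (sigma A : ty) (a : tm) : Prop :=
  wf_ty n A = true /\ lin_hom n (fobj sigma A) A a.

Definition alg_map (n : nat) (sigma A : ty) (a : tm) (B : ty) (b h : tm) : Prop :=
  lin_hom n A B h /\
  lin_eq n (fobj sigma A) B
    (comp (fobj sigma A) h a)
    (comp (fobj sigma A) b (fmap sigma A B h)).

Definition initial_algebra (n : nat) (sigma A : ty) (a : tm) : Prop :=
  algebra n sigma A a /\
  forall B b, algebra n sigma B b ->
    exists h, alg_map n sigma A a B b h /\
      forall h', alg_map n sigma A a B b h' -> lin_eq n A B h' h.

(* Main.v *)
(** [fold τ !f] carries [u : μα.σ] to [u τ !f], so everything rests on the
    parametricity of [u], i.e. identity extension at the closed type [μα.σ].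
    Taking the graph of an algebra map [h : a ⟶ b] as the relation gives
    [h (u A !a) = u B !b], provided that [σ[⟨h⟩](x, y)] implies [σ(h) x = y].
    That half of the graph lemma is parametricity of the closed strength
    [Λα. Λβ. λf. σ(f)] at the relations [⟨h⟩] and [eq], applied to the related
    pair [(h, id)], together with [σ(id) = id] and [σ[eq] ≡ eq].
    Applied to [h := fold α !f], this equation says that [v := u μ !in] satisfies
    [v α !f = u α !f]; hence [v] and [u] are related by the interpretation of [μα.σ],
    which is equality, so that [u μ !in = u].  An arbitrary algebra map [h] from [in]
    to [f] thus satisfies [h u = h (u μ !in) = u τ !f = fold τ !f u]. *)

From Stdlib Require Import List Arith Bool Lia FunctionalExtensionality.
Require Import Defs.
Import ListNotations.

(** * Substitution *)

Ltac fext := let i := fresh "i" in apply functional_extensionality; intro i.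
Ltac fext_case := fext; match goal with i : nat |- _ => destruct i end.

Ltac rewrite_hyps := try (repeat match goal with H : forall _, _ |- _ => rewrite H end; reflexivity).

Lemma upr_id : upr id = id.
Proof. fext_case; reflexivity. Qed.

Lemma uprn_id k : uprn k id = id.
Proof. induction k as [|k IH]; simpl; [reflexivity|]. rewrite IH. apply upr_id. Qed.

Lemma upT_TVar x : upT (fun i => TVar (x i)) = fun i => TVar (upr x i).
Proof. fext_case; reflexivity. Qed.

Lemma upT_id : upT TVar = TVar.
Proof. fext_case; reflexivity. Qed.

Lemma ty_ren_sub x A : ty_ren x A = ty_sub (fun i => TVar (x i)) A.
Proof.
  revert x; induction A; intros x; simpl; try reflexivity;
    rewrite ?upT_TVar; rewrite_hyps.
Qed.

Lemma ty_sub_id A : ty_sub TVar A = A.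
Proof. induction A; simpl; rewrite ?upT_id; congruence. Qed.

Lemma ty_sub_ren th x A : ty_sub th (ty_ren x A) = ty_sub (fun i => th (x i)) A.
Proof.
  revert th x; induction A; intros th x; simpl; rewrite_hyps.
  rewrite IHA. do 2 f_equal. fext_case; reflexivity.
Qed.

Lemma ty_ren_tysub th x A : ty_ren x (ty_sub th A) = ty_sub (fun i => ty_ren x (th i)) A.
Proof.
  revert th x; induction A; intros th x; simpl; rewrite_hyps.
  rewrite IHA. do 2 f_equal. fext_case; simpl; [reflexivity|].
  rewrite !(ty_ren_sub _ (ty_ren _ _)), !ty_sub_ren. reflexivity.
Qed.

Lemma ty_sub_sub th th' A : ty_sub th (ty_sub th' A) = ty_sub (fun i => ty_sub th (th' i)) A.
Proof.
  revert th th'; induction A; intros th th'; simpl; rewrite_hyps.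
  rewrite IHA. do 2 f_equal. fext_case; simpl; [reflexivity|].
  rewrite ty_sub_ren, ty_ren_tysub. reflexivity.
Qed.

Lemma upT_comp th th' : (fun i => ty_sub (upT th) (upT th' i)) = upT (fun i => ty_sub th (th' i)).
Proof.
  fext_case; simpl; [reflexivity|]. rewrite ty_sub_ren, ty_ren_tysub. reflexivity.
Qed.

Lemma upV_Var z : upV (fun i => Var (z i)) = fun i => Var (upr z i).
Proof. fext_case; reflexivity. Qed.

Lemma upVn_Var k z : upVn k (fun i => Var (z i)) = fun i => Var (uprn k z i).
Proof.
  induction k as [|k IH]; simpl; [reflexivity|]. rewrite IH. apply upV_Var.
Qed.

Lemma upVn_id k : upVn k Var = Var.
Proof.
  change Var with (fun i => Var (id i)) at 1. rewrite upVn_Var, uprn_id. reflexivity.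
Qed.

Lemma tm_ren_sub x z t : tm_ren x z t = tm_sub (fun i => TVar (x i)) (fun i => Var (z i)) t.
Proof.
  revert x z; induction t; intros x z; simpl; rewrite ?ty_ren_sub; rewrite_hyps.
  - f_equal. rewrite IHt. f_equal. symmetry; apply upV_Var.
  - rewrite IHt, upT_TVar. reflexivity.
  - rewrite IHt1, IHt2, upVn_Var. reflexivity.
Qed.

Lemma tm_sub_id t : tm_sub TVar Var t = t.
Proof.
  induction t; simpl; rewrite ?ty_sub_id, ?upT_id, ?upVn_id; try congruence.
  - change (upV Var) with (upVn 1 Var). rewrite upVn_id. congruence.
  - transitivity (TLam (tm_sub TVar Var t)); [reflexivity|congruence].
Qed.

Lemma upV_upr s z : (fun i => upV s (upr z i)) = upV (fun i => s (z i)).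
Proof. fext_case; reflexivity. Qed.

Lemma upVn_uprn k s z : (fun i => upVn k s (uprn k z i)) = upVn k (fun i => s (z i)).
Proof.
  induction k as [|k IH]; simpl; [reflexivity|]. rewrite upV_upr, IH. reflexivity.
Qed.

Lemma tm_sub_ren th s x z t :
  tm_sub th s (tm_ren x z t) = tm_sub (fun i => th (x i)) (fun i => s (z i)) t.
Proof.
  revert th s x z; induction t; intros th s x z; simpl; rewrite ?ty_sub_ren; rewrite_hyps.
  - rewrite IHt, upV_upr. reflexivity.
  - rewrite IHt. do 2 f_equal. fext_case; reflexivity.
  - rewrite IHt1, IHt2, upVn_uprn. reflexivity.
Qed.

Lemma tm_ren_ren x z x' z' t :
  tm_ren x z (tm_ren x' z' t) = tm_ren (fun i => x (x' i)) (fun i => z (z' i)) t.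
Proof. rewrite !(tm_ren_sub x), tm_sub_ren, tm_ren_sub. reflexivity. Qed.

Lemma upV_ren x z s :
  (fun i => tm_ren x (upr z) (upV s i)) = upV (fun i => tm_ren x z (s i)).
Proof.
  fext_case; simpl; [reflexivity|]. unfold tm_wk. rewrite !tm_ren_ren. reflexivity.
Qed.

Lemma upVn_ren k x z s :
  (fun i => tm_ren x (uprn k z) (upVn k s i)) = upVn k (fun i => tm_ren x z (s i)).
Proof.
  induction k as [|k IH]; simpl; [reflexivity|]. rewrite upV_ren, IH. reflexivity.
Qed.

Lemma tm_ren_tmsub x z th s t :
  tm_ren x z (tm_sub th s t) = tm_sub (fun i => ty_ren x (th i)) (fun i => tm_ren x z (s i)) t.
Proof.
  revert x z th s; induction t; intros x z th s; simpl; rewrite ?ty_ren_tysub; rewrite_hyps.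
  - rewrite IHt, upV_ren. reflexivity.
  - rewrite IHt. do 2 f_equal.
    + fext_case; simpl; [reflexivity|].
      rewrite !(ty_ren_sub _ (ty_ren _ _)), !ty_sub_ren. reflexivity.
    + fext. rewrite !tm_ren_ren. reflexivity.
  - rewrite IHt1, IHt2, upVn_ren. reflexivity.
Qed.

Lemma upV_comp th s s' :
  (fun i => tm_sub th (upV s) (upV s' i)) = upV (fun i => tm_sub th s (s' i)).
Proof.
  fext_case; simpl; [reflexivity|]. unfold tm_wk.
  rewrite tm_sub_ren, tm_ren_tmsub. f_equal. fext.
  change (th i0 = ty_ren id (th i0)). rewrite ty_ren_sub. symmetry. apply ty_sub_id.
Qed.

Lemma upVn_comp k th s s' :
  (fun i => tm_sub th (upVn k s) (upVn k s' i)) = upVn k (fun i => tm_sub th s (s' i)).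
Proof.
  induction k as [|k IH]; simpl; [reflexivity|]. rewrite upV_comp, IH. reflexivity.
Qed.

Lemma tm_sub_sub th s th' s' t :
  tm_sub th s (tm_sub th' s' t)
  = tm_sub (fun i => ty_sub th (th' i)) (fun i => tm_sub th s (s' i)) t.
Proof.
  revert th s th' s'; induction t; intros th s th' s'; simpl; rewrite ?ty_sub_sub;
    rewrite_hyps.
  - rewrite IHt, upV_comp. reflexivity.
  - rewrite IHt, upT_comp. do 2 f_equal. fext.
    rewrite tm_sub_ren, tm_ren_tmsub. reflexivity.
  - rewrite IHt1, IHt2, upVn_comp. reflexivity.
Qed.

Scheme prop_mut := Induction for prop Sort Prop
with rel_mut := Induction for rel Sort Prop.
Combined Scheme prop_rel_ind from prop_mut, rel_mut.

Lemma upq_RVar e : (RVar 0 .: (fun i => rel_ren id id S (RVar (e i)))) = fun i => RVar (upr e i).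
Proof. fext_case; reflexivity. Qed.

Lemma prop_rel_ren_sub :
  (forall f x z e, prop_ren x z e f
     = prop_sub (fun i => TVar (x i)) (fun i => Var (z i)) (fun i => RVar (e i)) f) /\
  (forall r x z e, rel_ren x z e r
     = rel_sub (fun i => TVar (x i)) (fun i => Var (z i)) (fun i => RVar (e i)) r).
Proof.
  apply prop_rel_ind; intros; simpl; rewrite ?ty_ren_sub, ?tm_ren_sub, ?upT_TVar, ?upV_Var,
    ?upq_RVar; rewrite_hyps.
  all: rewrite H; f_equal; f_equal; fext; try destruct i as [|[|]]; reflexivity.
Qed.
Definition prop_ren_sub := proj1 prop_rel_ren_sub.
Definition rel_ren_sub := proj2 prop_rel_ren_sub.

Lemma upV_id : upV Var = Var.
Proof. exact (upVn_id 1). Qed.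

Lemma upq_id : (RVar 0 .: (fun i => rel_ren id id S (RVar i))) = RVar.
Proof. fext_case; reflexivity. Qed.

Lemma prop_rel_sub_id :
  (forall f, prop_sub TVar Var RVar f = f) /\ (forall r, rel_sub TVar Var RVar r = r).
Proof.
  apply prop_rel_ind; intros; simpl; rewrite ?ty_sub_id, ?tm_sub_id, ?upT_id, ?upV_id, ?upq_id;
    try reflexivity; try congruence;
    f_equal; (etransitivity; [|exact H]); f_equal; fext; try destruct i as [|[|]]; reflexivity.
Qed.
Definition rel_sub_id := proj2 prop_rel_sub_id.
Definition prop_sub_id := proj1 prop_rel_sub_id.

Lemma prop_rel_sub_ren :
  (forall f th s q x z e, prop_sub th s q (prop_ren x z e f)
     = prop_sub (fun i => th (x i)) (fun i => s (z i)) (fun i => q (e i)) f) /\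
  (forall r th s q x z e, rel_sub th s q (rel_ren x z e r)
     = rel_sub (fun i => th (x i)) (fun i => s (z i)) (fun i => q (e i)) r).
Proof.
  apply prop_rel_ind; intros; simpl; rewrite ?ty_sub_ren, ?tm_sub_ren; rewrite_hyps;
    rewrite H; f_equal; f_equal; fext_case; try destruct i; reflexivity.
Qed.
Definition prop_sub_ren := proj1 prop_rel_sub_ren.
Definition rel_sub_ren := proj2 prop_rel_sub_ren.

Lemma rel_ren_ren x z e x' z' e' r :
  rel_ren x z e (rel_ren x' z' e' r)
  = rel_ren (fun i => x (x' i)) (fun i => z (z' i)) (fun i => e (e' i)) r.
Proof. rewrite !(rel_ren_sub _ x), rel_sub_ren, rel_ren_sub. reflexivity. Qed.

Lemma ty_ren_ren x x' A : ty_ren x (ty_ren x' A) = ty_ren (fun i => x (x' i)) A.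
Proof. rewrite !(ty_ren_sub x), ty_sub_ren, ty_ren_sub. reflexivity. Qed.

Lemma prop_rel_ren_relsub :
  (forall f x z e th s q, prop_ren x z e (prop_sub th s q f)
     = prop_sub (fun i => ty_ren x (th i)) (fun i => tm_ren x z (s i))
                (fun i => rel_ren x z e (q i)) f) /\
  (forall r x z e th s q, rel_ren x z e (rel_sub th s q r)
     = rel_sub (fun i => ty_ren x (th i)) (fun i => tm_ren x z (s i))
                (fun i => rel_ren x z e (q i)) r).
Proof.
  apply prop_rel_ind; intros; simpl; rewrite ?ty_ren_tysub, ?tm_ren_tmsub; rewrite_hyps;
    rewrite H; f_equal; f_equal; fext; try destruct i as [|[|]];
    simpl; unfold rel_wk, tm_wk, tm_wk; rewrite ?rel_ren_ren, ?tm_ren_ren, ?ty_ren_ren; reflexivity.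
Qed.
Definition prop_ren_propsub := proj1 prop_rel_ren_relsub.
Definition rel_ren_relsub := proj2 prop_rel_ren_relsub.

Lemma ty_ren_id A : ty_ren id A = A.
Proof. rewrite ty_ren_sub. apply ty_sub_id. Qed.

Lemma tm_ren_id t : tm_ren id id t = t.
Proof. rewrite tm_ren_sub. apply tm_sub_id. Qed.

Lemma prop_rel_sub_sub :
  (forall f th s q th' s' q', prop_sub th s q (prop_sub th' s' q' f)
     = prop_sub (fun i => ty_sub th (th' i)) (fun i => tm_sub th s (s' i))
                (fun i => rel_sub th s q (q' i)) f) /\
  (forall r th s q th' s' q', rel_sub th s q (rel_sub th' s' q' r)
     = rel_sub (fun i => ty_sub th (th' i)) (fun i => tm_sub th s (s' i))
                (fun i => rel_sub th s q (q' i)) r).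
Proof.
  assert (E : forall (th : nat -> ty), (fun i => ty_ren id (th i)) = th)
    by (intros; fext; apply ty_ren_id).
  assert (E' : forall (s : nat -> tm), (fun i => tm_ren id id (s i)) = s)
    by (intros; fext; apply tm_ren_id).
  apply prop_rel_ind; intros; simpl; rewrite ?ty_sub_sub, ?tm_sub_sub; rewrite_hyps;
    rewrite H, ?upT_comp; f_equal; f_equal; fext; try destruct i as [|[|]];
    simpl; unfold rel_wk, tm_wk; rewrite ?rel_sub_ren, ?tm_sub_ren, ?rel_ren_relsub, ?tm_ren_tmsub;
    rewrite ?tm_sub_ren;
    cbv beta; simpl; unfold tm_wk; rewrite ?E, ?E'; try reflexivity.
  all: f_equal; fext; rewrite ?tm_ren_ren; reflexivity.
Qed.
Definition prop_sub_sub := proj1 prop_rel_sub_sub.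
Definition rel_sub_sub := proj2 prop_rel_sub_sub.

(** * Typing under renamings *)

Ltac bool_hyps :=
  repeat match goal with
  | H : _ && _ = true |- _ => apply andb_true_iff in H; destruct H
  | H : (_ <? _) = true |- _ => apply Nat.ltb_lt in H
  end.

Lemma ty_sub_ext k th th' A :
  wf_ty k A = true -> (forall i, i < k -> th i = th' i) -> ty_sub th A = ty_sub th' A.
Proof.
  revert k th th'; induction A; intros k th th' H E; simpl in *; bool_hyps; f_equal; eauto.
  eapply IHA; eauto. intros [|i] Hi; simpl; [reflexivity|]. rewrite E; auto with arith.
Qed.

Lemma ty_sub_closed th A : wf_ty 0 A = true -> ty_sub th A = A.
Proof.
  intros H. rewrite <- (ty_sub_id A) at 2. eapply ty_sub_ext; eauto. intros; lia.
Qed.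

Lemma ty_ren_closed x A : wf_ty 0 A = true -> ty_ren x A = A.
Proof. intros. rewrite ty_ren_sub. now apply ty_sub_closed. Qed.

Lemma wf_ty_ren k m x A :
  wf_ty k A = true -> (forall i, i < k -> x i < m) -> wf_ty m (ty_ren x A) = true.
Proof.
  revert k m x; induction A; intros k m x H E; simpl in *; bool_hyps;
    rewrite ?andb_true_iff, ?Nat.ltb_lt; eauto.
  eapply IHA; eauto. intros [|i] Hi; simpl; [lia|]. assert (x i < m) by (apply E; lia). lia.
Qed.

Lemma wf_ty_sub k m th A :
  wf_ty k A = true -> (forall i, i < k -> wf_ty m (th i) = true) -> wf_ty m (ty_sub th A) = true.
Proof.
  revert k m th; induction A; intros k m th H E; simpl in *; bool_hyps;
    rewrite ?andb_true_iff; eauto.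
  eapply IHA; eauto. intros [|i] Hi; simpl; [reflexivity|].
  eapply wf_ty_ren; [apply E; lia|]. intros; lia.
Qed.

Lemma wf_ty_le k m A : wf_ty k A = true -> k <= m -> wf_ty m A = true.
Proof.
  intros H L. rewrite <- (ty_sub_id A). eapply wf_ty_sub; eauto.
  intros i Hi; simpl. apply Nat.ltb_lt; lia.
Qed.

Lemma wf_ty_S m A : wf_ty m A = true -> wf_ty (S m) (ty_ren S A) = true.
Proof. intros; eapply wf_ty_ren; eauto. intros; lia. Qed.

Lemma wf_ty_2 m A : wf_ty m A = true -> wf_ty (S (S m)) (ty_wk2 A) = true.
Proof. intros; eapply wf_ty_ren; eauto. simpl; intros; lia. Qed.

Lemma split_length G G1 G2 : split G G1 G2 -> length G1 = length G /\ length G2 = length G.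
Proof. induction 1; simpl; intuition lia. Qed.

Lemma pat_ty_length p A D : pat_ty p A D -> length D = arity p.
Proof. destruct 1; reflexivity. Qed.

Lemma upVn_lt k s s' m :
  (forall i, i < m -> s i = s' i) -> forall i, i < k + m -> upVn k s i = upVn k s' i.
Proof.
  intros E. induction k as [|k IH]; simpl; [auto|].
  intros [|i] Hi; simpl; [reflexivity|]. rewrite IH; [reflexivity|lia].
Qed.

Lemma tm_sub_ext n G t A :
  hasty n G t A -> forall th th' v v',
  (forall i, i < n -> th i = th' i) -> (forall i, i < length G -> v i = v' i) ->
  tm_sub th v t = tm_sub th' v' t.
Proof.
  induction 1; intros th th' v v' Eth Es; simpl;
    try match goal with H : split _ _ _ |- _ => apply split_length in H; destruct H as [L1 L2] end;
    try (f_equal; eauto; fail).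
  - apply Es. apply nth_error_Some. congruence.
  - apply Es. apply nth_error_Some. congruence.
  - f_equal; [eapply ty_sub_ext; eauto|]. apply IHhasty; auto. apply (upVn_lt 1); auto.
  - f_equal; [apply IHhasty1|apply IHhasty2]; rewrite ?L1, ?L2; auto.
  - f_equal; [apply IHhasty1|apply IHhasty2]; rewrite ?L1, ?L2; auto.
  - f_equal. apply IHhasty.
    + intros [|i] Hi; simpl; [reflexivity|]. rewrite Eth; auto with arith.
    + rewrite length_map. intros; rewrite Es; auto.
  - f_equal; [apply IHhasty; auto|eapply ty_sub_ext; eauto].
  - f_equal; [apply IHhasty1; rewrite ?L1; auto|]. apply IHhasty2; auto.
    rewrite length_app, (pat_ty_length _ _ _ H1), L2. apply upVn_lt; auto.
Qed.

Lemma tm_sub_closed t A th s : hasty 0 [] t A -> tm_sub th s t = t.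
Proof.
  intros H. rewrite <- (tm_sub_id t) at 2. eapply tm_sub_ext; eauto; simpl; intros; lia.
Qed.

Definition nonlin (s : slot) : Prop := forall A, s <> SLin A.

Lemma nolin_cons s G : nolin (s :: G) <-> nonlin s /\ nolin G.
Proof.
  split.
  - intros H; split.
    + intros A E; subst. exact (H 0 A eq_refl).
    + intros i A E. exact (H (S i) A E).
  - intros [H1 H2] [|i] A E; simpl in E; [injection E as E; exact (H1 A E)|exact (H2 i A E)].
Qed.

Lemma nolin_nil : nolin [].
Proof. intros [|i] A E; discriminate. Qed.

Lemma nonlin_int A : nonlin (SInt A). Proof. intros B E; discriminate. Qed.
Lemma nonlin_used : nonlin SUsed. Proof. intros B E; discriminate. Qed.

Lemma nolin_SInt G : nolin (map SInt G).
Proof.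
  induction G; simpl; [apply nolin_nil|]. apply nolin_cons; split; auto using nonlin_int.
Qed.

Lemma nolin_map x G : nolin (map (slot_ren x) G) <-> nolin G.
Proof.
  induction G as [|[]]; simpl; rewrite ?nolin_cons, ?IHG; try tauto;
    split; intros [H1 H2]; (split; [|assumption]); intros B E; try discriminate E;
    exfalso; eapply H1; reflexivity.
Qed.

Lemma split_nolin G : nolin G -> split G G G.
Proof.
  induction G as [|[]]; rewrite ?nolin_cons; intros H; try (constructor; tauto).
  destruct H as [H _]. exfalso; eapply H; reflexivity.
Qed.

(** [thin z G G']: the slots of [G] occur in this order in [G'], at the
    positions given by [z], and the other slots of [G'] are not linear. *)
Inductive thin : (nat -> nat) -> list slot -> list slot -> Prop :=
| thin_nil z G : nolin G -> thin z [] G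
| thin_keep z s G G' : thin z G G' -> thin (upr z) (s :: G) (s :: G')
| thin_skip z s G G' : nonlin s -> thin z G G' -> thin (fun i => S (z i)) G (s :: G').

Lemma thin_id G : thin id G G.
Proof.
  induction G; [constructor; apply nolin_nil|]. rewrite <- upr_id. now constructor.
Qed.

Lemma thin_nth z G G' i s :
  thin z G G' -> nth_error G i = Some s -> nth_error G' (z i) = Some s.
Proof.
  intros H; revert i; induction H; intros i E.
  - destruct i; discriminate.
  - destruct i; simpl in *; auto.
  - simpl. auto.
Qed.

Lemma thin_lin z G G' j A :
  thin z G G' -> nth_error G' j = Some (SLin A) ->
  exists i, j = z i /\ nth_error G i = Some (SLin A).
Proof.
  intros H; revert j; induction H; intros j E.
  - exfalso; eapply H; eauto.
  - destruct j; simpl in *; [exists 0; auto|].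
    destruct (IHthin j E) as (i & -> & Hi). exists (S i); auto.
  - destruct j; simpl in *; [injection E as E; exfalso; eapply H; eauto|].
    destruct (IHthin j E) as (i & -> & Hi). exists i; auto.
Qed.

Lemma thin_nolin z G G' : thin z G G' -> nolin G -> nolin G'.
Proof. intros H N j A E. destruct (thin_lin _ _ _ _ _ H E) as (i & _ & Hi). exact (N i A Hi). Qed.

Lemma thin_split z G G' G1 G2 :
  thin z G G' -> split G G1 G2 ->
  exists G1' G2', split G' G1' G2' /\ thin z G1 G1' /\ thin z G2 G2'.
Proof.
  intros H; revert G1 G2; induction H; intros G1 G2 Sp.
  - inversion Sp; subst. exists G, G. split; [now apply split_nolin|split; now constructor].
  - inversion Sp; subst;
      match goal with K : split _ _ _ |- _ =>
        destruct (IHthin _ _ K) as (G1' & G2' & S1 & T1 & T2) end;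
      eexists _, _; (split; [econstructor; eauto|split; constructor; auto]).
  - destruct (IHthin _ _ Sp) as (G1' & G2' & S1 & T1 & T2).
    exists (s :: G1'), (s :: G2'). split; [|split; constructor; auto].
    destruct s; [constructor; auto| |constructor; auto]. exfalso; eapply H; reflexivity.
Qed.

Lemma thin_map z x G G' : thin z G G' -> thin z (map (slot_ren x) G) (map (slot_ren x) G').
Proof.
  induction 1; simpl; constructor; auto.
  - now apply nolin_map.
  - destruct s; intros B E; simpl in E; try discriminate. eapply H; reflexivity.
Qed.

Lemma thin_app z D G G' : thin z G G' -> thin (uprn (length D) z) (D ++ G) (D ++ G').
Proof. induction D; simpl; auto. intros; apply thin_keep; auto. Qed.

Lemma split_map x G G1 G2 :
  split G G1 G2 -> split (map (slot_ren x) G) (map (slot_ren x) G1) (map (slot_ren x) G2).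
Proof. induction 1; simpl; constructor; auto. Qed.

Lemma slot_ren_ren x x' s : slot_ren x (slot_ren x' s) = slot_ren (fun i => x (x' i)) s.
Proof. destruct s; simpl; rewrite ?ty_ren_ren; reflexivity. Qed.

Lemma nth_map x G i s :
  nth_error G i = Some s -> nth_error (map (slot_ren x) G) i = Some (slot_ren x s).
Proof. intros H. rewrite nth_error_map, H. reflexivity. Qed.

Lemma nth_map_lin x G i B :
  nth_error (map (slot_ren x) G) i = Some (SLin B) ->
  exists A, nth_error G i = Some (SLin A).
Proof.
  rewrite nth_error_map. destruct (nth_error G i) as [[]|]; simpl; try discriminate. eauto.
Qed.

Lemma pat_ty_ren x p A D : pat_ty p A D -> pat_ty p (ty_ren x A) (map (slot_ren x) D).
Proof. destruct 1; constructor. Qed.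

Lemma hasty_ren n G t A :
  hasty n G t A -> forall m x z G',
  (forall i, i < n -> x i < m) -> thin z (map (slot_ren x) G) G' ->
  hasty m G' (tm_ren x z t) (ty_ren x A).
Proof.
  induction 1; intros m x z G' Hx Ht; simpl;
    try match goal with H : split _ _ _ |- _ =>
      destruct (thin_split _ _ _ _ _ Ht (split_map x _ _ _ H)) as (G1' & G2' & Sp & T1 & T2) end;
    try (match goal with H : nolin _ |- _ => apply (nolin_map x), (thin_nolin _ _ _ Ht) in H end).
  - apply ht_int; auto. apply (thin_nth _ _ _ _ _ Ht), (nth_map x _ _ _ H).
  - apply ht_lin; [apply (thin_nth _ _ _ _ _ Ht), (nth_map x _ _ _ H)|].
    intros j B E. destruct (thin_lin _ _ _ _ _ Ht E) as (k & -> & Hk).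
    destruct (nth_map_lin _ _ _ _ Hk) as (C & HC). f_equal. eapply H0; eauto.
  - now constructor.
  - now constructor.
  - constructor; [eapply wf_ty_ren; eauto|]. apply IHhasty; auto. simpl. now constructor.
  - econstructor; eauto.
  - econstructor; eauto.
  - constructor; auto.
  - constructor. apply IHhasty.
    + intros [|i] Hi; simpl; [lia|]. assert (x i < m) by (apply Hx; lia). lia.
    + replace (map (slot_ren (upr x)) (map (slot_ren S) G))
        with (map (slot_ren S) (map (slot_ren x) G)); [now apply thin_map|].
      rewrite !map_map. apply map_ext. intros; rewrite !slot_ren_ren. reflexivity.
  - replace (ty_ren x (ty_sub (B .: TVar) A))
      with (ty_sub (ty_ren x B .: TVar) (ty_ren (upr x) A)).
    + constructor; [now apply IHhasty|]. eapply wf_ty_ren; eauto.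
    + rewrite ty_sub_ren, ty_ren_tysub. f_equal. fext_case; reflexivity.
  - econstructor; eauto using pat_ty_ren. apply IHhasty2; auto.
    rewrite map_app. rewrite <- (pat_ty_length _ _ _ H1).
    rewrite <- (length_map (slot_ren x) D). now apply thin_app.
Qed.

Lemma map_slot_id G : map (slot_ren id) G = G.
Proof.
  rewrite <- (map_id G) at 2. apply map_ext. intros []; simpl; rewrite ?ty_ren_id; reflexivity.
Qed.

Lemma hasty_thin n G t A z G' :
  hasty n G t A -> thin z G G' -> hasty n G' (tm_ren id z t) A.
Proof.
  intros H Ht. rewrite <- (ty_ren_id A). eapply hasty_ren; eauto.
  now rewrite map_slot_id.
Qed.

Lemma hasty_wk n G t A D :
  hasty n G t A -> nolin D -> hasty n (D ++ G) (tm_wk (length D) t) A.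
Proof.
  intros H N. apply (hasty_thin _ _ _ _ _ _ H). clear H.
  induction D as [|s D IH]; simpl.
  - apply thin_id.
  - apply nolin_cons in N. apply (thin_skip (Nat.add (length D))); tauto.
Qed.

Lemma hasty_S n G t A :
  hasty n G t A -> hasty (S n) (map (slot_ren S) G) (tm_ren S id t) (ty_ren S A).
Proof. intros H. eapply hasty_ren; eauto using thin_id. intros; lia. Qed.

Lemma hasty_closed n G t A :
  hasty 0 [] t A -> wf_ty 0 A = true -> nolin G -> hasty n G t A.
Proof.
  intros H W N. rewrite <- (tm_sub_closed t A TVar Var H), <- (ty_ren_closed id A W).
  rewrite <- tm_ren_sub with (x := id) (z := id).
  eapply hasty_ren; eauto; [lia|now constructor].
Qed.

(** * The functorial action *)

Definition unlin (G : list slot) : list slot :=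
  map (fun s => match s with SLin _ => SUsed | s => s end) G.

Lemma nolin_unlin G : nolin (unlin G).
Proof.
  induction G as [|[]]; simpl; [apply nolin_nil| | |]; apply nolin_cons;
    auto using nonlin_int, nonlin_used.
Qed.

Lemma unlin_nolin G : nolin G -> unlin G = G.
Proof.
  induction G as [|[]]; simpl; intros H; auto; apply nolin_cons in H; destruct H as [H1 H2];
    try (f_equal; auto; fail).
  exfalso; eapply H1; reflexivity.
Qed.

Lemma split_unlin_l G : split G (unlin G) G.
Proof. induction G as [|[]]; simpl; constructor; auto. Qed.

Lemma split_unlin_r G : split G G (unlin G).
Proof. induction G as [|[]]; simpl; constructor; auto. Qed.

Lemma nolin_int A G : nolin G -> nolin (SInt A :: G).
Proof. intros; apply nolin_cons; auto using nonlin_int. Qed.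

Lemma nolin_used G : nolin G -> nolin (SUsed :: G).
Proof. intros; apply nolin_cons; auto using nonlin_used. Qed.

Lemma nolin_map_r x G : nolin G -> nolin (map (slot_ren x) G).
Proof. apply nolin_map. Qed.

#[export] Hint Resolve nolin_nil nolin_unlin nolin_SInt nolin_int nolin_used nolin_map_r : nolin.
#[export] Hint Resolve split_nolin split_unlin_l split_unlin_r : split.
#[export] Hint Constructors split : split.
#[export] Hint Extern 3 (nolin _) => solve [auto with nolin] : split.

Lemma hasty_cast n G t A A' : hasty n G t A -> A = A' -> hasty n G t A'.
Proof. intros; subst; assumption. Qed.

Lemma ht_lin0 n G A : nolin G -> hasty n (SLin A :: G) (Var 0) A.
Proof.
  intros H. apply ht_lin; [reflexivity|]. intros [|j] B E; [reflexivity|].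
  exfalso; eapply H; eauto.
Qed.

Lemma ht_lin1 n s G A : nonlin s -> nolin G -> hasty n (s :: SLin A :: G) (Var 1) A.
Proof.
  intros K H. apply ht_lin; [reflexivity|]. intros [|[|j]] B E; [|reflexivity|].
  - injection E as E. exfalso; eapply K; eauto.
  - exfalso; eapply H; eauto.
Qed.

Lemma ht_lin2 n s s' G A :
  nonlin s -> nonlin s' -> nolin G -> hasty n (s :: s' :: SLin A :: G) (Var 2) A.
Proof.
  intros K K' H. apply ht_lin; [reflexivity|]. intros [|[|[|j]]] B E; [| |reflexivity|].
  - injection E as E. exfalso; eapply K; eauto.
  - injection E as E. exfalso; eapply K'; eauto.
  - exfalso; eapply H; eauto.
Qed.

Lemma ht_int0 n G A : nolin G -> hasty n (SInt A :: G) (Var 0) A.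
Proof. intros; apply ht_int; auto with nolin. Qed.

Lemma ht_int1 n s G A : nonlin s -> nolin G -> hasty n (s :: SInt A :: G) (Var 1) A.
Proof. intros; apply ht_int; auto. apply nolin_cons; auto with nolin. Qed.

#[export] Hint Resolve ht_lin0 ht_lin1 ht_lin2 ht_int0 ht_int1 nonlin_int nonlin_used : typing.
#[export] Hint Resolve nolin_nil nolin_unlin nolin_SInt nolin_int nolin_used nolin_map_r : typing.

Lemma hasty_id n G A : wf_ty n A = true -> nolin G -> hasty n G (idtm A) (A ⊸ A).
Proof. intros; constructor; auto with typing. Qed.

Lemma hasty_ILam n G A B t :
  wf_ty n A = true -> hasty n (SInt A :: G) t B -> hasty n G (ILam A t) (TArr A B).
Proof.
  intros W H. constructor; auto.
  eapply (ht_let _ _ (SLin (TBang A) :: unlin G) (SUsed :: G) PBang); auto with split typing.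
  - constructor.
  - apply (hasty_thin _ _ _ _ _ _ H). change (0 .: (fun i => S (S i))) with (upr S).
    apply thin_keep, (thin_skip id); auto using thin_id with typing.
Qed.

Lemma tm_sub_ILam th s A t :
  tm_sub th s (ILam A t) = ILam (ty_sub th A) (tm_sub th (upV s) t).
Proof.
  unfold ILam; simpl. do 2 f_equal. rewrite tm_sub_ren, tm_ren_tmsub. f_equal.
  - fext. now rewrite ty_ren_id.
  - fext_case; [reflexivity|]. simpl. unfold tm_wk. rewrite !tm_ren_ren. reflexivity.
Qed.

Lemma hasty_comp n G A B C g f :
  nolin G -> wf_ty n A = true ->
  hasty n G g (B ⊸ C) -> hasty n G f (A ⊸ B) -> hasty n G (comp A g f) (A ⊸ C).
Proof.
  intros N W Hg Hf. constructor; auto.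
  assert (N1 : nolin [SUsed]) by auto with typing.
  eapply (ht_app _ _ (SUsed :: G) (SLin A :: G)); auto with split.
  - exact (hasty_wk _ _ _ _ _ Hg N1).
  - eapply (ht_app _ _ (SUsed :: G) (SLin A :: G)); auto with split typing.
    exact (hasty_wk _ _ _ _ _ Hf N1).
Qed.

Lemma tm_sub_wk1 th s t : tm_sub th (upV s) (tm_wk 1 t) = tm_wk 1 (tm_sub th s t).
Proof.
  unfold tm_wk. rewrite tm_sub_ren, tm_ren_tmsub. f_equal.
  fext. now rewrite ty_ren_id.
Qed.

Lemma comp_sub th s A g f :
  tm_sub th s (comp A g f) = comp (ty_sub th A) (tm_sub th s g) (tm_sub th s f).
Proof.
  unfold comp; simpl. now rewrite !tm_sub_wk1.
Qed.

Lemma tm_sub_wkn k th s t : tm_sub th (upVn k s) (tm_wk k t) = tm_wk k (tm_sub th s t).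
Proof.
  unfold tm_wk. rewrite tm_sub_ren, tm_ren_tmsub. f_equal.
  - fext. now rewrite ty_ren_id.
  - fext. induction k as [|k IH]; simpl.
    + now rewrite tm_ren_id.
    + unfold tm_wk. rewrite IH, tm_ren_ren. reflexivity.
Qed.

Lemma tm_sub_tren th s t :
  tm_sub (upT th) (fun i => tm_ren S id (s i)) (tm_ren S id t) = tm_ren S id (tm_sub th s t).
Proof. rewrite tm_sub_ren, tm_ren_tmsub. reflexivity. Qed.

Lemma wk_comp_var A t :
  tm_wk 1 (comp A (Var 0) t) = Lam A (App (Var 2) (App (tm_wk 2 t) (Var 0))).
Proof. unfold comp, tm_wk; simpl. rewrite ty_ren_id, !tm_ren_ren. reflexivity. Qed.

Lemma act_sub A : forall p th th' phi th0 s,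
  tm_sub th0 s (act p th th' phi A)
  = act p (fun i => ty_sub th0 (th i)) (fun i => ty_sub th0 (th' i))
        (fun i => tm_sub th0 s (phi i)) A.
Proof.
  induction A; intros p th th' phi th0 s; cbn [act]; try reflexivity;
    match goal with |- context [if ?b then _ else _] => destruct b eqn:E end;
    try exact (f_equal (fun A => Lam A (Var 0)) (ty_sub_closed th0 _ E)).
  - cbn [tm_sub ty_sub upVn arity]. rewrite <- (IHA1 p th th' phi th0 s), <- (IHA2 p th th' phi th0 s). rewrite !(tm_sub_wkn 3 th0 s).
    destruct p; rewrite !ty_sub_sub; reflexivity.
  - cbn [tm_sub ty_sub upVn arity]. rewrite <- (IHA1 (negb p) th th' phi th0 s), <- (IHA2 p th th' phi th0 s), !comp_sub, !tm_sub_wk1.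
    destruct p; rewrite !ty_sub_sub; reflexivity.
  - cbn [tm_sub ty_sub upVn arity]. rewrite <- (IHA p th th' phi th0 s). change (upV (upV s)) with (upVn 2 s). rewrite tm_sub_wkn.
    destruct p; rewrite !ty_sub_sub; reflexivity.
  - cbn [tm_sub ty_sub].
    f_equal; [destruct p; rewrite !ty_sub_sub, upT_comp; reflexivity|].
    do 2 f_equal.
    transitivity (tm_sub (upT th0) (upV (fun i => tm_ren S id (s i)))
      (tm_wk 1 (act p (upT th) (upT th') (idtm (TVar 0) .: (fun i => tm_ren S id (phi i))) A))).
    { f_equal. fext_case; [reflexivity|]. simpl. unfold tm_wk. rewrite !tm_ren_ren. reflexivity. }
    rewrite tm_sub_wk1, IHA. f_equal. rewrite !upT_comp. f_equal.
    fext_case; [reflexivity|]. simpl. apply tm_sub_tren.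
Qed.

Lemma act_ren A p th th' phi x z :
  tm_ren x z (act p th th' phi A)
  = act p (fun i => ty_ren x (th i)) (fun i => ty_ren x (th' i))
        (fun i => tm_ren x z (phi i)) A.
Proof.
  rewrite tm_ren_sub, act_sub. f_equal; fext; rewrite ?ty_ren_sub, ?tm_ren_sub; reflexivity.
Qed.

Lemma act_wk A k p th th' phi :
  tm_wk k (act p th th' phi A) = act p th th' (fun i => tm_wk k (phi i)) A.
Proof. unfold tm_wk. rewrite act_ren. f_equal; fext; now rewrite ty_ren_id. Qed.

Lemma hasty_act A : forall p k m th th' phi G,
  wf_ty k A = true -> nolin G ->
  (forall i, i < k -> wf_ty m (th i) = true /\ wf_ty m (th' i) = true /\
     hasty m G (phi i) (th i ⊸ th' i) /\ (th i = th' i \/ polarised p i A = true)) ->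
  hasty m G (act p th th' phi A)
    (ty_sub (if p then th else th') A ⊸ ty_sub (if p then th' else th) A).
Proof.
  induction A; intros p k m th th' phi G W N H; cbn [act];
    match goal with |- context [if ?b then idtm _ else _] => destruct b eqn:E end;
    try (rewrite !ty_sub_closed by exact E; apply hasty_id; eauto using wf_ty_le with arith; fail);
    try discriminate E; cbn [ty_sub].
  - simpl in *; bool_hyps. destruct (H i W) as (W1 & W2 & Hp & Heq).
    rewrite Nat.eqb_refl in Heq. destruct p; [assumption|].
    destruct Heq as [Heq|]; [|discriminate]. rewrite Heq in *. assumption.
  - simpl in W; bool_hyps.
    assert (Wd : forall A, wf_ty k A = true -> wf_ty m (ty_sub (if p then th else th') A) = true)
      by (intros; destruct p; eapply wf_ty_sub; eauto; intros; apply H; auto).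
    constructor; [simpl; rewrite !Wd; auto|].
    assert (forall C, (forall i, i < k -> th i = th' i \/ polarised p i C = true) ->
             forall D, nolin D -> length D = 3 -> forall i, i < k ->
       wf_ty m (th i) = true /\ wf_ty m (th' i) = true /\
     hasty m (D ++ G) (tm_wk 3 (phi i)) (th i ⊸ th' i) /\ (th i = th' i \/ polarised p i C = true)) as K.
    { intros C HC D ND L i Hi. destruct (H i Hi) as (? & ? & Hp & ?). repeat (split; auto).
      rewrite <- L. apply hasty_wk; auto. }
    eapply (ht_let _ _ (SLin _ :: G) (SUsed :: G) PTen); auto with split typing.
    { constructor. }
    simpl.
    eapply (ht_pair _ _ (SUsed :: SLin _ :: SUsed :: G) (SLin _ :: SUsed :: SUsed :: G));
      auto with split.
    + eapply (ht_app _ _ (SUsed :: SUsed :: SUsed :: G) (SUsed :: SLin _ :: SUsed :: G));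
        auto 7 with split typing.
      rewrite act_wk. eapply IHA1; eauto with typing.
      apply (K _ ) with (D := [SUsed; SUsed; SUsed]); auto with typing.
      intros i Hi. destruct (H i Hi) as (? & ? & ? & [?|Hpol]); auto.
      simpl in Hpol; bool_hyps; auto.
    + eapply (ht_app _ _ (SUsed :: SUsed :: SUsed :: G) (SLin _ :: SUsed :: SUsed :: G));
        auto 7 with split typing.
      rewrite act_wk. eapply IHA2; eauto with typing.
      apply (K _ ) with (D := [SUsed; SUsed; SUsed]); auto with typing.
      intros i Hi. destruct (H i Hi) as (? & ? & ? & [?|Hpol]); auto.
      simpl in Hpol; bool_hyps; auto.
  - simpl in W; bool_hyps.
    assert (Wd : forall A, wf_ty k A = true -> wf_ty m (ty_sub (if p then th else th') A) = true)
      by (intros; destruct p; eapply wf_ty_sub; eauto; intros; apply H; auto).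
    assert (Wc : forall A, wf_ty k A = true -> wf_ty m (ty_sub (if p then th' else th) A) = true)
      by (intros; destruct p; eapply wf_ty_sub; eauto; intros; apply H; auto).
    constructor; [simpl; rewrite !Wd; auto|].
    assert (K1 : forall i, i < k ->
       wf_ty m (th i) = true /\ wf_ty m (th' i) = true /\
       hasty m (SUsed :: G) (tm_wk 1 (phi i)) (th i ⊸ th' i) /\
       (th i = th' i \/ polarised (negb p) i A1 = true)).
    { intros i Hi. destruct (H i Hi) as (? & ? & Hp & Hpol). repeat (split; auto).
      - apply (hasty_wk _ _ _ _ [SUsed]); auto with typing.
      - destruct Hpol as [?|Hpol]; auto. simpl in Hpol; bool_hyps; auto. }
    assert (K2 : forall i, i < k ->
       wf_ty m (th i) = true /\ wf_ty m (th' i) = true /\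
       hasty m (SUsed :: G) (tm_wk 1 (phi i)) (th i ⊸ th' i) /\
       (th i = th' i \/ polarised p i A2 = true)).
    { intros i Hi. destruct (H i Hi) as (? & ? & Hp & Hpol). repeat (split; auto).
      - apply (hasty_wk _ _ _ _ [SUsed]); auto with typing.
      - destruct Hpol as [?|Hpol]; auto. simpl in Hpol; bool_hyps; auto. }
    rewrite !act_wk.
    pose proof (IHA2 p k m th th' _ (SUsed :: G) H1 (nolin_used _ N) K2) as T2.
    pose proof (IHA1 (negb p) k m th th' _ (SUsed :: G) H0 (nolin_used _ N) K1) as T1.
    constructor; [auto|].
    eapply (ht_app _ _ (SUsed :: SUsed :: G) (SLin _ :: SLin _ :: G)); auto with split.
    { exact (hasty_wk _ _ _ _ [SUsed] T2 (nolin_used _ nolin_nil)). }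
    eapply (ht_app _ _ (SUsed :: SLin _ :: G) (SLin _ :: SUsed :: G)); auto with split typing.
    rewrite wk_comp_var. constructor; [auto|].
    eapply (ht_app _ _ (SUsed :: SUsed :: SLin _ :: G) (SLin _ :: SUsed :: SUsed :: G));
      auto with split typing.
    eapply (ht_app _ _ (SUsed :: SUsed :: SUsed :: G) (SLin _ :: SUsed :: SUsed :: G));
      auto 6 with split typing.
    pose proof (hasty_wk _ _ _ _ [SUsed; SUsed] T1 (nolin_used _ (nolin_used _ nolin_nil))) as T.
    destruct p; exact T.
  - simpl in W.
    assert (Wd : wf_ty m (ty_sub (if p then th else th') A) = true)
      by (intros; destruct p; eapply wf_ty_sub; eauto; intros; apply H; auto).
    constructor; [simpl; auto|].
    eapply (ht_let _ _ (SLin _ :: G) (SUsed :: G) PBang); auto with split typing.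
    { constructor. }
    simpl. constructor; [auto with typing|].
    eapply (ht_app _ _ (SInt _ :: SUsed :: G) (SInt _ :: SUsed :: G)); auto with split typing.
    rewrite act_wk. eapply IHA; eauto with typing.
    intros i Hi. destruct (H i Hi) as (? & ? & Hp & Hpol). repeat (split; auto).
    apply (hasty_wk _ _ _ _ [SInt _; SUsed]); auto with typing.
  - simpl in W.
    assert (Wd : wf_ty (S m) (ty_sub (upT (if p then th else th')) A) = true).
    { eapply wf_ty_sub; eauto. intros [|i] Hi; simpl; [reflexivity|].
      apply wf_ty_S. destruct p; apply H; lia. }
    constructor; [simpl; auto|].
    constructor. simpl map.
    eapply (ht_app _ _ (SUsed :: _) (SLin _ :: _)).
    + constructor. apply split_nolin. auto with typing.
    + rewrite act_wk.
      pose proof (IHA p (S k) (S m) (upT th) (upT th')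
         (fun i => tm_wk 1 ((idtm (TVar 0) .: (fun i => tm_ren S id (phi i))) i))
         (SUsed :: map (slot_ren S) G)) as T.
      assert (E2 : forall b : bool, (if b then upT th else upT th') = upT (if b then th else th'))
        by (intros []; reflexivity).
      assert (E3 : forall b : bool, (if b then upT th' else upT th) = upT (if b then th' else th))
        by (intros []; reflexivity).
      rewrite E2, E3 in T. apply T; auto with typing.
      intros [|i] Hi.
      * simpl. repeat split; auto. apply hasty_id; auto with typing.
      * destruct (H i) as (? & ? & Hp & Hpol); [lia|]. simpl.
        repeat split; auto using wf_ty_S.
        -- apply (hasty_wk _ _ _ _ [SUsed]); auto with typing. exact (hasty_S _ _ _ _ Hp).
        -- destruct Hpol as [->|?]; auto.
    + eapply hasty_cast; [eapply ht_tapp; [|reflexivity]|].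
      * simpl. apply ht_lin0. auto with typing.
      * rewrite ty_sub_ren. etransitivity; [|apply ty_sub_id]. f_equal. fext_case; reflexivity.
Qed.

Lemma act_ext A : forall p k th th' phi th1 th1' phi1,
  wf_ty k A = true ->
  (forall i, i < k -> th i = th1 i /\ th' i = th1' i /\ phi i = phi1 i) ->
  act p th th' phi A = act p th1 th1' phi1 A.
Proof.
  induction A; intros p k th th' phi th1 th1' phi1 W H; cbn [act];
    match goal with |- context [if ?b then idtm _ else _] => destruct b eqn:E end;
    try reflexivity.
  - simpl in W; bool_hyps. now apply H.
  - assert (forall b : bool, ty_sub (if b then th else th') (A1 ⊗ A2)
                  = ty_sub (if b then th1 else th1') (A1 ⊗ A2)) as ->.
    { intros b; eapply ty_sub_ext; eauto. intros; destruct b; now apply H. }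
    simpl in W; bool_hyps.
    rewrite (IHA1 p k th th' phi th1 th1' phi1), (IHA2 p k th th' phi th1 th1' phi1); auto.
  - assert (K : forall b : bool, ty_sub (if b then th else th') (A1 ⊸ A2)
                  = ty_sub (if b then th1 else th1') (A1 ⊸ A2)).
    { intros b; eapply ty_sub_ext; eauto. intros; destruct b; now apply H. }
    simpl in W; bool_hyps.
    rewrite K, (IHA1 (negb p) k th th' phi th1 th1' phi1), (IHA2 p k th th' phi th1 th1' phi1); auto.
    assert (ty_sub (if p then th' else th) A1 = ty_sub (if p then th1' else th1) A1) as ->.
    { eapply ty_sub_ext; eauto. intros; destruct p; now apply H. }
    reflexivity.
  - assert (forall b : bool, ty_sub (if b then th else th') (TBang A)
                  = ty_sub (if b then th1 else th1') (TBang A)) as ->.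
    { intros b; eapply ty_sub_ext; eauto. intros; destruct b; now apply H. }
    rewrite (IHA p k th th' phi th1 th1' phi1); auto.
  - assert (forall b : bool, ty_sub (if b then th else th') (TAll A)
                  = ty_sub (if b then th1 else th1') (TAll A)) as ->.
    { intros b; eapply ty_sub_ext; eauto. intros; destruct b; now apply H. }
    simpl in W. erewrite (IHA p (S k)); eauto.
    intros [|i] Hi; simpl; auto. destruct (H i) as (-> & -> & ->); auto; lia.
Qed.

Lemma ext_base' n G t u u' A :
  base_eq t u -> u = u' -> hasty n G t A -> hasty n G u' A -> ext n G t u' A.
Proof. intros; subst; now apply ext_base. Qed.

Lemma tm_inst_wk1 t u : tm_sub TVar (u .: Var) (tm_wk 1 t) = t.
Proof.
  unfold tm_wk. rewrite tm_sub_ren. etransitivity; [|apply tm_sub_id]. reflexivity.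
Qed.

Lemma app_id n G A t u u' :
  wf_ty n A = true -> ext n (unlin G) t (idtm A) (A ⊸ A) -> ext n G u u' A ->
  hasty n G u' A -> ext n G (App t u) u' A.
Proof.
  intros W Et Eu Hu. apply ext_trans with (App (idtm A) u').
  - eapply ext_app; [apply split_unlin_l|eassumption|assumption].
  - eapply ext_base'; [apply beta_lol|reflexivity| |assumption].
    eapply ht_app; [apply split_unlin_l| |eassumption]. apply hasty_id; auto with typing.
Qed.

Lemma wk_act_id A k p th :
  tm_wk k (act p th th (fun i => idtm (th i)) A) = act p th th (fun i => idtm (th i)) A.
Proof.
  rewrite act_wk. f_equal. fext. unfold tm_wk; simpl. rewrite ty_ren_id.
  destruct k; reflexivity.
Qed.

Lemma ext_act_id A : forall p k m th G,
  wf_ty k A = true -> nolin G -> (forall i, i < k -> wf_ty m (th i) = true) ->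
  ext m G (act p th th (fun i => idtm (th i)) A) (idtm (ty_sub th A)) (ty_sub th A ⊸ ty_sub th A).
Proof.
  induction A; intros p k m th G W N H;
    assert (WA := wf_ty_sub _ _ _ _ W H);
    cbn [act];
    match goal with |- context [if ?b then idtm _ else _] => destruct b eqn:E end;
    try (rewrite !ty_sub_closed by exact E; apply ext_refl, hasty_id; eauto using wf_ty_le with arith; fail);
    try discriminate E.
  - apply ext_refl, hasty_id; assumption.
  - rewrite !wk_act_id. cbn [ty_sub].
    assert (Ei : (if p then th else th) = th) by (destruct p; reflexivity). rewrite !Ei.
    simpl in W, WA; bool_hyps.
    apply ext_lam; [simpl; now rewrite !andb_true_iff|].
    eapply ext_trans.
    + eapply (ext_let _ _ (SLin _ :: G) (SUsed :: G) PTen); auto with split typing.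
      * apply ext_refl. auto with typing.
      * constructor.
      * simpl. eapply (ext_pair _ _ (SUsed :: SLin _ :: SUsed :: G) (SLin _ :: SUsed :: SUsed :: G));
          auto with split.
        -- eapply app_id; eauto with typing. apply ext_refl. auto with typing.
        -- eapply app_id; eauto with typing. apply ext_refl. auto with typing.
    + assert (hasty m (SLin (ty_sub th A1 ⊗ ty_sub th A2) :: G)
       (Let PTen (Var 0) (Pair (Var 1) (Var 0))) (ty_sub th A1 ⊗ ty_sub th A2)).
      { eapply (ht_let _ _ (SLin _ :: G) (SUsed :: G) PTen); auto with split typing; [constructor|].
        simpl. eapply (ht_pair _ _ (SUsed :: SLin _ :: SUsed :: G) (SLin _ :: SUsed :: SUsed :: G));
          auto with split typing. }
      eapply ext_base; [assumption|auto with typing|constructor].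
  - rewrite !wk_act_id. cbn [ty_sub].
    assert (Ei : (if p then th else th) = th) by (destruct p; reflexivity). rewrite !Ei.
    simpl in W, WA; bool_hyps.
    assert (hasty m (SUsed :: SLin (ty_sub th A1 ⊸ ty_sub th A2) :: G)
       (Lam (ty_sub th A1) (App (Var 2) (Var 0)))
       (ty_sub th A1 ⊸ ty_sub th A2)).
    { constructor; auto.
      eapply (ht_app _ _ (SUsed :: SUsed :: SLin _ :: G) (SLin _ :: SUsed :: SUsed :: G));
        auto 7 with split typing. }
    eapply ext_trans.
    { apply ext_lam; [simpl; now rewrite !andb_true_iff|].
      unfold comp at 1. rewrite !wk_act_id. apply ext_lam; auto.
      eapply app_id; auto with typing.
      - eapply IHA2; eauto with typing.
      - rewrite wk_comp_var, wk_act_id.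
        eapply (ext_app _ _ (SUsed :: SLin _ :: G) (SLin _ :: SUsed :: G)); auto with split.
        + apply ext_trans with (Lam (ty_sub th A1) (App (Var 2) (Var 0))).
          * apply ext_lam; auto.
            eapply (ext_app _ _ (SUsed :: SUsed :: SLin _ :: G) (SLin _ :: SUsed :: SUsed :: G));
              auto with split.
            -- apply ext_refl. auto with typing.
            -- eapply app_id; eauto with typing. apply ext_refl; auto with typing.
          * eapply ext_base; [| |apply (eta_lol _ (Var 1))]; auto with typing.
        + apply ext_refl; auto with typing.
      - eapply (ht_app _ _ (SUsed :: SLin _ :: G) (SLin _ :: SUsed :: G)); auto with split typing. }
    apply ext_lam; [simpl; now rewrite !andb_true_iff|].
    eapply ext_base; [| |apply (eta_lol _ (Var 0))]; auto with typing.
    constructor; auto.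
    eapply (ht_app _ _ (SUsed :: SLin _ :: G) (SLin _ :: SUsed :: G)); auto with split typing.
  - rewrite !wk_act_id. cbn [ty_sub].
    assert (Ei : (if p then th else th) = th) by (destruct p; reflexivity). rewrite !Ei.
    simpl in W, WA. apply ext_lam; auto.
    eapply ext_trans.
    + eapply (ext_let _ _ (SLin _ :: G) (SUsed :: G) PBang); auto with split typing.
      * apply ext_refl. auto with typing.
      * constructor.
      * simpl. apply ext_bang; [auto with typing|].
        eapply app_id; auto with typing.
        -- rewrite unlin_nolin by auto with typing. eapply IHA; eauto with typing.
        -- apply ext_refl. auto with typing.
    + eapply ext_base; [|auto with typing|apply eta_bang].
      eapply (ht_let _ _ (SLin _ :: G) (SUsed :: G) PBang); auto with split typing; [constructor|].
      simpl. constructor; auto with typing.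
  - cbn [ty_sub].
    assert (Ei : (if p then th else th) = th) by (destruct p; reflexivity). rewrite !Ei.
    simpl in W, WA.
    assert (Ep : (idtm (TVar 0) .: (fun i => tm_ren S id (idtm (th i))))
       = (fun i => idtm (upT th i))) by (fext_case; reflexivity).
    rewrite Ep, wk_act_id.
    assert (Ht : hasty (S m) (map (slot_ren S) (SLin (TAll (ty_sub (upT th) A)) :: G))
      (TApp (Var 0) (TVar 0)) (ty_sub (upT th) A)).
    { eapply hasty_cast; [eapply ht_tapp; [|reflexivity]|].
      - simpl. apply ht_lin0. auto with typing.
      - rewrite ty_sub_ren. etransitivity; [|apply ty_sub_id]. f_equal. fext_case; reflexivity. }
    apply ext_lam; auto. eapply ext_trans.
    + apply ext_tlam. eapply app_id; auto.
      * eapply IHA; eauto with typing. intros [|i] Hi; simpl; auto.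
        apply wf_ty_S, H. lia.
      * apply ext_refl; exact Ht.
      * exact Ht.
    + eapply ext_base; [constructor; assumption|auto with typing|apply (eta_all (Var 0))].
Qed.

Lemma ext_ilam_beta n G A B t u r :
  wf_ty n A = true -> hasty n (unlin G) u A -> hasty n (SInt A :: G) t B ->
  r = tm_sub TVar (u .: Var) t -> hasty n G r B ->
  ext n G (App (ILam A t) (Bang u)) r B.
Proof.
  intros W Hu Ht -> Hr.
  assert (hasty n (unlin G) (Bang u) (TBang A)) by (constructor; auto with typing).
  eapply ext_trans; [eapply ext_base'; [apply beta_lol|simpl; reflexivity| |]|].
  - eapply ht_app; [apply split_unlin_r| |eassumption]. now apply hasty_ILam.
  - eapply (ht_let _ _ (unlin G) G PBang); auto with split; [eassumption|constructor|].
    simpl. rewrite tm_sub_ren. replace (tm_sub _ _ t) with t; [assumption|].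
    rewrite <- (tm_sub_id t) at 1. f_equal. fext. destruct i as [|]; reflexivity.
  - simpl. rewrite tm_sub_ren.
    eapply ext_base'; [apply beta_bang| | |assumption].
    + f_equal. rewrite <- (tm_sub_id t) at 2. f_equal. fext. destruct i as [|]; reflexivity.
    + eapply (ht_let _ _ (unlin G) G PBang); auto with split; [eassumption|constructor|].
      simpl. replace (tm_sub _ _ t) with t; [assumption|].
      rewrite <- (tm_sub_id t) at 1. f_equal. fext. destruct i as [|]; reflexivity.
Qed.

Section Fix_sigma.

Variable sigma : ty.
Hypothesis Hwf : wf_ty 1 sigma = true.
Hypothesis Hpos : polarised true 0 sigma = true.

Lemma fobj_sub th A : ty_sub th (fobj sigma A) = fobj sigma (ty_sub th A).
Proof.
  unfold fobj. rewrite ty_sub_sub. eapply ty_sub_ext; eauto. intros [|i] Hi; [reflexivity|lia].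
Qed.

Lemma fobj_ren x A : ty_ren x (fobj sigma A) = fobj sigma (ty_ren x A).
Proof. rewrite !ty_ren_sub. apply fobj_sub. Qed.

Lemma wf_fobj n A : wf_ty n A = true -> wf_ty n (fobj sigma A) = true.
Proof. intros H. eapply wf_ty_sub; eauto. intros [|i] Hi; [assumption|lia]. Qed.

Lemma fobj_var : fobj sigma (TVar 0) = sigma.
Proof.
  unfold fobj. etransitivity; [|apply ty_sub_id]. eapply ty_sub_ext; eauto.
  intros [|i] Hi; [reflexivity|lia].
Qed.

Lemma wf_mu n : wf_ty n (mu sigma) = true.
Proof.
  apply wf_ty_le with 0; [|lia]. simpl. rewrite Hwf. reflexivity.
Qed.

Lemma mu_sub th : ty_sub th (mu sigma) = mu sigma.
Proof. apply ty_sub_closed, wf_mu. Qed.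

Lemma mu_ren x : ty_ren x (mu sigma) = mu sigma.
Proof. apply ty_ren_closed, wf_mu. Qed.

Lemma fmap_sub th s A B f :
  tm_sub th s (fmap sigma A B f) = fmap sigma (ty_sub th A) (ty_sub th B) (tm_sub th s f).
Proof.
  unfold fmap. rewrite act_sub. eapply act_ext; eauto.
  intros [|i] Hi; [repeat split|lia].
Qed.

Lemma fmap_ren x z A B f :
  tm_ren x z (fmap sigma A B f) = fmap sigma (ty_ren x A) (ty_ren x B) (tm_ren x z f).
Proof. rewrite !tm_ren_sub, !ty_ren_sub. apply fmap_sub. Qed.

Lemma hasty_fmap n G A B f :
  nolin G -> wf_ty n A = true -> wf_ty n B = true -> hasty n G f (A ⊸ B) ->
  hasty n G (fmap sigma A B f) (fobj sigma A ⊸ fobj sigma B).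
Proof.
  intros N WA WB Hf. apply (hasty_act _ true 1); auto.
  intros [|i] Hi; [|lia]. simpl. auto.
Qed.

Lemma ext_fmap_id n G A :
  nolin G -> wf_ty n A = true ->
  ext n G (fmap sigma A A (idtm A)) (idtm (fobj sigma A)) (fobj sigma A ⊸ fobj sigma A).
Proof.
  intros N W. pose proof (ext_act_id sigma true 1 n (A .: TVar) G Hwf N) as K.
  unfold fmap. erewrite act_ext; [apply K|exact Hwf|].
  - intros [|i] Hi; [assumption|lia].
  - intros [|i] Hi; [|lia]. simpl. auto.
Qed.

Lemma hasty_inst n G u tau :
  hasty n G u (mu sigma) -> wf_ty n tau = true ->
  hasty n G (TApp u tau) (TArr (fobj sigma tau ⊸ tau) tau).
Proof. intros Hu W. exact (ht_tapp _ _ _ _ _ Hu W). Qed.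

Lemma hasty_inst_app n G u tau f :
  hasty n G u (mu sigma) -> wf_ty n tau = true ->
  hasty n (unlin G) f (fobj sigma tau ⊸ tau) ->
  hasty n G (App (TApp u tau) (Bang f)) tau.
Proof.
  intros Hu W Hf. eapply ht_app; [apply split_unlin_r|eapply hasty_inst; eauto|].
  constructor; auto with typing.
Qed.

Lemma hasty_fold0 : hasty 0 [] (fold sigma) (TAll (TArr (sigma ⊸ TVar 0) (mu sigma ⊸ TVar 0))).
Proof.
  constructor. simpl. apply hasty_ILam; [simpl; now rewrite Hwf|].
  constructor; [apply wf_mu|].
  apply hasty_inst_app; auto.
  - apply ht_lin0. auto with typing.
  - simpl. rewrite fobj_var. auto with typing.
Qed.

Lemma hasty_fold n G :
  nolin G -> hasty n G (fold sigma) (TAll (TArr (sigma ⊸ TVar 0) (mu sigma ⊸ TVar 0))).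
Proof.
  apply hasty_closed; [apply hasty_fold0|]. cbn.
  rewrite Hwf, (wf_ty_le 1 2 sigma Hwf) by lia. reflexivity.
Qed.

Lemma fold_sub th s : tm_sub th s (fold sigma) = fold sigma.
Proof. eapply tm_sub_closed, hasty_fold0. Qed.

Definition fold_at (tau : ty) (f : tm) : tm := App (TApp (fold sigma) tau) (Bang f).

Lemma hasty_fold_at n G tau f :
  nolin G -> wf_ty n tau = true -> hasty n G f (fobj sigma tau ⊸ tau) ->
  hasty n G (fold_at tau f) (mu sigma ⊸ tau).
Proof.
  intros N W Hf. eapply ht_app; [now apply split_nolin| |constructor; eassumption].
  eapply hasty_cast; [apply ht_tapp; [now apply hasty_fold|assumption]|].
  cbn [TArr ty_sub]. rewrite mu_sub. reflexivity.
Qed.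

Lemma ext_fold_at n G tau f :
  nolin G -> wf_ty n tau = true -> hasty n G f (fobj sigma tau ⊸ tau) ->
  ext n G (fold_at tau f) (Lam (mu sigma) (App (TApp (Var 0) tau) (Bang (tm_wk 1 f))))
    (mu sigma ⊸ tau).
Proof.
  intros N W Hf.
  assert (Wa : wf_ty n (fobj sigma tau ⊸ tau) = true) by (simpl; now rewrite wf_fobj).
  assert (H1 : hasty n (SInt (fobj sigma tau ⊸ tau) :: G)
      (Lam (mu sigma) (App (TApp (Var 0) tau) (Bang (Var 1)))) (mu sigma ⊸ tau)).
  { constructor; [apply wf_mu|]. apply hasty_inst_app; auto with typing.
    simpl. auto with typing. }
  eapply ext_trans; [eapply ext_app; [apply split_nolin; eauto| |apply ext_refl; constructor; eauto]|].
  - eapply ext_base' with (u' := ILam (fobj sigma tau ⊸ tau)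
        (Lam (mu sigma) (App (TApp (Var 0) tau) (Bang (Var 1))))); [apply beta_all| | |].
    + rewrite tm_sub_ILam. cbn [tm_sub]. rewrite mu_sub. reflexivity.
    + eapply hasty_cast; [apply ht_tapp; [now apply hasty_fold|assumption]|].
      cbn [TArr ty_sub]. rewrite mu_sub. reflexivity.
    + apply hasty_ILam; auto.
  - eapply ext_ilam_beta; eauto.
    + rewrite unlin_nolin; auto.
    + cbn [tm_sub]. rewrite mu_sub. simpl. rewrite ty_sub_id. reflexivity.
    + constructor; [apply wf_mu|]. apply hasty_inst_app; auto with typing.
      simpl. rewrite unlin_nolin by assumption.
      apply (hasty_wk _ _ _ _ [SUsed]); auto with typing.
Qed.

Lemma ext_fold_app n G tau f u :
  wf_ty n tau = true -> hasty n (unlin G) f (fobj sigma tau ⊸ tau) -> hasty n G u (mu sigma) ->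
  ext n G (App (fold_at tau f) u) (App (TApp u tau) (Bang f)) tau.
Proof.
  intros W Hf Hu. eapply ext_trans.
  - eapply ext_app; [apply split_unlin_l|apply ext_fold_at; auto with typing|apply ext_refl; eauto].
  - eapply ext_base'; [apply beta_lol| | |].
    + simpl. rewrite ty_sub_id, tm_inst_wk1. reflexivity.
    + eapply ht_app; [apply split_unlin_l| |eassumption].
      constructor; [apply wf_mu|]. apply hasty_inst_app; auto with typing.
      simpl. apply (hasty_wk _ _ _ _ [SUsed]); auto with typing.
      now rewrite unlin_nolin by auto with typing.
    + now apply hasty_inst_app.
Qed.

Lemma fold_at_sub th s tau f :
  tm_sub th s (fold_at tau f) = fold_at (ty_sub th tau) (tm_sub th s f).
Proof. unfold fold_at; cbn [tm_sub]. now rewrite fold_sub. Qed.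

Lemma fold_at_ren x z tau f :
  tm_ren x z (fold_at tau f) = fold_at (ty_ren x tau) (tm_ren x z f).
Proof. rewrite !tm_ren_sub, ty_ren_sub. apply fold_at_sub. Qed.

(** [in z = Λα. λf. in_body α f z]. *)
Definition in_body (tau : ty) (f z : tm) : tm :=
  App f (App (fmap sigma (mu sigma) tau (fold_at tau f)) z).

Lemma in_body_sub th s tau f z :
  tm_sub th s (in_body tau f z) = in_body (ty_sub th tau) (tm_sub th s f) (tm_sub th s z).
Proof. unfold in_body; cbn [tm_sub]. now rewrite fmap_sub, fold_at_sub, mu_sub. Qed.

Lemma hasty_in_body n G tau f z :
  wf_ty n tau = true -> hasty n (unlin G) f (fobj sigma tau ⊸ tau) ->
  hasty n G z (fobj sigma (mu sigma)) -> hasty n G (in_body tau f z) tau.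
Proof.
  intros W Hf Hz. eapply ht_app; [apply split_unlin_l|eassumption|].
  eapply ht_app; [apply split_unlin_l| |eassumption].
  apply hasty_fmap; auto using wf_mu with typing. apply hasty_fold_at; auto with typing.
Qed.

Lemma in_alg_eq :
  in_alg sigma = Lam (fobj sigma (mu sigma))
    (TLam (ILam (sigma ⊸ TVar 0) (in_body (TVar 0) (Var 0) (Var 1)))).
Proof. reflexivity. Qed.

Lemma hasty_in_gen n G z :
  hasty n G z (fobj sigma (mu sigma)) ->
  hasty n G (TLam (ILam (sigma ⊸ TVar 0)
     (in_body (TVar 0) (Var 0) (tm_ren S S z)))) (mu sigma).
Proof.
  intros Hz. constructor. apply hasty_ILam.
  - simpl. now rewrite (wf_ty_le 1 (S n) sigma Hwf) by lia.
  - apply hasty_in_body; auto.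
    + simpl. rewrite fobj_var. auto with typing.
    + eapply hasty_cast.
      * eapply hasty_ren; eauto; [intros; lia|]. apply (thin_skip id); [auto with typing|].
        apply thin_id.
      * rewrite fobj_ren, mu_ren. reflexivity.
Qed.

Lemma hasty_in n G : nolin G -> hasty n G (in_alg sigma) (fobj sigma (mu sigma) ⊸ mu sigma).
Proof.
  intros N. constructor; [apply wf_fobj, wf_mu|].
  apply (hasty_in_gen n _ (Var 0)). auto with typing.
Qed.

Lemma in_sub th s : tm_sub th s (in_alg sigma) = in_alg sigma.
Proof. eapply tm_sub_closed, hasty_in, nolin_nil. Qed.

Lemma in_ren x z : tm_ren x z (in_alg sigma) = in_alg sigma.
Proof. rewrite tm_ren_sub. apply in_sub. Qed.

Lemma ext_in_app n G tau f z :
  wf_ty n tau = true -> hasty n (unlin G) f (fobj sigma tau ⊸ tau) ->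
  hasty n G z (fobj sigma (mu sigma)) ->
  ext n G (App (TApp (App (in_alg sigma) z) tau) (Bang f)) (in_body tau f z) tau.
Proof.
  intros W Hf Hz.
  assert (Wa : wf_ty n (fobj sigma tau ⊸ tau) = true) by (simpl; now rewrite wf_fobj).
  assert (hasty n (unlin G) (Bang f) (TBang (fobj sigma tau ⊸ tau)))
    by (constructor; auto with typing).
  assert (H1 : hasty n (SInt (fobj sigma tau ⊸ tau) :: G) (in_body tau (Var 0) (tm_wk 1 z)) tau).
  { apply hasty_in_body; auto; [simpl; auto with typing|].
    apply (hasty_wk _ _ _ _ [SInt _]); auto with typing. }
  rewrite in_alg_eq.
  eapply ext_trans; [eapply ext_app; [apply split_unlin_r| |apply ext_refl; eassumption]|].
  - eapply ext_trans; [eapply (ext_tapp n G (TArr (sigma ⊸ TVar 0) (TVar 0)))|]; [|assumption|].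
    + eapply ext_base'; [apply beta_lol| | |].
      * cbn [tm_sub]. rewrite tm_sub_ILam, in_body_sub. unfold upT.
        instantiate (1 := TLam (ILam (sigma ⊸ TVar 0) (in_body (TVar 0) (Var 0) (tm_ren S S z)))).
        do 2 f_equal; [fold (upT TVar); rewrite upT_id; apply ty_sub_id|].
        simpl. unfold tm_wk. rewrite tm_ren_ren. reflexivity.
      * eapply ht_app; [apply split_unlin_l|apply hasty_in; auto with typing|assumption].
      * now apply hasty_in_gen.
    + eapply ext_base' with (u' := ILam (fobj sigma tau ⊸ tau) (in_body tau (Var 0) (tm_wk 1 z)));
        [apply beta_all| | |].
      * rewrite tm_sub_ILam, in_body_sub. f_equal. simpl. f_equal.
        unfold tm_wk. rewrite tm_sub_ren, tm_ren_sub. reflexivity.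
      * apply hasty_inst; auto. now apply hasty_in_gen.
      * now apply hasty_ILam.
  - eapply ext_ilam_beta; eauto.
    + rewrite in_body_sub, ty_sub_id, tm_inst_wk1. reflexivity.
    + now apply hasty_in_body.
Qed.

Lemma ext_fold_hom n G tau f :
  nolin G -> wf_ty n tau = true -> hasty n G f (fobj sigma tau ⊸ tau) ->
  ext n G (comp (fobj sigma (mu sigma)) (fold_at tau f) (in_alg sigma))
    (comp (fobj sigma (mu sigma)) f (fmap sigma (mu sigma) tau (fold_at tau f)))
    (fobj sigma (mu sigma) ⊸ tau).
Proof.
  intros N W Hf. apply ext_lam; [apply wf_fobj, wf_mu|].
  assert (Hf' : hasty n (SUsed :: G) (tm_wk 1 f) (fobj sigma tau ⊸ tau))
    by (apply (hasty_wk _ _ _ _ [SUsed]); auto with typing).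
  rewrite <- (unlin_nolin _ N) in Hf'.
  unfold tm_wk. rewrite !fmap_ren, !fold_at_ren, in_ren, mu_ren, !ty_ren_id. fold (tm_wk 1 f).
  eapply ext_trans.
  - apply ext_fold_app; auto. eapply ht_app; [apply split_unlin_l| |].
    + apply hasty_in. auto with typing.
    + auto with typing.
  - apply ext_in_app; auto with typing.
Qed.

Definition strength : tm :=
  TLam (TLam (ILam (TVar 1 ⊸ TVar 0) (fmap sigma (TVar 1) (TVar 0) (Var 0)))).

Definition strength_ty : ty :=
  TAll (TAll (TArr (TVar 1 ⊸ TVar 0) (fobj sigma (TVar 1) ⊸ fobj sigma (TVar 0)))).

Lemma wf_strength_ty n : wf_ty n strength_ty = true.
Proof.
  unfold strength_ty, TArr; cbn [wf_ty]. rewrite !wf_fobj; reflexivity.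
Qed.

Lemma hasty_strength n G : nolin G -> hasty n G strength strength_ty.
Proof.
  intros N. do 2 constructor. apply hasty_ILam; [reflexivity|].
  apply hasty_fmap; auto with typing.
Qed.

Definition strength_at A B f := App (TApp (TApp strength A) B) (Bang f).

Lemma hasty_strength_inst n G A B :
  nolin G -> wf_ty n A = true -> wf_ty n B = true ->
  hasty n G (TApp (TApp strength A) B) (TArr (A ⊸ B) (fobj sigma A ⊸ fobj sigma B)).
Proof.
  intros N WA WB. eapply hasty_cast; [apply ht_tapp; [eapply hasty_cast; [apply ht_tapp|]|]|].
  - now apply hasty_strength.
  - assumption.
  - cbn [ty_sub]. reflexivity.
  - assumption.
  - unfold TArr. cbn [ty_sub upT scons]. rewrite !fobj_sub. simpl.
    rewrite ty_sub_ren, ty_sub_id. reflexivity.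
Qed.

Lemma ext_strength n G A B f :
  nolin G -> wf_ty n A = true -> wf_ty n B = true -> hasty n G f (A ⊸ B) ->
  ext n G (strength_at A B f) (fmap sigma A B f) (fobj sigma A ⊸ fobj sigma B).
Proof.
  intros N WA WB Hf.
  assert (Ht : hasty n (SInt (A ⊸ B) :: G) (fmap sigma A B (Var 0)) (fobj sigma A ⊸ fobj sigma B))
    by (apply hasty_fmap; auto with typing).
  assert (Ht' : hasty (S n) (map (slot_ren S) G)
     (ILam (ty_ren S A ⊸ TVar 0) (fmap sigma (ty_ren S A) (TVar 0) (Var 0)))
     (TArr (ty_ren S A ⊸ TVar 0) (fobj sigma (ty_ren S A) ⊸ fobj sigma (TVar 0)))).
  { apply hasty_ILam; [simpl; now rewrite wf_ty_S|].
    apply hasty_fmap; auto using wf_ty_S with typing. }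
  eapply ext_trans; [eapply ext_app; [apply split_nolin; eauto| |apply ext_refl; constructor; eauto]|].
  - assert (E : TBang (A ⊸ B) ⊸ (fobj sigma A ⊸ fobj sigma B)
      = ty_sub (B .: TVar) (TArr (ty_ren S A ⊸ TVar 0) (fobj sigma (ty_ren S A) ⊸ fobj sigma (TVar 0)))).
    { unfold TArr. cbn [ty_sub]. rewrite !fobj_sub. simpl. rewrite ty_sub_ren, ty_sub_id. reflexivity. }
    rewrite E. eapply ext_trans.
    + apply ext_tapp; [|assumption].
      eapply ext_base'; [apply beta_all| | |].
      * cbn [tm_sub]. rewrite tm_sub_ILam, fmap_sub. simpl. reflexivity.
      * eapply hasty_cast; [eapply ht_tapp; [now apply hasty_strength|assumption]|].
        cbn [ty_sub TArr]. rewrite !fobj_sub. reflexivity.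
      * constructor. exact Ht'.
    + eapply ext_base'; [apply beta_all| | |].
      * rewrite tm_sub_ILam, fmap_sub. simpl. rewrite !ty_sub_ren, !ty_sub_id. reflexivity.
      * apply ht_tapp; auto. constructor. exact Ht'.
      * rewrite <- E. apply hasty_ILam; auto. simpl; now rewrite WA.
  - eapply ext_ilam_beta; eauto.
    + simpl. now rewrite WA.
    + now rewrite unlin_nolin.
    + rewrite fmap_sub, !ty_sub_id. reflexivity.
    + now apply hasty_fmap.
Qed.

End Fix_sigma.

(** * Relations and their substitution *)

Ltac subst_norm :=
  unfold rel_wk, tm_wk, prop_wk, ty_wk2, rel_wkall, TArr, id in *;
  cbn [prop_sub rel_sub prop_ren rel_ren tm_sub tm_ren ty_sub ty_ren upVn uprn arity upV upT upr scons];
  repeat first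
    [ rewrite ty_sub_ren | rewrite ty_ren_tysub | rewrite ty_ren_ren | rewrite ty_sub_sub
    | rewrite tm_sub_ren | rewrite tm_ren_tmsub | rewrite tm_ren_ren | rewrite tm_sub_sub
    | rewrite rel_sub_ren | rewrite rel_ren_relsub | rewrite rel_ren_ren | rewrite rel_sub_sub
    | rewrite prop_sub_ren | rewrite prop_ren_propsub | rewrite prop_sub_sub ].

Ltac subst_eq :=
  subst_norm; try reflexivity;
  lazymatch goal with
  | |- ty_sub _ ?A = ty_sub _ ?A => f_equal; subst_eq_fun
  | |- tm_sub _ _ ?t = tm_sub _ _ ?t => f_equal; subst_eq_fun
  | |- rel_sub _ _ _ ?r = rel_sub _ _ _ ?r => f_equal; subst_eq_fun
  | |- prop_sub _ _ _ ?r = prop_sub _ _ _ ?r => f_equal; subst_eq_fun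
  | |- ty_ren _ ?A = _ => rewrite (ty_ren_sub _ A); subst_eq
  | |- _ = ty_ren _ ?A => rewrite (ty_ren_sub _ A); subst_eq
  | |- tm_ren _ _ ?A = _ => rewrite (tm_ren_sub _ _ A); subst_eq
  | |- _ = tm_ren _ _ ?A => rewrite (tm_ren_sub _ _ A); subst_eq
  | |- rel_ren _ _ _ ?A = _ => rewrite (rel_ren_sub A); subst_eq
  | |- _ = rel_ren _ _ _ ?A => rewrite (rel_ren_sub A); subst_eq
  | |- prop_ren _ _ _ ?A = _ => rewrite (prop_ren_sub A); subst_eq
  | |- _ = prop_ren _ _ _ ?A => rewrite (prop_ren_sub A); subst_eq
  | |- ty_sub _ ?A = ?A => etransitivity; [|apply ty_sub_id]; f_equal; subst_eq_fun
  | |- tm_sub _ _ ?A = ?A => etransitivity; [|apply tm_sub_id]; f_equal; subst_eq_fun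
  | |- rel_sub _ _ _ ?A = ?A => etransitivity; [|apply rel_sub_id]; f_equal; subst_eq_fun
  | |- prop_sub _ _ _ ?A = ?A => etransitivity; [|apply prop_sub_id]; f_equal; subst_eq_fun
  | |- ?A = ty_sub _ ?A => symmetry; subst_eq
  | |- ?A = tm_sub _ _ ?A => symmetry; subst_eq
  | |- ?A = rel_sub _ _ _ ?A => symmetry; subst_eq
  | |- ?A = prop_sub _ _ _ ?A => symmetry; subst_eq
  | |- (fun _ => _) = _ => subst_eq_fun
  | |- _ = (fun _ => _) => subst_eq_fun
  | |- upT _ = _ => subst_eq_fun
  | |- _ = upT _ => subst_eq_fun
  | |- _ .: _ = _ => subst_eq_fun
  | |- _ = _ .: _ => subst_eq_fun
  | |- upV _ = _ => subst_eq_fun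
  | |- _ = upV _ => subst_eq_fun
  | |- ?a = ?b => first [progress f_equal | idtac "stuck:" a "=" b; fail]; subst_eq
  end
with subst_eq_fun :=
  let i := fresh "i" in
  apply functional_extensionality; intro i;
  first [reflexivity | solve [destruct i as [|[|[|[|i]]]]; simpl; subst_eq] | simpl; subst_eq].

Lemma rlol_sub th s q A A' B B' r r' :
  rel_sub th s q (rlol A A' B B' r r')
  = rlol (ty_sub th A) (ty_sub th A') (ty_sub th B) (ty_sub th B')
         (rel_sub th s q r) (rel_sub th s q r').
Proof. unfold rlol. subst_eq. Qed.

Lemma rarr_sub th s q A A' B B' r r' :
  rel_sub th s q (rarr A A' B B' r r')
  = rarr (ty_sub th A) (ty_sub th A') (ty_sub th B) (ty_sub th B')
         (rel_sub th s q r) (rel_sub th s q r').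
Proof. unfold rarr. subst_eq. Qed.

Definition upQ (q : nat -> rel) : nat -> rel := RVar 0 .: (fun i => rel_wkall (q i)).

Lemma rall_sub th s q A A' r :
  rel_sub th s q (rall A A' r)
  = rall (ty_sub (upT th) A) (ty_sub (upT th) A')
     (rel_sub (upT (upT th)) (fun i => tm_ren (Nat.add 2) id (s i)) (upQ q) r).
Proof. unfold rall. subst_eq. Qed.

Lemma reindex_sub th s q A B f g r :
  rel_sub th s q (reindex A B f g r)
  = reindex (ty_sub th A) (ty_sub th B) (tm_sub th s f) (tm_sub th s g) (rel_sub th s q r).
Proof. unfold reindex. subst_eq. Qed.

Lemma graph_sub th s q A B f :
  rel_sub th s q (graph A B f) = graph (ty_sub th A) (ty_sub th B) (tm_sub th s f).
Proof. unfold graph. subst_eq. Qed.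

Lemma rel_wkall_sub th s q r :
  rel_sub (upT (upT th)) (fun i => tm_ren (Nat.add 2) id (s i)) (upQ q) (rel_wkall r)
  = rel_wkall (rel_sub th s q r).
Proof. subst_eq. Qed.

Lemma upT_wk2 th A : ty_sub (upT (upT th)) (ty_wk2 A) = ty_wk2 (ty_sub th A).
Proof. subst_eq. Qed.

Lemma upT_wk th A : ty_sub (upT th) (ty_ren S A) = ty_ren S (ty_sub th A).
Proof. subst_eq. Qed.

Lemma enc_ten_sub th s A B : tm_sub th s (enc_ten A B) = enc_ten (ty_sub th A) (ty_sub th B).
Proof. unfold enc_ten. subst_eq. Qed.

Lemma enc_bang_sub th s A : tm_sub th s (enc_bang A) = enc_bang (ty_sub th A).
Proof. unfold enc_bang. subst_eq. Qed.

Lemma rten_sub th s q A A' B B' r r' :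
  rel_sub th s q (rten A A' B B' r r')
  = rten (ty_sub th A) (ty_sub th A') (ty_sub th B) (ty_sub th B')
         (rel_sub th s q r) (rel_sub th s q r').
Proof.
  unfold rten. rewrite reindex_sub, !enc_ten_sub, rall_sub, !rlol_sub, !rel_wkall_sub.
  cbn [ty_sub]. rewrite !upT_wk2, !upT_wk. reflexivity.
Qed.

Lemma rbang_sub th s q A A' r :
  rel_sub th s q (rbang A A' r)
  = rbang (ty_sub th A) (ty_sub th A') (rel_sub th s q r).
Proof.
  unfold rbang. rewrite reindex_sub, !enc_bang_sub, rall_sub, !rlol_sub, rarr_sub, !rel_wkall_sub.
  unfold TArr. cbn [ty_sub]. rewrite !upT_wk2, !upT_wk. reflexivity.
Qed.

Lemma rone_sub th s q : rel_sub th s q rone = rone.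
Proof. reflexivity. Qed.

Lemma interp_sub A : forall th th' r th0 s q,
  rel_sub th0 s q (interp th th' r A)
  = interp (fun i => ty_sub th0 (th i)) (fun i => ty_sub th0 (th' i))
           (fun i => rel_sub th0 s q (r i)) A.
Proof.
  induction A; intros; cbn [interp];
    rewrite ?rone_sub, ?rten_sub, ?rlol_sub, ?rbang_sub, ?ty_sub_sub; rewrite_hyps.
  rewrite rall_sub, IHA. rewrite !ty_sub_sub, !upT_comp.
  do 2 f_equal; fext_case; simpl; rewrite ?upT_wk2, ?rel_wkall_sub; try reflexivity.
Qed.

Lemma interp_ren A : forall th th' r x,
  interp th th' r (ty_ren x A)
  = interp (fun i => th (x i)) (fun i => th' (x i)) (fun i => r (x i)) A.
Proof.
  induction A; intros; cbn [interp ty_ren]; rewrite ?ty_sub_ren; rewrite_hyps.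
  rewrite IHA. f_equal; f_equal; fext_case; reflexivity.
Qed.

Lemma interp_ext A : forall k th th' r th1 th1' r1,
  wf_ty k A = true ->
  (forall i, i < k -> th i = th1 i /\ th' i = th1' i /\ r i = r1 i) ->
  interp th th' r A = interp th1 th1' r1 A.
Proof.
  induction A; intros k th th' r th1 th1' r1 W H; cbn [interp]; simpl in W; bool_hyps;
    repeat match goal with
    | K : wf_ty _ ?A = true |- context [ty_sub th ?A] =>
        rewrite (ty_sub_ext _ th th1 A K) by (intros; now apply H)
    | K : wf_ty _ ?A = true |- context [ty_sub th' ?A] =>
        rewrite (ty_sub_ext _ th' th1' A K) by (intros; now apply H)
    end.
  - now apply H.
  - reflexivity.
  - rewrite (IHA1 k th th' r th1 th1' r1), (IHA2 k th th' r th1 th1' r1); auto.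
  - rewrite (IHA1 k th th' r th1 th1' r1), (IHA2 k th th' r th1 th1' r1); auto.
  - rewrite (IHA k th th' r th1 th1' r1); auto.
  - f_equal.
    + eapply ty_sub_ext; eauto. intros [|i] Hi; simpl; [reflexivity|].
      destruct (H i) as (-> & _ & _); auto; lia.
    + eapply ty_sub_ext; eauto. intros [|i] Hi; simpl; [reflexivity|].
      destruct (H i) as (_ & -> & _); auto; lia.
    + eapply IHA; eauto. intros [|i] Hi; simpl; auto.
      destruct (H i) as (-> & -> & ->); auto; lia.
Qed.

Scheme wf_prop_mut := Induction for wf_prop Sort Prop
with wf_rel_mut := Induction for wf_rel Sort Prop.
Combined Scheme wf_prop_rel_ind from wf_prop_mut, wf_rel_mut.

Definition thin_i x z (G G' : list ty) : Prop :=
  thin z (map SInt (map (ty_ren x) G)) (map SInt G').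

Definition rctx_map x e (T T' : rctx) : Prop :=
  forall i k A B, nth_error T i = Some (k, A, B) ->
    nth_error T' (e i) = Some (k, ty_ren x A, ty_ren x B).

Lemma hasty_i_ren n m x z G G' t A :
  hasty_i n G t A -> (forall i, i < n -> x i < m) -> thin_i x z G G' ->
  hasty_i m G' (tm_ren x z t) (ty_ren x A).
Proof.
  intros H Hx Ht. eapply hasty_ren; eauto. unfold thin_i in Ht.
  rewrite map_map in *. exact Ht.
Qed.

Lemma thin_i_keep x z G G' A : thin_i x z G G' -> thin_i x (upr z) (A :: G) (ty_ren x A :: G').
Proof. intros H. unfold thin_i; simpl. now constructor. Qed.

Lemma map_SInt x G : map (slot_ren x) (map SInt G) = map SInt (map (ty_ren x) G).
Proof. rewrite !map_map. reflexivity. Qed.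

Lemma thin_i_S x z G G' :
  thin_i x z G G' -> thin_i (upr x) z (map (ty_ren S) G) (map (ty_ren S) G').
Proof.
  intros H. apply (thin_map _ S) in H. rewrite !map_SInt in H. unfold thin_i.
  replace (map (ty_ren (upr x)) (map (ty_ren S) G))
    with (map (ty_ren S) (map (ty_ren x) G)); [exact H|].
  rewrite !map_map. apply map_ext. intros; rewrite !ty_ren_ren. reflexivity.
Qed.

Lemma rctx_map_keep x e T T' k A B :
  rctx_map x e T T' -> rctx_map x (upr e) ((k, A, B) :: T) ((k, ty_ren x A, ty_ren x B) :: T').
Proof.
  intros H [|i] k' A' B' E; simpl in *; [injection E as -> -> ->; reflexivity|auto].
Qed.

Lemma nth_rctx_ren x T i k A B :
  nth_error T i = Some (k, A, B) ->
  nth_error (rctx_ren x T) i = Some (k, ty_ren x A, ty_ren x B).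
Proof. intros E. unfold rctx_ren. rewrite nth_error_map, E. reflexivity. Qed.

Lemma nth_rctx_ren_inv x T i k A B :
  nth_error (rctx_ren x T) i = Some (k, A, B) ->
  exists A' B', nth_error T i = Some (k, A', B') /\ A = ty_ren x A' /\ B = ty_ren x B'.
Proof.
  unfold rctx_ren. rewrite nth_error_map.
  destruct (nth_error T i) as [[[k' A'] B']|]; simpl; [|discriminate].
  intros E; injection E as -> <- <-. eauto.
Qed.

Lemma rctx_map_S x e T T' :
  rctx_map x e T T' -> rctx_map (upr x) e (rctx_ren S T) (rctx_ren S T').
Proof.
  intros H i k A B E. destruct (nth_rctx_ren_inv _ _ _ _ _ _ E) as (A' & B' & E' & -> & ->).
  rewrite (nth_rctx_ren S T' (e i) k _ _ (H _ _ _ _ E')).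
  rewrite !ty_ren_ren. reflexivity.
Qed.

Lemma wf_ren :
  (forall n G T f, wf_prop n G T f -> forall m x z e G' T',
     (forall i, i < n -> x i < m) -> thin_i x z G G' -> rctx_map x e T T' ->
     wf_prop m G' T' (prop_ren x z e f)) /\
  (forall n G T r A B, wf_rel n G T r A B -> forall m x z e G' T',
     (forall i, i < n -> x i < m) -> thin_i x z G G' -> rctx_map x e T T' ->
     wf_rel m G' T' (rel_ren x z e r) (ty_ren x A) (ty_ren x B)).
Proof.
  assert (U : forall n m x, (forall i, i < n -> x i < m) -> forall i, i < S n -> upr x i < S m).
  { intros n m x H [|i] Hi; simpl; [lia|]. assert (x i < m) by (apply H; lia). lia. }
  apply wf_prop_rel_ind; intros; simpl; econstructor;
    eauto using hasty_i_ren, wf_ty_ren, thin_i_keep, thin_i_S, rctx_map_keep, rctx_map_S.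
Qed.

Lemma thin_SInt D G : thin (Nat.add (length D)) (map SInt G) (map SInt (D ++ G)).
Proof.
  induction D; simpl; [apply thin_id|].
  apply (thin_skip (Nat.add (length D))); auto using nonlin_int.
Qed.

Lemma map_ty_id G : map (ty_ren id) G = G.
Proof. rewrite <- (map_id G) at 2. apply map_ext, ty_ren_id. Qed.

Lemma thin_i_wk D G : thin_i id (Nat.add (length D)) G (D ++ G).
Proof. unfold thin_i. rewrite map_ty_id. apply thin_SInt. Qed.

Lemma thin_i_tren x G : thin_i x id G (map (ty_ren x) G).
Proof. apply thin_id. Qed.

Lemma rctx_map_id T : rctx_map id id T T.
Proof. intros i k A B E. now rewrite !ty_ren_id. Qed.

Lemma hasty_i_wk n G t A D : hasty_i n G t A -> hasty_i n (D ++ G) (tm_wk (length D) t) A.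
Proof.
  intros H. rewrite <- (ty_ren_id A). eapply hasty_i_ren; eauto using thin_i_wk.
Qed.

Lemma wf_rel_wk n G T r A B D :
  wf_rel n G T r A B -> wf_rel n (D ++ G) T (rel_wk (length D) r) A B.
Proof.
  intros H. rewrite <- (ty_ren_id A), <- (ty_ren_id B).
  eapply wf_ren; eauto using thin_i_wk, rctx_map_id.
Qed.

Definition ctx2 (G : list ty) : list ty := map (ty_ren S) (map (ty_ren S) G).
Definition rctx2 (T : rctx) : rctx := (KAdm, TVar 1, TVar 0) :: rctx_ren S (rctx_ren S T).

Lemma ctx2_eq G : ctx2 G = map (ty_ren (Nat.add 2)) G.
Proof. unfold ctx2. rewrite map_map. apply map_ext. intros A; exact (ty_ren_ren S S A). Qed.

Lemma thin_i_2 G : thin_i (Nat.add 2) id G (ctx2 G).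
Proof. rewrite ctx2_eq. apply thin_i_tren. Qed.

Lemma rctx_map_2 T : rctx_map (Nat.add 2) S T (rctx2 T).
Proof.
  intros i k A B E. simpl. do 2 apply (nth_rctx_ren S) in E. rewrite E.
  rewrite !ty_ren_ren. reflexivity.
Qed.

Lemma hasty_i_2 n G t A :
  hasty_i n G t A -> hasty_i (S (S n)) (ctx2 G) (tm_ren (Nat.add 2) id t) (ty_wk2 A).
Proof. intros H. eapply hasty_i_ren; eauto using thin_i_2. simpl; intros; lia. Qed.

Lemma wf_rel_2 n G T r A B :
  wf_rel n G T r A B ->
  wf_rel (S (S n)) (ctx2 G) (rctx2 T) (rel_wkall r) (ty_wk2 A) (ty_wk2 B).
Proof. intros H. eapply wf_ren; eauto using thin_i_2, rctx_map_2. simpl; intros; lia. Qed.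

Lemma hasty_i_var n G i A : nth_error G i = Some A -> hasty_i n G (Var i) A.
Proof.
  intros E. apply ht_int; auto with nolin. now rewrite nth_error_map, E.
Qed.

Lemma hasty_i_app n G A B t u : hasty_i n G t (A ⊸ B) -> hasty_i n G u A -> hasty_i n G (App t u) B.
Proof. intros. eapply ht_app; eauto. apply split_nolin; auto with nolin. Qed.

Lemma hasty_i_bang n G A t : hasty_i n G t A -> hasty_i n G (Bang t) (TBang A).
Proof. constructor; auto with nolin. Qed.

Lemma hasty_i_arr n G A B t u : hasty_i n G t (TArr A B) -> hasty_i n G u A -> hasty_i n G (App t (Bang u)) B.
Proof. intros. eapply hasty_i_app; eauto using hasty_i_bang. Qed.

#[export] Hint Resolve hasty_i_app hasty_i_bang hasty_i_arr : hi.
#[export] Hint Extern 1 (hasty_i _ _ (Var _) _) => apply hasty_i_var; reflexivity : hi.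

Lemma wf_rlol n G T A A' B B' r r' :
  wf_ty n A = true -> wf_ty n A' = true -> wf_ty n B = true -> wf_ty n B' = true ->
  wf_rel n G T r A A' -> wf_rel n G T r' B B' ->
  wf_rel n G T (rlol A A' B B' r r') (A ⊸ B) (A' ⊸ B').
Proof.
  intros. unfold rlol. constructor; try (simpl; now rewrite andb_true_iff).
  do 2 (constructor; auto).
  constructor; econstructor; eauto with hi.
  - now apply (wf_rel_wk _ _ _ _ _ _ [_; _; _; _]).
  - now apply (wf_rel_wk _ _ _ _ _ _ [_; _; _; _]).
Qed.

Lemma wf_rarr n G T A A' B B' r r' :
  wf_ty n A = true -> wf_ty n A' = true -> wf_ty n B = true -> wf_ty n B' = true ->
  wf_rel n G T r A A' -> wf_rel n G T r' B B' ->
  wf_rel n G T (rarr A A' B B' r r') (TArr A B) (TArr A' B').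
Proof.
  intros. unfold rarr. constructor; try (simpl; now rewrite andb_true_iff).
  do 2 (constructor; auto).
  constructor; econstructor; eauto with hi.
  - now apply (wf_rel_wk _ _ _ _ _ _ [_; _; _; _]).
  - now apply (wf_rel_wk _ _ _ _ _ _ [_; _; _; _]).
Qed.

Lemma hasty_i_tapp n G t A B C :
  hasty_i n G t (TAll A) -> wf_ty n B = true -> C = ty_sub (B .: TVar) A ->
  hasty_i n G (TApp t B) C.
Proof. intros Ht W ->. now apply ht_tapp. Qed.

Lemma wf_rall n G T A A' r :
  wf_ty (S n) A = true -> wf_ty (S n) A' = true ->
  wf_rel (S (S n)) (ctx2 G) (rctx2 T) r
    (ty_sub (TVar 1 .: (fun i => TVar (S (S i)))) A)
    (ty_sub (TVar 0 .: (fun i => TVar (S (S i)))) A') ->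
  wf_rel n G T (rall A A' r) (TAll A) (TAll A').
Proof.
  intros WA WA' Wr. unfold rall. constructor; auto.
  do 2 constructor. constructor; auto. simpl.
  econstructor; [apply (wf_rel_wk _ _ _ _ _ _ [_; _]); exact Wr| |].
  - eapply hasty_i_tapp; [now apply hasty_i_var|reflexivity|]. subst_eq.
  - eapply hasty_i_tapp; [now apply hasty_i_var|reflexivity|]. subst_eq.
Qed.

Lemma wf_reindex n G T A A' B B' f g r :
  wf_ty n A = true -> wf_ty n A' = true ->
  hasty_i n G f (A ⊸ B) -> hasty_i n G g (A' ⊸ B') -> wf_rel n G T r B B' ->
  wf_rel n G T (reindex A A' f g r) A A'.
Proof.
  intros. unfold reindex. constructor; auto.
  econstructor; [apply (wf_rel_wk _ _ _ _ _ _ [_; _]); eassumption| |].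
  - eapply hasty_i_app; [apply (hasty_i_wk _ _ _ _ [_; _]); eassumption|]. now apply hasty_i_var.
  - eapply hasty_i_app; [apply (hasty_i_wk _ _ _ _ [_; _]); eassumption|]. now apply hasty_i_var.
Qed.

Lemma wf_rvar0 n G T : wf_rel n G (rctx2 T) (RVar 0) (TVar 1) (TVar 0).
Proof. econstructor. reflexivity. Qed.

Lemma wf_cast n G T r A B A' B' : wf_rel n G T r A B -> A = A' -> B = B' -> wf_rel n G T r A' B'.
Proof. intros; subst; assumption. Qed.

Lemma hasty_enc_ten n G A B :
  wf_ty n A = true -> wf_ty n B = true -> nolin G ->
  hasty n G (enc_ten A B)
    (A ⊗ B ⊸ TAll ((ty_ren S A ⊸ ty_ren S B ⊸ TVar 0) ⊸ TVar 0)).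
Proof.
  intros WA WB N. constructor; [simpl; now rewrite WA|].
  eapply (ht_let _ _ (SLin _ :: G) (SUsed :: G) PTen); auto with split typing; [constructor|].
  constructor. simpl. constructor; [simpl; now rewrite !wf_ty_S|].
  apply (nolin_map_r S) in N.
  eapply (ht_app _ _ (SLin _ :: SUsed :: SLin _ :: SUsed :: map (slot_ren S) G)
                     (SUsed :: SLin _ :: SUsed :: SUsed :: map (slot_ren S) G));
    auto 7 with split typing.
  eapply (ht_app _ _ (SLin _ :: SUsed :: SUsed :: SUsed :: map (slot_ren S) G)
                     (SUsed :: SUsed :: SLin _ :: SUsed :: map (slot_ren S) G));
    auto 7 with split typing.
Qed.

Lemma hasty_enc_one n G : nolin G -> hasty n G enc_one (TOne ⊸ TAll (TVar 0 ⊸ TVar 0)).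
Proof.
  intros N. constructor; auto.
  eapply (ht_let _ _ (SLin _ :: G) (SUsed :: G) PStar); auto with split typing; [constructor|].
  constructor. simpl. constructor; auto with typing.
Qed.

Lemma hasty_enc_bang n G A :
  wf_ty n A = true -> nolin G ->
  hasty n G (enc_bang A) (TBang A ⊸ TAll (TArr (ty_ren S A) (TVar 0) ⊸ TVar 0)).
Proof.
  intros WA N. unfold enc_bang, TArr. constructor; auto. constructor. simpl.
  constructor; [simpl; now rewrite wf_ty_S|].
  eapply (ht_app _ _ (SLin _ :: SUsed :: map (slot_ren S) G)
                     (SUsed :: SLin _ :: map (slot_ren S) G)); auto 7 with split typing.
Qed.

Lemma sub_wk_1 A : ty_sub (TVar 1 .: (fun i => TVar (S (S i)))) (ty_ren S A) = ty_wk2 A.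
Proof. subst_eq. Qed.
Lemma sub_wk_0 A : ty_sub (TVar 0 .: (fun i => TVar (S (S i)))) (ty_ren S A) = ty_wk2 A.
Proof. subst_eq. Qed.

Ltac wfs := simpl; rewrite ?andb_true_iff; repeat split; auto using wf_ty_S, wf_ty_2.

Lemma wf_rten n G T A A' B B' r r' :
  wf_ty n A = true -> wf_ty n A' = true -> wf_ty n B = true -> wf_ty n B' = true ->
  wf_rel n G T r A A' -> wf_rel n G T r' B B' ->
  wf_rel n G T (rten A A' B B' r r') (A ⊗ B) (A' ⊗ B').
Proof.
  intros. eapply wf_reindex; [wfs|wfs|apply hasty_enc_ten; auto with nolin..|].
  apply wf_rall; [wfs|wfs|]. cbn [ty_sub]. rewrite !sub_wk_1, !sub_wk_0.
  repeat first [apply wf_rlol | apply wf_rel_2 | apply wf_rvar0]; auto; wfs.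
Qed.

Lemma wf_rone n G T : wf_rel n G T rone TOne TOne.
Proof.
  eapply wf_reindex; [wfs|wfs|apply hasty_enc_one; auto with nolin..|].
  apply wf_rall; [wfs|wfs|]. apply wf_rlol; auto using wf_rvar0.
Qed.

Definition rbang_rel A A' r : rel :=
  rall (TArr (ty_ren S A) (TVar 0) ⊸ TVar 0)
          (TArr (ty_ren S A') (TVar 0) ⊸ TVar 0)
          (rlol (TArr (ty_wk2 A) (TVar 1)) (TArr (ty_wk2 A') (TVar 0))
                (TVar 1) (TVar 0)
             (rarr (ty_wk2 A) (ty_wk2 A') (TVar 1) (TVar 0)
                (rel_wkall r) (RVar 0))
             (RVar 0)).

Lemma wf_rbang_rel n G T A A' r :
  wf_ty n A = true -> wf_ty n A' = true -> wf_rel n G T r A A' ->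
  wf_rel n G T (rbang_rel A A' r) (TAll (TArr (ty_ren S A) (TVar 0) ⊸ TVar 0))
          (TAll (TArr (ty_ren S A') (TVar 0) ⊸ TVar 0)).
Proof.
  intros. apply wf_rall; [wfs|wfs|]. unfold TArr. cbn [ty_sub]. rewrite sub_wk_1, sub_wk_0.
  repeat first [apply wf_rarr | apply wf_rlol | apply wf_rel_2 | apply wf_rvar0]; auto; wfs.
Qed.

Lemma wf_rbang n G T A A' r :
  wf_ty n A = true -> wf_ty n A' = true -> wf_rel n G T r A A' ->
  wf_rel n G T (rbang A A' r) (TBang A) (TBang A').
Proof.
  intros. eapply wf_reindex; [wfs|wfs|apply hasty_enc_bang; auto with nolin..|].
  now apply wf_rbang_rel.
Qed.

Lemma wf_interp A : forall k n G T th th' r,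
  wf_ty k A = true ->
  (forall i, i < k -> wf_ty n (th i) = true /\ wf_ty n (th' i) = true /\
     wf_rel n G T (r i) (th i) (th' i)) ->
  wf_rel n G T (interp th th' r A) (ty_sub th A) (ty_sub th' A).
Proof.
  induction A; intros k n G T th th' r W H; simpl in W; bool_hyps; cbn [interp ty_sub];
    assert (forall B, wf_ty k B = true -> wf_ty n (ty_sub th B) = true)
      by (intros; eapply wf_ty_sub; eauto; apply H);
    assert (forall B, wf_ty k B = true -> wf_ty n (ty_sub th' B) = true)
      by (intros; eapply wf_ty_sub; eauto; apply H).
  - now apply H.
  - apply wf_rone.
  - apply wf_rten; eauto.
  - apply wf_rlol; eauto.
  - apply wf_rbang; eauto.
  - apply wf_rall.
    + eapply wf_ty_sub; eauto. intros [|i] Hi; simpl; auto.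
      apply wf_ty_S, H. lia.
    + eapply wf_ty_sub; eauto. intros [|i] Hi; simpl; auto.
      apply wf_ty_S, H. lia.
    + eapply wf_cast; [eapply IHA; eauto| |].
      * intros [|i] Hi; simpl; [repeat split; auto using wf_rvar0|].
        destruct (H i) as (? & ? & ?); [lia|]. repeat split; auto using wf_ty_2, wf_rel_2.
      * subst_eq.
      * subst_eq.
Qed.

(** * Derived rules of the logic *)

Local Notation pr := (prv ext_ie) (only parsing).

Lemma prv_cast n G T H f g : pr n G T H f -> f = g -> pr n G T H g.
Proof. intros; subst; assumption. Qed.

Lemma prv_cut n G T H f g : wf_prop n G T f -> pr n G T H f -> pr n G T (f :: H) g -> pr n G T H g.
Proof. intros W Hf Hg. eapply prv_impE; [apply prv_impI; eauto|assumption]. Qed.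

Lemma prop_ren_ren x z e x' z' e' f :
  prop_ren x z e (prop_ren x' z' e' f)
  = prop_ren (fun i => x (x' i)) (fun i => z (z' i)) (fun i => e (e' i)) f.
Proof. rewrite !(prop_ren_sub _ x), prop_sub_ren, prop_ren_sub. reflexivity. Qed.

Lemma rabs_E n G T H A B f t u g :
  pr n G T H (PRel (RAbs A B f) t u) -> wf_rel n G T (RAbs A B f) A B ->
  hasty_i n G t A -> hasty_i n G u B -> prop_sub TVar (u .: t .: Var) RVar f = g ->
  pr n G T H g.
Proof.
  intros K W Ht Hu <-. eapply prv_impE; [eapply prv_andE1, prv_rabs; eauto|assumption].
Qed.

Lemma rabs_I n G T H A B f t u g :
  pr n G T H g -> wf_rel n G T (RAbs A B f) A B ->
  hasty_i n G t A -> hasty_i n G u B -> prop_sub TVar (u .: t .: Var) RVar f = g ->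
  pr n G T H (PRel (RAbs A B f) t u).
Proof.
  intros K W Ht Hu <-. eapply prv_impE; [eapply prv_andE2, prv_rabs; eauto|assumption].
Qed.

Lemma allV2_E n G T H A B f t u g :
  pr n G T H (PAllV A (PAllV B f)) -> hasty_i n G t A -> hasty_i n G u B ->
  prop_sub TVar (u .: t .: Var) RVar f = g -> pr n G T H g.
Proof.
  intros K Ht Hu <-. eapply prv_allVE in K; [|exact Ht]. cbn [prop_sub] in K.
  rewrite ty_sub_id in K. eapply prv_allVE in K; [|exact Hu].
  eapply prv_cast; [exact K|]. subst_eq.
Qed.

Lemma allV2_I n G T H A B f :
  wf_ty n A = true -> wf_ty n B = true ->
  pr n (B :: A :: G) T (map (prop_wk 2) H) f -> pr n G T H (PAllV A (PAllV B f)).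
Proof.
  intros WA WB K. do 2 (apply prv_allVI; auto).
  replace (map (prop_wk 1) (map (prop_wk 1) H)) with (map (prop_wk 2) H); [assumption|].
  rewrite map_map. apply map_ext. intros; unfold prop_wk. now rewrite prop_ren_ren.
Qed.

Lemma requiv_E1 n G T H A B r r' x y :
  pr n G T H (requiv A B r r') -> hasty_i n G x A -> hasty_i n G y B ->
  pr n G T H (PRel r x y) -> pr n G T H (PRel r' x y).
Proof.
  intros K Hx Hy Hr. eapply allV2_E in K; [|eauto..].
  eapply prv_impE; [eapply prv_cast; [eapply prv_andE1; exact K|]|exact Hr]. subst_eq.
Qed.

Lemma requiv_E2 n G T H A B r r' x y :
  pr n G T H (requiv A B r r') -> hasty_i n G x A -> hasty_i n G y B ->
  pr n G T H (PRel r' x y) -> pr n G T H (PRel r x y).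
Proof.
  intros K Hx Hy Hr. eapply allV2_E in K; [|eauto..].
  eapply prv_impE; [eapply prv_cast; [eapply prv_andE2; exact K|]|exact Hr]. subst_eq.
Qed.

Lemma hasty_i_wk1 n G t A B : hasty_i n G t A -> hasty_i n (B :: G) (tm_wk 1 t) A.
Proof. exact (hasty_i_wk n G t A [B]). Qed.

Lemma hasty_i_wk2 n G t A B C : hasty_i n G t A -> hasty_i n (B :: C :: G) (tm_wk 2 t) A.
Proof. exact (hasty_i_wk n G t A [B; C]). Qed.

Lemma peq_refl n G T H A t : hasty_i n G t A -> pr n G T H (PEq A t t).
Proof. intros. apply prv_ext. now constructor. Qed.

Lemma peq_repl n G T H A t u f g g' :
  pr n G T H (PEq A t u) -> wf_prop n (A :: G) T f ->
  pr n G T H g -> prop_sub TVar (t .: Var) RVar f = g ->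
  prop_sub TVar (u .: Var) RVar f = g' -> pr n G T H g'.
Proof. intros K W Hg <- <-. eapply prv_repl; eauto. Qed.

Lemma peq_sym n G T H A t u :
  hasty_i n G t A -> pr n G T H (PEq A t u) -> pr n G T H (PEq A u t).
Proof.
  intros Ht K. eapply (peq_repl _ _ _ _ _ _ _ (PEq A (Var 0) (tm_wk 1 t)) (PEq A t t));
    [eassumption| |now apply peq_refl|subst_eq|subst_eq].
  constructor; [now apply hasty_i_var|now apply hasty_i_wk1].
Qed.

Lemma peq_trans n G T H A t u v :
  hasty_i n G t A -> pr n G T H (PEq A t u) -> pr n G T H (PEq A u v) -> pr n G T H (PEq A t v).
Proof.
  intros Ht K L. eapply (peq_repl _ _ _ _ _ _ _ (PEq A (tm_wk 1 t) (Var 0)) (PEq A t u));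
    [exact L| |assumption|subst_eq|subst_eq].
  constructor; [now apply hasty_i_wk1|now apply hasty_i_var].
Qed.

Lemma peq_appr n G T H A B f t u :
  hasty_i n G f (A ⊸ B) -> hasty_i n G t A ->
  pr n G T H (PEq A t u) -> pr n G T H (PEq B (App f t) (App f u)).
Proof.
  intros Hf Ht K.
  assert (Hf' := hasty_i_wk1 _ _ _ _ A Hf). assert (Ht' := hasty_i_wk1 _ _ _ _ A Ht).
  eapply (peq_repl _ _ _ _ _ _ _ (PEq B (App (tm_wk 1 f) (tm_wk 1 t)) (App (tm_wk 1 f) (Var 0)))
     (PEq B (App f t) (App f t)));
    [eassumption| |apply peq_refl; eauto with hi|subst_eq|subst_eq].
  constructor; eauto with hi.
Qed.

Lemma peq_appl n G T H A B f g t :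
  hasty_i n G f (A ⊸ B) -> hasty_i n G t A ->
  pr n G T H (PEq (A ⊸ B) f g) -> pr n G T H (PEq B (App f t) (App g t)).
Proof.
  intros Hf Ht K.
  assert (Hf' := hasty_i_wk1 _ _ _ _ (A ⊸ B) Hf). assert (Ht' := hasty_i_wk1 _ _ _ _ (A ⊸ B) Ht).
  eapply (peq_repl _ _ _ _ _ _ _ (PEq B (App (tm_wk 1 f) (tm_wk 1 t)) (App (Var 0) (tm_wk 1 t)))
     (PEq B (App f t) (App f t)));
    [eassumption| |apply peq_refl; eauto with hi|subst_eq|subst_eq].
  constructor; eauto with hi.
Qed.

Lemma rel_conv n G T H A B r t t' u u' :
  wf_rel n G T r A B -> hasty_i n G t' A -> hasty_i n G u B ->
  pr n G T H (PEq A t t') -> pr n G T H (PEq B u u') ->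
  pr n G T H (PRel r t u) -> pr n G T H (PRel r t' u').
Proof.
  intros W Ht Hu Et Eu K.
  assert (Wk : forall C, wf_rel n (C :: G) T (rel_wk 1 r) A B)
    by (intros C; exact (wf_rel_wk n G T r A B [C] W)).
  eapply (peq_repl _ _ _ _ _ _ _ (PRel (rel_wk 1 r) (tm_wk 1 t') (Var 0)));
    [exact Eu| | |reflexivity|subst_eq].
  - econstructor; eauto using hasty_i_wk1 with hi.
  - eapply (peq_repl _ _ _ _ _ _ _ (PRel (rel_wk 1 r) (Var 0) (tm_wk 1 u)));
      [exact Et| |exact K|subst_eq|subst_eq].
    econstructor; eauto using hasty_i_wk1 with hi.
Qed.

Lemma rel_conv_ext n G T H A B r t t' u u' :
  wf_rel n G T r A B -> hasty_i n G t' A -> hasty_i n G u B ->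
  ext n (map SInt G) t t' A -> ext n (map SInt G) u u' B ->
  pr n G T H (PRel r t u) -> pr n G T H (PRel r t' u').
Proof. intros. eapply rel_conv; eauto using prv_ext. Qed.

Lemma wf_req n G T A : wf_ty n A = true -> wf_rel n G T (req A) A A.
Proof. intros. constructor; auto. constructor; now apply hasty_i_var. Qed.

Lemma req_I n G T H A t u :
  wf_ty n A = true -> hasty_i n G t A -> hasty_i n G u A ->
  pr n G T H (PEq A t u) -> pr n G T H (PRel (req A) t u).
Proof. intros W Ht Hu K. eapply rabs_I; [exact K|now apply wf_req|auto..|subst_eq]. Qed.

Lemma req_E n G T H A t u :
  wf_ty n A = true -> hasty_i n G t A -> hasty_i n G u A ->
  pr n G T H (PRel (req A) t u) -> pr n G T H (PEq A t u).
Proof. intros W Ht Hu K. eapply rabs_E; [exact K|now apply wf_req|auto..|subst_eq]. Qed.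

Lemma wf_graph n G T A B f :
  wf_ty n A = true -> wf_ty n B = true -> hasty_i n G f (A ⊸ B) ->
  wf_rel n G T (graph A B f) A B.
Proof.
  intros. constructor; auto. constructor; [|now apply hasty_i_var].
  eapply hasty_i_app; [apply hasty_i_wk2; eassumption|now apply hasty_i_var].
Qed.

Lemma graph_I n G T H A B f t u :
  wf_ty n A = true -> wf_ty n B = true -> hasty_i n G f (A ⊸ B) ->
  hasty_i n G t A -> hasty_i n G u B ->
  pr n G T H (PEq B (App f t) u) -> pr n G T H (PRel (graph A B f) t u).
Proof. intros WA WB Hf Ht Hu K. eapply rabs_I; [exact K|now apply wf_graph|auto..|subst_eq]. Qed.

Lemma graph_E n G T H A B f t u :
  wf_ty n A = true -> wf_ty n B = true -> hasty_i n G f (A ⊸ B) ->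
  hasty_i n G t A -> hasty_i n G u B ->
  pr n G T H (PRel (graph A B f) t u) -> pr n G T H (PEq B (App f t) u).
Proof. intros WA WB Hf Ht Hu K. eapply rabs_E; [exact K|now apply wf_graph|auto..|subst_eq]. Qed.

Lemma reindex_E n G T H A B f g r t u :
  wf_rel n G T (reindex A B f g r) A B -> hasty_i n G t A -> hasty_i n G u B ->
  pr n G T H (PRel (reindex A B f g r) t u) -> pr n G T H (PRel r (App f t) (App g u)).
Proof. intros W Ht Hu K. eapply rabs_E; [exact K|exact W|auto..|subst_eq]. Qed.

Lemma reindex_I n G T H A B f g r t u :
  wf_rel n G T (reindex A B f g r) A B -> hasty_i n G t A -> hasty_i n G u B ->
  pr n G T H (PRel r (App f t) (App g u)) -> pr n G T H (PRel (reindex A B f g r) t u).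
Proof. intros W Ht Hu K. eapply rabs_I; [exact K|exact W|auto..|subst_eq]. Qed.

Lemma rlol_E n G T H A A' B B' r r' f g x y :
  wf_rel n G T (rlol A A' B B' r r') (A ⊸ B) (A' ⊸ B') ->
  hasty_i n G f (A ⊸ B) -> hasty_i n G g (A' ⊸ B') -> hasty_i n G x A -> hasty_i n G y A' ->
  pr n G T H (PRel (rlol A A' B B' r r') f g) -> pr n G T H (PRel r x y) ->
  pr n G T H (PRel r' (App f x) (App g y)).
Proof.
  intros W Hf Hg Hx Hy K L.
  eapply rabs_E in K; [|exact W|auto..|cbn [prop_sub]; rewrite !ty_sub_id; reflexivity].
  eapply allV2_E in K; [|eauto..].
  eapply prv_impE; [eapply prv_cast; [exact K|]|exact L]. subst_eq.
Qed.

Lemma rarr_E n G T H A A' B B' r r' f g x y :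
  wf_rel n G T (rarr A A' B B' r r') (TArr A B) (TArr A' B') ->
  hasty_i n G f (TArr A B) -> hasty_i n G g (TArr A' B') -> hasty_i n G x A -> hasty_i n G y A' ->
  pr n G T H (PRel (rarr A A' B B' r r') f g) -> pr n G T H (PRel r x y) ->
  pr n G T H (PRel r' (App f (Bang x)) (App g (Bang y))).
Proof.
  intros W Hf Hg Hx Hy K L.
  eapply rabs_E in K; [|exact W|auto..|cbn [prop_sub]; rewrite !ty_sub_id; reflexivity].
  eapply allV2_E in K; [|eauto..].
  eapply prv_impE; [eapply prv_cast; [exact K|]|exact L]. subst_eq.
Qed.

Lemma rlol_I n G T H A A' B B' r r' f g :
  wf_ty n A = true -> wf_ty n A' = true -> wf_rel n G T r A A' ->
  wf_rel n G T (rlol A A' B B' r r') (A ⊸ B) (A' ⊸ B') ->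
  hasty_i n G f (A ⊸ B) -> hasty_i n G g (A' ⊸ B') ->
  pr n (A' :: A :: G) T (PRel (rel_wk 2 r) (Var 1) (Var 0) :: map (prop_wk 2) H)
    (PRel (rel_wk 2 r') (App (tm_wk 2 f) (Var 1)) (App (tm_wk 2 g) (Var 0))) ->
  pr n G T H (PRel (rlol A A' B B' r r') f g).
Proof.
  intros WA WA' Wr W Hf Hg K.
  eapply rabs_I; [|exact W|auto..|cbn [prop_sub]; rewrite !ty_sub_id; reflexivity].
  apply allV2_I; auto.
  assert (Wk : wf_rel n (A' :: A :: G) T (rel_wk 2 r) A A')
    by exact (wf_rel_wk n G T r A A' [A'; A] Wr).
  eapply prv_cast; [apply prv_impI; [|exact K]|].
  - econstructor; eauto with hi.
  - subst_eq.
Qed.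

Lemma rarr_I n G T H A A' B B' r r' f g :
  wf_ty n A = true -> wf_ty n A' = true -> wf_rel n G T r A A' ->
  wf_rel n G T (rarr A A' B B' r r') (TArr A B) (TArr A' B') ->
  hasty_i n G f (TArr A B) -> hasty_i n G g (TArr A' B') ->
  pr n (A' :: A :: G) T (PRel (rel_wk 2 r) (Var 1) (Var 0) :: map (prop_wk 2) H)
    (PRel (rel_wk 2 r') (App (tm_wk 2 f) (Bang (Var 1))) (App (tm_wk 2 g) (Bang (Var 0)))) ->
  pr n G T H (PRel (rarr A A' B B' r r') f g).
Proof.
  intros WA WA' Wr W Hf Hg K.
  eapply rabs_I; [|exact W|auto..|cbn [prop_sub]; rewrite !ty_sub_id; reflexivity].
  apply allV2_I; auto.
  assert (Wk : wf_rel n (A' :: A :: G) T (rel_wk 2 r) A A')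
    by exact (wf_rel_wk n G T r A A' [A'; A] Wr).
  eapply prv_cast; [apply prv_impI; [|exact K]|].
  - econstructor; eauto with hi.
  - subst_eq.
Qed.

Lemma rall_E n G T H A A' r t u B B' q C :
  wf_rel n G T (rall A A' r) (TAll A) (TAll A') ->
  hasty_i n G t (TAll A) -> hasty_i n G u (TAll A') ->
  wf_ty n B = true -> wf_ty n B' = true -> defrel ext_ie n G T KAdm q B B' ->
  pr n G T H (PRel (rall A A' r) t u) ->
  rel_sub (B' .: B .: TVar) Var (q .: RVar) r = C ->
  pr n G T H (PRel C (TApp t B) (TApp u B')).
Proof.
  intros W Ht Hu WB WB' Wq K <-.
  eapply rabs_E in K; [|exact W|auto..|reflexivity].
  cbn [prop_sub] in K.
  eapply prv_allTE in K; [|exact WB]. cbn [prop_sub] in K.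
  eapply prv_allTE in K; [|exact WB']. cbn [prop_sub] in K.
  eapply prv_allRE in K; [eapply prv_cast; [exact K|]|].
  - subst_eq.
  - match goal with |- defrel _ _ _ _ _ _ ?X ?Y =>
      replace X with B by subst_eq; replace Y with B' by subst_eq end. exact Wq.
Qed.

Definition prop_wkall (f : prop) : prop := prop_ren (Nat.add 2) id S f.
Definition tm_wkall (t : tm) : tm := tm_ren (Nat.add 2) id t.

Lemma rall_I n G T H A A' r t u :
  wf_rel n G T (rall A A' r) (TAll A) (TAll A') ->
  hasty_i n G t (TAll A) -> hasty_i n G u (TAll A') ->
  pr (S (S n)) (ctx2 G) (rctx2 T) (map prop_wkall H)
    (PRel r (TApp (tm_wkall t) (TVar 1)) (TApp (tm_wkall u) (TVar 0))) ->
  pr n G T H (PRel (rall A A' r) t u).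
Proof.
  intros W Ht Hu K.
  eapply rabs_I; [|exact W|auto..|reflexivity].
  cbn [prop_sub]. do 2 apply prv_allTI. apply prv_allRI; [reflexivity..|].
  replace (map (prop_ren id id S) (map (prop_ren S id id) (map (prop_ren S id id) H)))
    with (map prop_wkall H).
  - eapply prv_cast; [exact K|]. unfold tm_wkall. subst_eq.
  - rewrite !map_map. apply map_ext. intros f. rewrite !prop_ren_ren. reflexivity.
Qed.

Lemma ext_enc_bang n G A B z g :
  nolin G -> wf_ty n A = true -> wf_ty n B = true ->
  hasty n G z (TBang A) -> hasty n G g (TArr A B) ->
  ext n G (App (TApp (App (enc_bang A) z) B) g) (App g z) B.
Proof.
  intros N WA WB Hz Hg.
  assert (H1 : hasty (S n) (map (slot_ren S) G)
     (Lam (TArr (ty_ren S A) (TVar 0)) (App (Var 0) (tm_wk 1 (tm_ren S id z))))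
     (TArr (ty_ren S A) (TVar 0) ⊸ TVar 0)).
  { constructor; [simpl; now rewrite wf_ty_S|].
    apply (ht_app _ _ (SLin (TArr (ty_ren S A) (TVar 0)) :: map (slot_ren S) G)
             (SUsed :: map (slot_ren S) G) (TBang (ty_ren S A))).
    - auto with split nolin.
    - apply ht_lin0. auto with nolin.
    - apply (hasty_wk _ _ _ _ [SUsed]); auto with nolin. now apply (hasty_S _ _ _ (TBang A)). }
  assert (H2 : hasty n G (Lam (TArr A B) (App (Var 0) (tm_wk 1 z))) (TArr A B ⊸ B)).
  { constructor; [simpl; now rewrite WA|].
    apply (ht_app _ _ (SLin (TArr A B) :: G) (SUsed :: G) (TBang A)).
    - auto with split nolin.
    - apply ht_lin0. auto with nolin.
    - apply (hasty_wk _ _ _ _ [SUsed]); auto with nolin. }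
  assert (E : TArr A B ⊸ B = ty_sub (B .: TVar) (TArr (ty_ren S A) (TVar 0) ⊸ TVar 0)) by subst_eq.
  apply ext_trans with (App (Lam (TArr A B) (App (Var 0) (tm_wk 1 z))) g).
  - eapply ext_app; [now apply split_nolin| |apply ext_refl; exact Hg].
    rewrite E.
    set (w := TLam (Lam (TArr (ty_ren S A) (TVar 0)) (App (Var 0) (tm_wk 1 (tm_ren S id z))))).
    assert (Hw : hasty n G w (TAll (TArr (ty_ren S A) (TVar 0) ⊸ TVar 0))) by (constructor; exact H1).
    apply ext_trans with (TApp w B).
    + apply ext_tapp; [|assumption]. eapply ext_base'; [apply beta_lol|unfold w; subst_eq| |exact Hw].
      eapply ht_app; [now apply split_nolin| |exact Hz]. now apply hasty_enc_bang.
    + eapply ext_base'; [apply beta_all|subst_eq|now apply ht_tapp|].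
      rewrite <- E. exact H2.
  - eapply ext_base'; [apply beta_lol| | |].
    + subst_eq.
    + eapply ht_app; [now apply split_nolin|exact H2|exact Hg].
    + eapply ht_app; [now apply split_nolin|exact Hg|exact Hz].
Qed.

Lemma hasty_i_enc_bang n G A z :
  wf_ty n A = true -> hasty_i n G z (TBang A) ->
  hasty_i n G (App (enc_bang A) z) (TAll (TArr (ty_ren S A) (TVar 0) ⊸ TVar 0)).
Proof.
  intros W Hz. eapply hasty_i_app; [|exact Hz]. apply hasty_enc_bang; auto with nolin.
Qed.

Lemma hasty_i_enc_bang_inst n G A B z :
  wf_ty n A = true -> wf_ty n B = true -> hasty_i n G z (TBang A) ->
  hasty_i n G (TApp (App (enc_bang A) z) B) (TArr A B ⊸ B).
Proof.
  intros W WB Hz. eapply hasty_i_tapp; [now apply hasty_i_enc_bang|assumption|]. subst_eq.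
Qed.

Lemma rbang_E n G T H A A' r x y B B' q g h :
  wf_ty n A = true -> wf_ty n A' = true -> wf_rel n G T r A A' ->
  wf_ty n B = true -> wf_ty n B' = true -> wf_rel n G T q B B' ->
  defrel ext_ie n G T KAdm q B B' ->
  hasty_i n G x (TBang A) -> hasty_i n G y (TBang A') ->
  hasty_i n G g (TArr A B) -> hasty_i n G h (TArr A' B') ->
  pr n G T H (PRel (rbang A A' r) x y) ->
  pr n G T H (PRel (rarr A A' B B' r q) g h) ->
  pr n G T H (PRel q (App g x) (App h y)).
Proof.
  intros WA WA' Wr WB WB' Wq Dq Hx Hy Hg Hh K L.
  apply reindex_E in K; [|now apply wf_rbang|assumption..].
  eapply rall_E in K; [|now apply wf_rbang_rel|now apply hasty_i_enc_bang..|exact WB|exact WB'|exact Dq|].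
  2:{ rewrite rlol_sub, rarr_sub. cbn [ty_sub rel_sub scons].
      instantiate (1 := rlol (TArr A B) (TArr A' B') B B' (rarr A A' B B' r q) q).
      f_equal; [| |f_equal]; subst_eq. }
  assert (W1 : wf_rel n G T (rlol (TArr A B) (TArr A' B') B B' (rarr A A' B B' r q) q)
      (TArr A B ⊸ B) (TArr A' B' ⊸ B'))
    by (apply wf_rlol; auto using wf_rarr; wfs).
  pose proof (hasty_i_enc_bang_inst _ _ _ _ _ WA WB Hx) as Hex.
  pose proof (hasty_i_enc_bang_inst _ _ _ _ _ WA' WB' Hy) as Hey.
  apply (rlol_E _ _ _ _ _ _ _ _ _ _ _ _ _ _ W1 Hex Hey Hg Hh K) in L.
  eapply rel_conv_ext; [exact Wq| | | | |exact L].
  - eapply hasty_i_app; eassumption.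
  - eapply hasty_i_app; eassumption.
  - apply ext_enc_bang; auto with nolin.
  - apply ext_enc_bang; auto with nolin.
Qed.

Lemma defrel_rvar0 n G T : defrel ext_ie n G (rctx2 T) KAdm (RVar 0) (TVar 1) (TVar 0).
Proof. now apply adm_var. Qed.

Lemma rbang_I_hyp n G T H A A' r x y :
  wf_ty n A = true -> wf_ty n A' = true -> wf_rel n G T r A A' ->
  hasty_i n G x A -> hasty_i n G y A' -> In (PRel r x y) H ->
  pr n G T H (PRel (rbang A A' r) (Bang x) (Bang y)).
Proof.
  intros WA WA' Wr Hx Hy K.
  assert (Hbx := hasty_i_bang _ _ _ _ Hx). assert (Hby := hasty_i_bang _ _ _ _ Hy).
  apply reindex_I; [now apply wf_rbang|assumption..|].
  apply rall_I; [now apply wf_rbang_rel|now apply hasty_i_enc_bang..|].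
  assert (WA2 := wf_ty_2 _ _ WA). assert (WA2' := wf_ty_2 _ _ WA').
  assert (Wr2 := wf_rel_2 _ _ _ _ _ _ Wr).
  assert (Hx2 := hasty_i_2 _ _ _ _ Hx). assert (Hy2 := hasty_i_2 _ _ _ _ Hy).
  fold (tm_wkall x) in Hx2. fold (tm_wkall y) in Hy2.
  assert (Hbx2 := hasty_i_bang _ _ _ _ Hx2). assert (Hby2 := hasty_i_bang _ _ _ _ Hy2).
  assert (Wa : wf_rel (S (S n)) (ctx2 G) (rctx2 T)
     (rarr (ty_wk2 A) (ty_wk2 A') (TVar 1) (TVar 0) (rel_wkall r) (RVar 0))
     (TArr (ty_wk2 A) (TVar 1)) (TArr (ty_wk2 A') (TVar 0)))
    by (apply wf_rarr; auto using wf_rvar0).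
  set (ex := tm_wkall (App (enc_bang A) (Bang x))).
  set (ey := tm_wkall (App (enc_bang A') (Bang y))).
  assert (Ex : ex = App (enc_bang (ty_wk2 A)) (Bang (tm_wkall x))).
  { subst ex. unfold tm_wkall, enc_bang. subst_eq. }
  assert (Ey : ey = App (enc_bang (ty_wk2 A')) (Bang (tm_wkall y))).
  { subst ey. unfold tm_wkall, enc_bang. subst_eq. }
  assert (Hex : hasty_i (S (S n)) (ctx2 G) (TApp ex (TVar 1)) (TArr (ty_wk2 A) (TVar 1) ⊸ TVar 1))
    by (rewrite Ex; now apply hasty_i_enc_bang_inst).
  assert (Hey : hasty_i (S (S n)) (ctx2 G) (TApp ey (TVar 0)) (TArr (ty_wk2 A') (TVar 0) ⊸ TVar 0))
    by (rewrite Ey; now apply hasty_i_enc_bang_inst).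
  apply rlol_I; auto; [wfs..| |].
  { apply wf_rlol; auto using wf_rvar0; wfs. }
  rewrite Ex, Ey.
  set (G2 := _ :: _ :: ctx2 G). set (H2 := _ :: map _ _).
  assert (W0 : wf_rel (S (S n)) G2 (rctx2 T) (rel_wk 2 (RVar 0)) (TVar 1) (TVar 0))
    by (apply wf_rvar0).
  assert (Hx4 : hasty_i (S (S n)) G2 (tm_wk 2 (tm_wkall x)) (ty_wk2 A)) by now apply hasty_i_wk2.
  assert (Hy4 : hasty_i (S (S n)) G2 (tm_wk 2 (tm_wkall y)) (ty_wk2 A')) by now apply hasty_i_wk2.
  assert (Hv1 : hasty_i (S (S n)) G2 (Var 1) (TArr (ty_wk2 A) (TVar 1))) by now apply hasty_i_var.
  assert (Hv0 : hasty_i (S (S n)) G2 (Var 0) (TArr (ty_wk2 A') (TVar 0))) by now apply hasty_i_var.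
  assert (Wa2 := wf_rel_wk _ _ _ _ _ _
    [TArr (ty_wk2 A') (TVar 0); TArr (ty_wk2 A) (TVar 1)] Wa).
  assert (L : pr (S (S n)) G2 (rctx2 T) H2
    (PRel (rel_wk 2 (RVar 0)) (App (Var 1) (Bang (tm_wk 2 (tm_wkall x))))
                     (App (Var 0) (Bang (tm_wk 2 (tm_wkall y)))))).
  { assert (E : forall r r', rel_wk 2 (rarr (ty_wk2 A) (ty_wk2 A') (TVar 1) (TVar 0) r r')
      = rarr (ty_wk2 A) (ty_wk2 A') (TVar 1) (TVar 0) (rel_wk 2 r) (rel_wk 2 r')).
    { intros r1 r2. unfold rel_wk at 1. rewrite rel_ren_sub, rarr_sub. f_equal; subst_eq. }
    rewrite E in Wa2.
    eapply rarr_E; [exact Wa2|assumption..| |].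
    - rewrite <- E. apply prv_hyp. left. reflexivity.
    - apply prv_hyp. right.
      apply (in_map prop_wkall), (in_map (prop_wk 2)) in K. exact K. }
  assert (Ew : forall A z, tm_wk 2 (TApp (App (enc_bang A) (Bang z)) (TVar 1))
       = TApp (App (enc_bang A) (Bang (tm_wk 2 z))) (TVar 1))
    by (intros; unfold enc_bang; subst_eq).
  assert (Ew' : forall A z, tm_wk 2 (TApp (App (enc_bang A) (Bang z)) (TVar 0))
       = TApp (App (enc_bang A) (Bang (tm_wk 2 z))) (TVar 0))
    by (intros; unfold enc_bang; subst_eq).
  rewrite Ew, Ew'.
  eapply rel_conv_ext; [exact W0| | | | |exact L].
  - eapply hasty_i_app; [apply hasty_i_enc_bang_inst; auto; now apply hasty_i_bang|assumption].
  - now apply hasty_i_arr with (ty_wk2 A').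
  - apply ext_sym, ext_enc_bang; auto with nolin. now apply hasty_i_bang.
  - apply ext_sym, ext_enc_bang; auto with nolin. now apply hasty_i_bang.
Qed.

Lemma rbang_I n G T H A A' r x y :
  wf_ty n A = true -> wf_ty n A' = true -> wf_rel n G T r A A' ->
  hasty_i n G x A -> hasty_i n G y A' -> pr n G T H (PRel r x y) ->
  pr n G T H (PRel (rbang A A' r) (Bang x) (Bang y)).
Proof.
  intros. apply prv_cut with (PRel r x y); [econstructor; eauto|assumption|].
  apply rbang_I_hyp; auto. now left.
Qed.

Lemma interp_all_E n G T H k A th th' r t u B B' q :
  wf_ty (S k) A = true ->
  (forall i, i < k -> wf_ty n (th i) = true /\ wf_ty n (th' i) = true /\
     wf_rel n G T (r i) (th i) (th' i)) ->
  hasty_i n G t (TAll (ty_sub (upT th) A)) -> hasty_i n G u (TAll (ty_sub (upT th') A)) ->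
  wf_ty n B = true -> wf_ty n B' = true -> defrel ext_ie n G T KAdm q B B' ->
  pr n G T H (PRel (interp th th' r (TAll A)) t u) ->
  pr n G T H (PRel (interp (B .: th) (B' .: th') (q .: r) A) (TApp t B) (TApp u B')).
Proof.
  intros W E Ht Hu WB WB' Dq K.
  eapply rall_E; [exact (wf_interp (TAll A) k n G T th th' r W E)|exact Ht|exact Hu|exact WB
    |exact WB'|exact Dq|exact K|].
  rewrite interp_sub. f_equal; fext_case; try reflexivity; simpl; subst_eq.
Qed.

Definition req_var (i : nat) : rel := req (TVar i).

Lemma identity_closed n G T H A :
  wf_ty 0 A = true -> pr n G T H (requiv A A (interp TVar TVar req_var A) (req A)).
Proof. intros W. apply prv_Ax. exact (ax_identity_extension n G T 0 A W). Qed.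

Lemma parametricity n G T H A t :
  wf_ty 0 A = true -> hasty_i n G t A -> pr n G T H (PRel (interp TVar TVar req_var A) t t).
Proof.
  intros W Ht. eapply requiv_E2; [now apply identity_closed|assumption..|].
  apply req_I; auto using peq_refl. now apply wf_ty_le with 0; [|lia].
Qed.

(** * Parametricity and initiality *)

Lemma requiv_sub th s q A B r r' :
  prop_sub th s q (requiv A B r r')
  = requiv (ty_sub th A) (ty_sub th B) (rel_sub th s q r) (rel_sub th s q r').
Proof. unfold requiv, PIff. subst_eq. Qed.

Lemma hasty_i_unlin n G t A : hasty_i n G t A -> hasty n (unlin (map SInt G)) t A.
Proof. intros H. rewrite unlin_nolin; auto with nolin. Qed.

Lemma ext_comp_app n G A B C g f x :
  nolin G -> wf_ty n A = true ->
  hasty n G g (B ⊸ C) -> hasty n G f (A ⊸ B) -> hasty n G x A ->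
  ext n G (App (comp A g f) x) (App g (App f x)) C.
Proof.
  intros N W Hg Hf Hx. eapply ext_base'; [apply beta_lol|simpl; rewrite !tm_inst_wk1; reflexivity| |].
  - eapply ht_app; [now apply split_nolin|now apply (hasty_comp _ _ A B C)|exact Hx].
  - eapply ht_app; [now apply split_nolin|exact Hg|].
    eapply ht_app; [now apply split_nolin|exact Hf|exact Hx].
Qed.

Section Fix_sigma.

Variable sigma : ty.
Hypothesis Hwf : wf_ty 1 sigma = true.
Hypothesis Hpos : polarised true 0 sigma = true.

Lemma interp_fobj_var th th' r i th1 th1' r1 :
  th i = th1 0 -> th' i = th1' 0 -> r i = r1 0 ->
  interp th th' r (fobj sigma (TVar i)) = interp th1 th1' r1 sigma.
Proof.
  intros E1 E2 E3.
  assert (E : fobj sigma (TVar i) = ty_ren (fun _ => i) sigma).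
  { rewrite ty_ren_sub. unfold fobj. eapply ty_sub_ext; [exact Hwf|].
    intros [|j] Hj; [reflexivity|lia]. }
  rewrite E, interp_ren. eapply interp_ext; [exact Hwf|].
  intros [|j] Hj; [auto|lia].
Qed.

Definition sigma_rel (A B : ty) (q : rel) : rel :=
  interp (A .: TVar) (B .: TVar) (q .: req_var) sigma.

Lemma wf_sigma_rel n G T A B q :
  wf_ty n A = true -> wf_ty n B = true -> wf_rel n G T q A B ->
  wf_rel n G T (sigma_rel A B q) (fobj sigma A) (fobj sigma B).
Proof.
  intros WA WB Wq. eapply wf_interp; [exact Hwf|]. intros [|i] Hi; [auto|lia].
Qed.

Lemma sigma_rel_ren x z e A B q :
  rel_ren x z e (sigma_rel A B q) = sigma_rel (ty_ren x A) (ty_ren x B) (rel_ren x z e q).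
Proof.
  unfold sigma_rel. rewrite rel_ren_sub, interp_sub. eapply interp_ext; [exact Hwf|].
  intros [|i] Hi; [|lia]. simpl. rewrite !ty_ren_sub, rel_ren_sub. auto.
Qed.

Lemma sigma_rel_wk k A B q : rel_wk k (sigma_rel A B q) = sigma_rel A B (rel_wk k q).
Proof. unfold rel_wk. now rewrite sigma_rel_ren, !ty_ren_id. Qed.

Lemma sigma_rel_eq n G T H A x y :
  wf_ty n A = true -> hasty_i n G x (fobj sigma A) -> hasty_i n G y (fobj sigma A) ->
  pr n G T H (PRel (sigma_rel A A (req A)) x y) -> pr n G T H (PEq (fobj sigma A) x y).
Proof.
  intros W Hx Hy K. apply req_E; [now apply wf_fobj|assumption..|].
  eapply requiv_E1; [|exact Hx|exact Hy|exact K].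
  assert (I := prv_allTE _ _ _ _ _ _ A (prv_Ax _ _ _ _ H _ (ax_identity_extension n G T 1 sigma Hwf)) W).
  cbn [PAllTn] in I. rewrite requiv_sub, interp_sub in I.
  eapply prv_cast; [exact I|]. unfold sigma_rel, fobj.
  f_equal. f_equal; fext_case; reflexivity.
Qed.

Definition strength_inst_ty : ty :=
  TArr (TVar 1 ⊸ TVar 0) (fobj sigma (TVar 1) ⊸ fobj sigma (TVar 0)).

Lemma strength_rel n G T H A A' B B' q q' f g :
  wf_ty n A = true -> wf_ty n A' = true -> wf_ty n B = true -> wf_ty n B' = true ->
  wf_rel n G T q A A' -> wf_rel n G T q' B B' ->
  defrel ext_ie n G T KAdm q A A' -> defrel ext_ie n G T KAdm q' B B' ->
  hasty_i n G f (A ⊸ B) -> hasty_i n G g (A' ⊸ B') ->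
  pr n G T H (PRel (rlol A A' B B' q q') f g) ->
  pr n G T H (PRel (rlol (fobj sigma A) (fobj sigma A') (fobj sigma B) (fobj sigma B')
                        (sigma_rel A A' q) (sigma_rel B B' q'))
    (strength_at sigma A B f) (strength_at sigma A' B' g)).
Proof.
  intros WA WA' WB WB' Wq Wq' Dq Dq' Hf Hg K.
  assert (N : nolin (map SInt G)) by apply nolin_SInt.
  assert (Hs : hasty_i n G (strength sigma) (strength_ty sigma)) by now apply hasty_strength.
  assert (S0 := parametricity n G T H _ _ (wf_strength_ty sigma Hwf 0) Hs).
  unfold strength_ty in S0, Hs. fold strength_inst_ty in S0, Hs.
  assert (W2 : wf_ty 2 strength_inst_ty = true).
  { unfold strength_inst_ty, TArr. cbn [wf_ty]. rewrite !(wf_fobj _ Hwf); reflexivity. }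
  eapply (interp_all_E n G T H 0) in S0; [|exact W2|intros; lia|..|exact WA|exact WA'|exact Dq].
  2,3: rewrite upT_id, ty_sub_id; exact Hs.
  assert (Hi : forall A B, wf_ty n A = true -> wf_ty n B = true ->
      hasty_i n G (TApp (strength sigma) A) (TAll (ty_sub (upT (A .: TVar)) strength_inst_ty))).
  { intros. eapply hasty_i_tapp; [exact Hs|assumption|reflexivity]. }
  eapply (interp_all_E n G T H 1) in S0; [|exact W2| |eauto..|exact WB|exact WB'|exact Dq'].
  2:{ intros [|i] Hi'; [auto|lia]. }
  assert (EI : interp (B .: A .: TVar) (B' .: A' .: TVar) (q' .: q .: req_var) strength_inst_ty
    = rlol (TBang (A ⊸ B)) (TBang (A' ⊸ B'))
        (fobj sigma A ⊸ fobj sigma B) (fobj sigma A' ⊸ fobj sigma B')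
        (rbang (A ⊸ B) (A' ⊸ B') (rlol A A' B B' q q'))
        (rlol (fobj sigma A) (fobj sigma A') (fobj sigma B) (fobj sigma B')
              (sigma_rel A A' q) (sigma_rel B B' q'))).
  { unfold strength_inst_ty, TArr. cbn [interp ty_sub scons]. rewrite !(fobj_sub _ Hwf).
    unfold sigma_rel.
    rewrite (interp_fobj_var _ _ _ 1 (A .: TVar) (A' .: TVar) (q .: req_var)) by reflexivity.
    rewrite (interp_fobj_var _ _ _ 0 (B .: TVar) (B' .: TVar) (q' .: req_var)) by reflexivity.
    reflexivity. }
  rewrite EI in S0.
  assert (Wr : wf_rel n G T (rlol A A' B B' q q') (A ⊸ B) (A' ⊸ B')) by now apply wf_rlol.
  eapply rlol_E; [|now apply hasty_strength_inst|now apply hasty_strength_inst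
    |now apply hasty_i_bang|now apply hasty_i_bang|exact S0|].
  - apply wf_rlol; try solve [simpl; rewrite ?(wf_fobj _ Hwf), ?WA, ?WA'; auto].
    + apply wf_rbang; auto; simpl; rewrite ?WA, ?WA'; auto.
    + apply wf_rlol; auto using wf_sigma_rel, wf_fobj.
  - apply rbang_I; auto; simpl; rewrite ?WA, ?WA'; auto.
Qed.

Lemma comp_ren x z A g f :
  tm_ren x z (comp A g f) = comp (ty_ren x A) (tm_ren x z g) (tm_ren x z f).
Proof. rewrite !tm_ren_sub, comp_sub, ty_ren_sub. reflexivity. Qed.

Lemma graph_wk k A B f : rel_wk k (graph A B f) = graph A B (tm_wk k f).
Proof. unfold rel_wk. rewrite rel_ren_sub, graph_sub. f_equal; subst_eq. Qed.

(** One half of the graph lemma [σ[⟨f⟩] ≡ ⟨σ(f)⟩]. *)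
Lemma sigma_graph n G T H A B f x y :
  wf_ty n A = true -> wf_ty n B = true -> hasty_i n G f (A ⊸ B) ->
  hasty_i n G x (fobj sigma A) -> hasty_i n G y (fobj sigma B) ->
  pr n G T H (PRel (sigma_rel A B (graph A B f)) x y) ->
  pr n G T H (PEq (fobj sigma B) (App (fmap sigma A B f) x) y).
Proof.
  intros WA WB Hf Hx Hy K.
  assert (N : nolin (map SInt G)) by apply nolin_SInt.
  assert (Hid : hasty_i n G (idtm B) (B ⊸ B)) by now apply hasty_id.
  assert (Wg : wf_rel n G T (graph A B f) A B) by now apply wf_graph.
  assert (We : wf_rel n G T (req B) B B) by now apply wf_req.
  assert (R : pr n G T H (PRel (rlol A B B B (graph A B f) (req B)) f (idtm B))).
  { apply rlol_I; auto using wf_rlol. rewrite graph_wk.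
    change (rel_wk 2 (req B)) with (rel_ren id (Nat.add 2) id (req B)).
    replace (rel_ren id (Nat.add 2) id (req B)) with (req B) by (unfold req; subst_eq).
    set (G2 := B :: A :: G).
    assert (N2 : nolin (map SInt G2)) by apply nolin_SInt.
    assert (H1 : hasty_i n G2 (Var 1) A) by now apply hasty_i_var.
    assert (H0 : hasty_i n G2 (Var 0) B) by now apply hasty_i_var.
    assert (Hf2 : hasty_i n G2 (tm_wk 2 f) (A ⊸ B)) by now apply hasty_i_wk2.
    assert (Hid2 : hasty_i n G2 (idtm B) (B ⊸ B)) by now apply hasty_id.
    replace (tm_wk 2 (idtm B)) with (idtm B) by (unfold idtm; subst_eq).
    apply req_I; eauto with hi.
    eapply peq_trans; [eauto with hi|eapply graph_E; [exact WA|exact WB|exact Hf2|exact H1|exact H0|]|].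
    - apply prv_hyp. now left.
    - apply prv_ext, ext_sym. apply app_id; auto using hasty_i_unlin.
      + apply ext_refl, hasty_i_unlin, Hid2.
      + now apply ext_refl. }
  assert (L := strength_rel n G T H A B B B _ _ f (idtm B) WA WB WB WB Wg We
    (adm_graph _ _ _ _ _ _ _ WA WB Hf) (adm_eq _ _ _ _ _ WB) Hf Hid R).
  assert (Hs : forall C D f, wf_ty n C = true -> wf_ty n D = true -> hasty_i n G f (C ⊸ D) ->
     hasty_i n G (strength_at sigma C D f) (fobj sigma C ⊸ fobj sigma D)).
  { intros. eapply hasty_i_arr; [now apply hasty_strength_inst|assumption]. }
  assert (Wl : wf_rel n G T
    (rlol (fobj sigma A) (fobj sigma B) (fobj sigma B) (fobj sigma B)
       (sigma_rel A B (graph A B f)) (sigma_rel B B (req B)))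
    (fobj sigma A ⊸ fobj sigma B) (fobj sigma B ⊸ fobj sigma B))
    by (apply wf_rlol; auto using wf_fobj, wf_sigma_rel).
  assert (Hsf := Hs A B f WA WB Hf). assert (Hsi := Hs B B (idtm B) WB WB Hid).
  apply (rlol_E _ _ _ _ _ _ _ _ _ _ _ _ _ _ Wl Hsf Hsi Hx Hy L) in K.
  apply sigma_rel_eq in K; [|eauto with hi..].
  apply peq_trans with (App (strength_at sigma A B f) x).
  { eapply hasty_i_app; [now apply hasty_fmap|exact Hx]. }
  { apply prv_ext, ext_sym. eapply ext_app; [now apply split_nolin| |apply ext_refl; exact Hx].
    now apply ext_strength. }
  apply peq_trans with (App (strength_at sigma B B (idtm B)) y); [eauto with hi|exact K|].
  apply prv_ext, app_id; auto using wf_fobj, ext_refl.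
  rewrite unlin_nolin by assumption. eapply ext_trans; [now apply ext_strength|].
  now apply ext_fmap_id.
Qed.

Definition mu_body_rel (q : rel) (A B : ty) : rel :=
  rlol (TBang (fobj sigma A ⊸ A)) (TBang (fobj sigma B ⊸ B)) A B
    (rbang (fobj sigma A ⊸ A) (fobj sigma B ⊸ B)
       (rlol (fobj sigma A) (fobj sigma B) A B (sigma_rel A B q) q)) q.

Lemma mu_rel n G T H u A B q a b :
  wf_ty n A = true -> wf_ty n B = true ->
  wf_rel n G T q A B -> defrel ext_ie n G T KAdm q A B ->
  hasty_i n G u (mu sigma) ->
  hasty_i n G a (fobj sigma A ⊸ A) -> hasty_i n G b (fobj sigma B ⊸ B) ->
  pr n G T H (PRel (rlol (fobj sigma A) (fobj sigma B) A B (sigma_rel A B q) q) a b) ->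
  pr n G T H (PRel q (App (TApp u A) (Bang a)) (App (TApp u B) (Bang b))).
Proof.
  intros WA WB Wq Dq Hu Ha Hb K.
  assert (S0 := parametricity n G T H _ _ (wf_mu sigma Hwf 0) Hu).
  eapply (interp_all_E n G T H 0) in S0; [| |intros; lia|..|exact WA|exact WB|exact Dq].
  2: cbn; now rewrite Hwf.
  2,3: rewrite upT_id, ty_sub_id; exact Hu.
  assert (Wr : wf_rel n G T (rlol (fobj sigma A) (fobj sigma B) A B (sigma_rel A B q) q)
     (fobj sigma A ⊸ A) (fobj sigma B ⊸ B)) by (apply wf_rlol; auto using wf_fobj, wf_sigma_rel).
  assert (Wa : wf_ty n (fobj sigma A ⊸ A) = true) by (simpl; now rewrite wf_fobj).
  assert (Wb : wf_ty n (fobj sigma B ⊸ B) = true) by (simpl; now rewrite wf_fobj).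
  assert (Wm : wf_rel n G T (mu_body_rel q A B)
     (TArr (fobj sigma A ⊸ A) A) (TArr (fobj sigma B ⊸ B) B))
    by (apply wf_rlol; auto; now apply wf_rbang).
  apply (rlol_E n G T H _ _ _ _ _ _ _ _ _ _ Wm (hasty_inst sigma _ _ _ _ Hu WA)
    (hasty_inst sigma _ _ _ _ Hu WB) (hasty_i_bang _ _ _ _ Ha) (hasty_i_bang _ _ _ _ Hb) S0).
  now apply rbang_I.
Qed.

Definition alg_eq (A B : ty) (a b h : tm) : prop :=
  PEq (fobj sigma A ⊸ B) (comp (fobj sigma A) h a)
    (comp (fobj sigma A) b (fmap sigma A B h)).

Lemma alg_eq_wk k A B a b h :
  prop_wk k (alg_eq A B a b h) = alg_eq A B (tm_wk k a) (tm_wk k b) (tm_wk k h).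
Proof.
  unfold alg_eq, prop_wk, tm_wk. cbn [prop_ren].
  rewrite !comp_ren, (fmap_ren _ Hwf), !ty_ren_id. reflexivity.
Qed.

Lemma mu_alg_map n G T H u A B a b h :
  wf_ty n A = true -> wf_ty n B = true -> hasty_i n G u (mu sigma) ->
  hasty_i n G a (fobj sigma A ⊸ A) -> hasty_i n G b (fobj sigma B ⊸ B) ->
  hasty_i n G h (A ⊸ B) ->
  In (alg_eq A B a b h) H ->
  pr n G T H (PEq B (App h (App (TApp u A) (Bang a))) (App (TApp u B) (Bang b))).
Proof.
  intros WA WB Hu Ha Hb Hh K.
  assert (Wg : wf_rel n G T (graph A B h) A B) by now apply wf_graph.
  assert (WfA := wf_fobj _ Hwf _ _ WA). assert (WfB := wf_fobj _ Hwf _ _ WB).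
  apply (graph_E n G T H A); auto.
  { apply (hasty_inst_app sigma); auto using hasty_i_unlin. }
  { apply (hasty_inst_app sigma); auto using hasty_i_unlin. }
  apply mu_rel; auto using adm_graph.
  apply rlol_I; auto using wf_rlol, wf_sigma_rel.
  rewrite sigma_rel_wk, graph_wk.
  apply (in_map (prop_wk 2)) in K. rewrite alg_eq_wk in K.
  set (G2 := _ :: _ :: G). set (H2 := _ :: map _ _).
  assert (N2 : nolin (map SInt G2)) by apply nolin_SInt.
  assert (H1 : hasty_i n G2 (Var 1) (fobj sigma A)) by now apply hasty_i_var.
  assert (H0 : hasty_i n G2 (Var 0) (fobj sigma B)) by now apply hasty_i_var.
  assert (Hh2 : hasty_i n G2 (tm_wk 2 h) (A ⊸ B)) by now apply hasty_i_wk2.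
  assert (Ha2 : hasty_i n G2 (tm_wk 2 a) (fobj sigma A ⊸ A)) by now apply hasty_i_wk2.
  assert (Hb2 : hasty_i n G2 (tm_wk 2 b) (fobj sigma B ⊸ B)) by now apply hasty_i_wk2.
  assert (Hm : hasty_i n G2 (fmap sigma A B (tm_wk 2 h)) (fobj sigma A ⊸ fobj sigma B))
    by now apply hasty_fmap.
  assert (Hc1 : hasty_i n G2 (comp (fobj sigma A) (tm_wk 2 h) (tm_wk 2 a)) (fobj sigma A ⊸ B))
    by (eapply hasty_comp; eauto).
  assert (Ha1 : hasty_i n G2 (App (tm_wk 2 a) (Var 1)) A) by eauto with hi.
  assert (Hm1 : hasty_i n G2 (App (fmap sigma A B (tm_wk 2 h)) (Var 1)) (fobj sigma B))
    by eauto with hi.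
  apply graph_I; auto; [eauto with hi..|].
  apply peq_trans with (App (comp (fobj sigma A) (tm_wk 2 h) (tm_wk 2 a)) (Var 1)); [eauto with hi|..].
  { apply prv_ext, ext_sym, (ext_comp_app _ _ _ A); auto. }
  apply peq_trans with (App (comp (fobj sigma A) (tm_wk 2 b) (fmap sigma A B (tm_wk 2 h))) (Var 1));
    [eauto with hi|..].
  { eapply peq_appl; [exact Hc1|exact H1|]. apply prv_hyp. right. exact K. }
  apply peq_trans with (App (tm_wk 2 b) (App (fmap sigma A B (tm_wk 2 h)) (Var 1))).
  { eapply hasty_i_app; [eapply hasty_comp; eauto|exact H1]. }
  { apply prv_ext, (ext_comp_app _ _ _ (fobj sigma B)); auto. }
  eapply peq_appr; [exact Hb2|exact Hm1|].
  apply sigma_graph; auto. apply prv_hyp. now left.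
Qed.

Lemma mu_inst_in n G T H u tau f :
  wf_ty n tau = true -> hasty_i n G u (mu sigma) -> hasty_i n G f (fobj sigma tau ⊸ tau) ->
  pr n G T H (PEq tau (App (TApp (App (TApp u (mu sigma)) (Bang (in_alg sigma))) tau) (Bang f))
                     (App (TApp u tau) (Bang f))).
Proof.
  intros W Hu Hf.
  assert (N : nolin (map SInt G)) by apply nolin_SInt.
  assert (Wm := wf_mu sigma Hwf n). assert (Wfm := wf_fobj _ Hwf _ _ Wm).
  assert (Hin : hasty_i n G (in_alg sigma) (fobj sigma (mu sigma) ⊸ mu sigma)) by now apply hasty_in.
  assert (Hv : hasty_i n G (App (TApp u (mu sigma)) (Bang (in_alg sigma))) (mu sigma))
    by (apply (hasty_inst_app sigma); auto using hasty_i_unlin).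
  assert (Hfo : hasty_i n G (fold_at sigma tau f) (mu sigma ⊸ tau)) by now apply hasty_fold_at.
  apply peq_trans with (App (fold_at sigma tau f) (App (TApp u (mu sigma)) (Bang (in_alg sigma)))).
  - apply (hasty_inst_app sigma); auto using hasty_i_unlin.
  - apply prv_ext, ext_sym, ext_fold_app; auto using hasty_i_unlin.
  - apply prv_cut with (alg_eq (mu sigma) tau (in_alg sigma) f (fold_at sigma tau f)).
    + constructor; [eapply hasty_comp; eauto|eapply hasty_comp; eauto; now apply hasty_fmap].
    + apply prv_ext. now apply ext_fold_hom.
    + apply mu_alg_map; auto. now left.
Qed.

Lemma mu_unfold : mu sigma = TAll (TArr (sigma ⊸ TVar 0) (TVar 0)).
Proof. reflexivity. Qed.

Lemma mu_in_id n G T H u :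
  hasty_i n G u (mu sigma) ->
  pr n G T H (PEq (mu sigma) (App (TApp u (mu sigma)) (Bang (in_alg sigma))) u).
Proof.
  intros Hu.
  assert (N : nolin (map SInt G)) by apply nolin_SInt.
  assert (Wm := wf_mu sigma Hwf n). assert (Wfm := wf_fobj _ Hwf _ _ Wm).
  assert (Hin : hasty_i n G (in_alg sigma) (fobj sigma (mu sigma) ⊸ mu sigma)) by now apply hasty_in.
  assert (Hv : hasty_i n G (App (TApp u (mu sigma)) (Bang (in_alg sigma))) (mu sigma))
    by (apply (hasty_inst_app sigma); auto using hasty_i_unlin).
  set (v := App _ _) in *.
  apply req_E; auto.
  eapply requiv_E1; [apply identity_closed, wf_mu; assumption|assumption..|].
  assert (Wr := wf_interp (mu sigma) 0 n G T TVar TVar req_var (wf_mu _ Hwf 0)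
     ltac:(intros; lia)).
  rewrite !mu_sub in Wr by assumption.
  assert (EI : interp TVar TVar req_var (mu sigma)
    = rall (TArr (sigma ⊸ TVar 0) (TVar 0)) (TArr (sigma ⊸ TVar 0) (TVar 0))
        (mu_body_rel (RVar 0) (TVar 1) (TVar 0))).
  { rewrite mu_unfold. cbn [interp]. rewrite !upT_id, !ty_sub_id. f_equal.
    transitivity (interp (TVar 1 .: TVar) (TVar 0 .: TVar) (RVar 0 .: req_var)
       (TArr (sigma ⊸ TVar 0) (TVar 0))); [|reflexivity].
    apply (interp_ext _ 1); [simpl; now rewrite Hwf|]. intros [|i] Hi; [auto|lia]. }
  rewrite EI in *. apply rall_I; auto.
  set (n2 := S (S n)) in *. set (Ga := ctx2 G). set (Ta := rctx2 T). set (Ha := map _ H).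
  assert (Wq : forall G', wf_rel n2 G' Ta (RVar 0) (TVar 1) (TVar 0)) by (intros; apply wf_rvar0).
  assert (Dq : forall G', defrel ext_ie n2 G' Ta KAdm (RVar 0) (TVar 1) (TVar 0))
    by (intros; apply defrel_rvar0).
  assert (W1 : wf_ty n2 (TVar 1) = true) by reflexivity.
  assert (W0 : wf_ty n2 (TVar 0) = true) by reflexivity.
  assert (Wf1 := wf_fobj _ Hwf _ _ W1). assert (Wf0 := wf_fobj _ Hwf _ _ W0).
  assert (Wl1 : wf_ty n2 (fobj sigma (TVar 1) ⊸ TVar 1) = true) by (simpl; now rewrite Wf1).
  assert (Wl0 : wf_ty n2 (fobj sigma (TVar 0) ⊸ TVar 0) = true) by (simpl; now rewrite Wf0).
  assert (Wsr : forall G', wf_rel n2 G' Ta (rlol (fobj sigma (TVar 1)) (fobj sigma (TVar 0))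
      (TVar 1) (TVar 0) (sigma_rel (TVar 1) (TVar 0) (RVar 0)) (RVar 0))
      (fobj sigma (TVar 1) ⊸ TVar 1) (fobj sigma (TVar 0) ⊸ TVar 0))
    by (intros; apply wf_rlol; auto using wf_sigma_rel).
  assert (Wb : forall G', wf_rel n2 G' Ta (rbang (fobj sigma (TVar 1) ⊸ TVar 1) (fobj sigma (TVar 0) ⊸ TVar 0)
      (rlol (fobj sigma (TVar 1)) (fobj sigma (TVar 0))
      (TVar 1) (TVar 0) (sigma_rel (TVar 1) (TVar 0) (RVar 0)) (RVar 0)))
      (TBang (fobj sigma (TVar 1) ⊸ TVar 1)) (TBang (fobj sigma (TVar 0) ⊸ TVar 0)))
    by (intros; now apply wf_rbang).
  assert (Hua : hasty_i n2 Ga (tm_wkall u) (mu sigma)).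
  { eapply hasty_cast; [exact (hasty_i_2 _ _ _ _ Hu)|]. apply mu_ren, Hwf. }
  assert (Ev : tm_wkall v = App (TApp (tm_wkall u) (mu sigma)) (Bang (in_alg sigma))).
  { unfold v, tm_wkall. cbn [tm_ren]. now rewrite mu_ren, in_ren. }
  rewrite Ev.
  assert (Hina : forall G', hasty_i n2 G' (in_alg sigma) (fobj sigma (mu sigma) ⊸ mu sigma))
    by (intros; apply hasty_in; auto with nolin).
  assert (Wm2 := wf_mu sigma Hwf n2).
  assert (Hvi : forall G' t, hasty_i n2 G' t (mu sigma) ->
     hasty_i n2 G' (App (TApp t (mu sigma)) (Bang (in_alg sigma))) (mu sigma))
    by (intros; apply (hasty_inst_app sigma); auto using hasty_i_unlin).
  apply rlol_I; auto.
  { apply wf_rlol; auto. }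
  { apply (hasty_inst sigma); [now apply Hvi|reflexivity]. }
  { now apply (hasty_inst sigma). }
  set (Gb := _ :: _ :: Ga). set (Hb := _ :: map _ Ha).
  assert (Ewk : forall t B, tm_wk 2 (TApp t B) = TApp (tm_wk 2 t) B)
    by (intros; unfold tm_wk; cbn [tm_ren]; now rewrite ty_ren_id).
  assert (Ewv : forall t, tm_wk 2 (App (TApp t (mu sigma)) (Bang (in_alg sigma)))
      = App (TApp (tm_wk 2 t) (mu sigma)) (Bang (in_alg sigma))).
  { intros; unfold tm_wk; cbn [tm_ren]. now rewrite ty_ren_id, in_ren. }
  rewrite !Ewk, Ewv.
  assert (Hub : hasty_i n2 Gb (tm_wk 2 (tm_wkall u)) (mu sigma)) by now apply hasty_i_wk2.
  set (ub := tm_wk 2 (tm_wkall u)) in *.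
  assert (Hvb := Hvi Gb ub Hub).
  change (rel_wk 2 (RVar 0)) with (RVar 0).
  assert (Esr : forall k, rel_wk k (rlol (fobj sigma (TVar 1)) (fobj sigma (TVar 0))
      (TVar 1) (TVar 0) (sigma_rel (TVar 1) (TVar 0) (RVar 0)) (RVar 0))
     = rlol (fobj sigma (TVar 1)) (fobj sigma (TVar 0))
      (TVar 1) (TVar 0) (sigma_rel (TVar 1) (TVar 0) (RVar 0)) (RVar 0)).
  { intros k. unfold rel_wk. rewrite rel_ren_sub, rlol_sub, <- !ty_ren_sub, <- !rel_ren_sub.
    rewrite sigma_rel_ren, !ty_ren_id. reflexivity. }
  eapply rbang_E; [exact Wl1|exact Wl0|apply Wsr|exact W1|exact W0|apply Wq|apply Dq
    |now apply hasty_i_var|now apply hasty_i_var|now apply (hasty_inst sigma)|now apply hasty_inst| |].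
  { apply prv_hyp. left. unfold rel_wk at 1. rewrite rel_ren_sub, rbang_sub, <- rel_ren_sub.
    fold (rel_wk 2 (rlol (fobj sigma (TVar 1)) (fobj sigma (TVar 0))
      (TVar 1) (TVar 0) (sigma_rel (TVar 1) (TVar 0) (RVar 0)) (RVar 0))).
    rewrite Esr, <- !ty_ren_sub, !ty_ren_id. reflexivity. }
  apply rarr_I; auto.
  { apply wf_rarr; auto. }
  { now apply (hasty_inst sigma). }
  { now apply (hasty_inst sigma). }
  rewrite Esr, !Ewk, Ewv. change (rel_wk 2 (RVar 0)) with (RVar 0).
  set (Gc := _ :: _ :: Gb). set (Hc := _ :: map _ Hb).
  assert (Huc : hasty_i n2 Gc (tm_wk 2 ub) (mu sigma)) by now apply hasty_i_wk2.
  set (uc := tm_wk 2 ub) in *.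
  assert (Hf1 : hasty_i n2 Gc (Var 1) (fobj sigma (TVar 1) ⊸ TVar 1)) by now apply hasty_i_var.
  assert (Hf0 : hasty_i n2 Gc (Var 0) (fobj sigma (TVar 0) ⊸ TVar 0)) by now apply hasty_i_var.
  assert (Hvc := Hvi Gc uc Huc).
  assert (Hvf : hasty_i n2 Gc (App (TApp (App (TApp uc (mu sigma)) (Bang (in_alg sigma))) (TVar 1)) (Bang (Var 1))) (TVar 1))
    by (apply (hasty_inst_app sigma); auto using hasty_i_unlin).
  assert (Huf : forall B f, wf_ty n2 B = true -> hasty_i n2 Gc f (fobj sigma B ⊸ B) ->
     hasty_i n2 Gc (App (TApp uc B) (Bang f)) B)
    by (intros; apply (hasty_inst_app sigma); auto using hasty_i_unlin).
  eapply rel_conv; [apply Wq|exact Hvf|exact (Huf _ _ W0 Hf0)| |exact (peq_refl _ _ _ _ _ _ (Huf _ _ W0 Hf0))|].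
  - apply peq_sym; [exact Hvf|]. now apply mu_inst_in.
  - apply mu_rel; auto. apply prv_hyp. now left.
Qed.

Lemma fold_unique n tau f h :
  wf_ty n tau = true -> hasty n [] f (fobj sigma tau ⊸ tau) -> hasty n [] h (mu sigma ⊸ tau) ->
  pr n [] [] [] (alg_eq (mu sigma) tau (in_alg sigma) f h) ->
  pr n [] [] [] (PEq (mu sigma ⊸ tau) h (fold_at sigma tau f)).
Proof.
  intros W Hf Hh K.
  change (hasty_i n [] f (fobj sigma tau ⊸ tau)) in Hf.
  change (hasty_i n [] h (mu sigma ⊸ tau)) in Hh.
  assert (Wm := wf_mu sigma Hwf n). assert (Wfm := wf_fobj _ Hwf _ _ Wm).
  assert (Hin : forall G, hasty_i n G (in_alg sigma) (fobj sigma (mu sigma) ⊸ mu sigma))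
    by (intros; apply hasty_in; auto with nolin).
  assert (Hfo : hasty_i n [] (fold_at sigma tau f) (mu sigma ⊸ tau))
    by (apply hasty_fold_at; auto with nolin).
  apply prv_cut with (2 := K).
  { assert (N : nolin (map SInt [])) by apply nolin_nil.
    constructor; [eapply hasty_comp; eauto; now apply Hin|eapply hasty_comp; eauto; now apply hasty_fmap]. }
  eapply prv_impE; [apply prv_Ax, ax_ext_lol; assumption|].
  apply prv_allVI; auto. cbn [map]. rewrite alg_eq_wk.
  replace (tm_wk 1 (in_alg sigma)) with (in_alg sigma) by (symmetry; now apply in_ren).
  unfold tm_wk at 4. rewrite (fold_at_ren _ Hwf), ty_ren_id.
  fold (tm_wk 1 f).
  assert (Hf1 : hasty_i n [mu sigma] (tm_wk 1 f) (fobj sigma tau ⊸ tau)) by now apply hasty_i_wk1.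
  assert (Hh1 : hasty_i n [mu sigma] (tm_wk 1 h) (mu sigma ⊸ tau)) by now apply hasty_i_wk1.
  assert (Hu : hasty_i n [mu sigma] (Var 0) (mu sigma)) by now apply hasty_i_var.
  assert (Hv : hasty_i n [mu sigma] (App (TApp (Var 0) (mu sigma)) (Bang (in_alg sigma))) (mu sigma))
    by (apply (hasty_inst_app sigma); auto using hasty_i_unlin).
  eapply peq_trans; [eapply hasty_i_app; [exact Hh1|exact Hu]|
    eapply peq_appr; [exact Hh1|exact Hu|apply peq_sym; [exact Hv|now apply mu_in_id]]|].
  eapply peq_trans; [eapply hasty_i_app; [exact Hh1|exact Hv]|
    apply mu_alg_map; [exact Wm|exact W|exact Hu|apply Hin|exact Hf1|exact Hh1|now left]|].
  apply prv_ext, ext_sym, ext_fold_app; auto using hasty_i_unlin.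
Qed.

End Fix_sigma.

Theorem theorem2p24 (sigma : ty)
  (Hwf : wf_ty 1 sigma = true)
  (Hind : ind_constructed sigma)
  (Hpos : polarised true 0 sigma = true)
  (n : nat) :
  (forall (tau : ty) (f h : tm),
     wf_ty n tau = true ->
     hasty n [] f (fobj sigma tau ⊸ tau) ->
     hasty n [] h (mu sigma ⊸ tau) ->
     prv ext_ie n [] [] []
       (PEq (fobj sigma (mu sigma) ⊸ tau)
            (comp (fobj sigma (mu sigma)) h (in_alg sigma))
            (comp (fobj sigma (mu sigma)) f (fmap sigma (mu sigma) tau h))) ->
     prv ext_ie n [] [] []
       (PEq (mu sigma ⊸ tau) h (App (TApp (fold sigma) tau) (Bang f))))
  /\ initial_algebra n sigma (mu sigma) (in_alg sigma).
Proof.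
  assert (U := fold_unique sigma Hwf Hpos n). split; [exact U|].
  split; [split; [now apply wf_mu|apply hasty_in; auto with nolin]|].
  intros B b [WB Hb]. exists (fold_at sigma B b). split; [split|].
  - apply hasty_fold_at; auto with nolin.
  - apply prv_ext. apply ext_fold_hom; auto with nolin.
  - intros h' [Hh' E]. now apply U.
Qed.
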